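(* Let $M$ be a compact, oriented $C^\infty$ surface with boundary $\partial M$, embedded in $\mathbb{R}^3$, with unit normal $\mathbf{N}$, area element $dA$ and Gaussian curvature $K$. If $\mathbf{V}$ is a continuously differentiable tangent vector field on $M$ with $\|\mathbf{V}\|=1$ everywhere on $M$, then $$\int_{\partial M}(\mathbf{V}\times\mathbf{N})\cdot d\mathbf{V}=\int_M K\,dA.$$
   Context: $\mathbf{N}$ is the unit normal vector field given by the orientation, and $\partial M$ carries the orientation induced from $M$ as in Stokes' theorem. A tangent vector field is regarded as an $\mathbb{R}^3$-valued function $\mathbf{V}$ on $M$ with $\mathbf{V}\cdot\mathbf{N}=0$; for $\mathbb{R}^3$-valued functions $\mathbf{U},\mathbf{W}$, $\int_{\partial M}\mathbf{U}\cdot d\mathbf{W}=\int_{\partial M}\sum_i U_i\,dW_i$. The Gaussian curvature is $K=\kappa_1\kappa_2$, the product of the principal curvatures. *)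

(* Defs.v *)
From mathcomp Require Import all_boot all_order all_algebra.
From mathcomp Require Import all_classical all_reals all_analysis.

Set Implicit Arguments.
Unset Strict Implicit.
Unset Printing Implicit Defensive.

Import Order.TTheory GRing.Theory Num.Theory.
Import numFieldNormedType.Exports.

Local Open Scope classical_set_scope.
Local Open Scope ring_scope.

(* Euclidean geometry of R^3. The library norm `|u| on 'rV[R]_3 is the sup
   norm: it gives the right topology but not the right length, hence enorm. *)

Definition dotmul {R : realType} (u v : 'rV[R]_3) : R := (u *m v^T) 0 0.

Definition enorm {R : realType} (u : 'rV[R]_3) : R := Num.sqrt (dotmul u u).

(* Indices are added modulo 3 in 'I_3. *)
Definition crossmul {R : realType} (u v : 'rV[R]_3) : 'rV[R]_3 :=
  \row_(i < 3) (u 0 (i + 1) * v 0 (i + 2) - u 0 (i + 2) * v 0 (i + 1)).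

(* f is of class C^k on the open set A: for k > 0, f is differentiable on A
   and all its directional derivatives are of class C^(k-1). *)
Fixpoint class_C {R : realType} {V W : normedModType R} (k : nat)
    (A : set V) (f : V -> W) : Prop :=
  match k with
  | 0 => forall x, A x -> {for x, continuous f}
  | k'.+1 => (forall x, A x -> differentiable f x) /\
             (forall v : V, class_C k' A ('D_v f))
  end.

Definition smooth {R : realType} {V W : normedModType R}
    (A : set V) (f : V -> W) : Prop := forall k, class_C k A f.

(* F is of class C^k on the arbitrary subset M: near each point of M it is the
   restriction to M of a C^k function defined on an open set of the ambient
   space. Only the values of F on M matter. *)
Definition class_C_on {R : realType} {V W : normedModType R} (k : nat)
    (M : set V) (F : V -> W) : Prop :=
  forall p, M p -> exists (A : set V) (G : V -> W),
    [/\ open A, A p, class_C k A G & forall q, M q -> A q -> G q = F q].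

Definition half_plane {R : realType} : set (R * R) := [set x | 0 <= x.2].

Definition partial_u {R : realType} (phi : R * R -> 'rV[R]_3) (x : R * R) :
  'rV[R]_3 := 'D_(1, 0) phi x.

Definition partial_v {R : realType} (phi : R * R -> 'rV[R]_3) (x : R * R) :
  'rV[R]_3 := 'D_(0, 1) phi x.

Definition normal_product {R : realType} (phi : R * R -> 'rV[R]_3)
    (x : R * R) : 'rV[R]_3 := crossmul (partial_u phi x) (partial_v phi x).

Definition patch_image {R : realType} (O : set (R * R))
    (phi : R * R -> 'rV[R]_3) : set 'rV[R]_3 :=
  phi @` (O `&` half_plane).

(* phi restricted to O `&` half_plane is a regular local parametrization of M:
   a smooth immersion (the values of phi on the rest of O only serve to give a
   meaning to smoothness at v = 0) which is a homeomorphism onto a relatively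
   open subset of M. The last clause is that openness, for the image and for
   the map at once. Interior points are covered by taking O inside v > 0;
   points phi (u, 0) are the boundary points of M. *)
Definition patch {R : realType} (M : set 'rV[R]_3) (O : set (R * R))
    (phi : R * R -> 'rV[R]_3) : Prop :=
  [/\ open O,
      smooth O phi,
      forall x, O x -> half_plane x ->
        free [:: partial_u phi x; partial_v phi x],
      forall x y, O x -> half_plane x -> O y -> half_plane y ->
        phi x = phi y -> x = y
    & forall A : set (R * R), open A -> A `<=` O ->
        exists2 W : set 'rV[R]_3, open W & patch_image A phi = M `&` W].

(* M is a smooth surface with (possibly empty) boundary embedded in R^3. *)
Definition surface_with_boundary {R : realType} (M : set 'rV[R]_3) : Prop :=
  forall p, M p -> exists O phi, patch M O phi /\ patch_image O phi p.

(* A patch whose coordinates (u, v) induce the unit normal N. *)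
Definition oriented_patch {R : realType} (M : set 'rV[R]_3)
    (N : 'rV[R]_3 -> 'rV[R]_3) (O : set (R * R))
    (phi : R * R -> 'rV[R]_3) : Prop :=
  patch M O phi /\
  forall x, O x -> half_plane x ->
    N (phi x) = (enorm (normal_product phi x))^-1 *: normal_product phi x.

(* An orientation of M is given by an atlas of patches inducing the same
   field N of unit normals on M. (Any two such patches have a transition map of
   positive Jacobian, and every such atlas determines N.) *)
Definition orientation {R : realType} (M : set 'rV[R]_3)
    (N : 'rV[R]_3 -> 'rV[R]_3) : Prop :=
  forall p, M p -> exists O phi, oriented_patch M N O phi /\
    patch_image O phi p.

(* The matrix L (acting on row vectors) is a derivative of F at p along M; if M
   is a surface, its restriction to the tangent plane of M at p is unique. *)
Definition derivative_along {R : realType} (M : set 'rV[R]_3)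
    (F : 'rV[R]_3 -> 'rV[R]_3) (p : 'rV[R]_3) (L : 'M[R]_3) : Prop :=
  forall e : R, 0 < e -> \forall q \near within M (nbhs p),
    `|F q - F p - (q - p) *m L| <= e * `|q - p|.

(* k1, k2 are the eigenvalues, with multiplicity, of the shape operator -dN_p
   of the tangent plane, i.e. of the orthogonal complement of N p. *)
Definition principal_curvatures {R : realType} (M : set 'rV[R]_3)
    (N : 'rV[R]_3 -> 'rV[R]_3) (p : 'rV[R]_3) (k1 k2 : R) : Prop :=
  exists (L : 'M[R]_3) (w1 w2 : 'rV[R]_3),
    [/\ derivative_along M N p L,
        dotmul w1 (N p) = 0 /\ dotmul w2 (N p) = 0,
        free [:: w1; w2]
      & - (w1 *m L) = k1 *: w1 /\ - (w2 *m L) = k2 *: w2].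

(* The product of the principal curvatures; the default value 0 of xget is
   never used at a point of an oriented surface. *)
Definition gaussian_curvature {R : realType} (M : set 'rV[R]_3)
    (N : 'rV[R]_3 -> 'rV[R]_3) (p : 'rV[R]_3) : R :=
  xget 0 [set K | exists k1 k2, principal_curvatures M N p k1 k2 /\
                                K = k1 * k2].

(* A finite family of oriented patches with a smooth partition of unity on M
   subordinate to it. *)
Definition partition_of_unity {R : realType} (M : set 'rV[R]_3)
    (N : 'rV[R]_3 -> 'rV[R]_3) (n : nat) (O : 'I_n -> set (R * R))
    (phi : 'I_n -> R * R -> 'rV[R]_3) (rho : 'I_n -> 'rV[R]_3 -> R) : Prop :=
  [/\ forall i, oriented_patch M N (O i) (phi i),
      forall i, smooth setT (rho i),
      forall i p, 0 <= rho i p,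
      forall i, closure [set p | M p /\ rho i p != 0] `<=`
        patch_image (O i) (phi i)
    & forall p, M p -> \sum_(i < n) rho i p = 1].

(* The integral of f dA over a compact M, where dA = |phi_u x phi_v| du dv in
   a patch. The value does not depend on the partition of unity that xget
   selects, and one exists when M is compact and oriented by N, so that the
   default value 0 is not used. *)
Definition surface_integral {R : realType} (M : set 'rV[R]_3)
    (N : 'rV[R]_3 -> 'rV[R]_3) (f : 'rV[R]_3 -> R) : R :=
  xget 0 [set I | exists n O phi rho,
    @partition_of_unity R M N n O phi rho /\
    I = \sum_(i < n)
          Rintegral (lebesgue_measure \x lebesgue_measure)%E
            (O i `&` half_plane)
            (fun x => rho i (phi i x) * f (phi i x) *
                      enorm (normal_product (phi i) x))].

(* The integral of U . dW over the boundary of a compact M. In an oriented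
   patch the boundary is the image of t |-> phi (t, 0). The outward pointing
   vector being - phi_v, (- phi_v, phi_u) is a positive frame and increasing t
   is the boundary orientation of Stokes' theorem. Again the value does not
   depend on the partition of unity. *)
Definition boundary_integral {R : realType} (M : set 'rV[R]_3)
    (N : 'rV[R]_3 -> 'rV[R]_3) (U W : 'rV[R]_3 -> 'rV[R]_3) : R :=
  xget 0 [set I | exists n O phi rho,
    @partition_of_unity R M N n O phi rho /\
    I = \sum_(i < n)
          Rintegral lebesgue_measure [set t : R | O i (t, 0)]
            (fun t => rho i (phi i (t, 0)) *
                      dotmul (U (phi i (t, 0)))
                             (derive1 (fun s : R => W (phi i (s, 0))) t))].

(* Main.v *)
From HB Require Import structures.
Require Import Defs.
From mathcomp Require Import all_boot all_order all_algebra.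
From mathcomp Require Import all_classical all_reals all_analysis.
From mathcomp Require Import measurable_realfun ring lra.
Import Order.TTheory GRing.Theory Num.Theory.
Import numFieldNormedType.Exports.
Set Implicit Arguments.
Unset Strict Implicit.
Unset Printing Implicit Defensive.
Local Open Scope classical_set_scope.
Local Open Scope ring_scope.

(** Let U = V x N and let omega be the restriction of U . dV to M, the connection
    form of the frame (V, U). Differentiating the relations of the frame
    (V, U, N) gives, in any oriented patch,
      U_u . V_v - U_v . V_u = (N_u x N_v) . N = K |phi_u x phi_v|,
    that is d omega = K dA, and the formula is Stokes' theorem for omega.
    Since V is only C1, omega has no exterior derivative in the usual sense;
    but omega is locally a sum of forms F dG with F and G of class C1, and Green's
    formula for int F dG only involves F_u G_v - F_v G_u: the derivative of
    v |-> int F G_u du exists and can be computed by an integration by parts in u.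
    Two partitions of unity rho_i, rho'_j are compared by moving the integrals of
    rho_i rho'_j f from one patch to another. This change of variables follows from
    a comparison of the measures of the two preimages of a small compact set, up to
    a factor 1 + e: a transition map is nearly linear on it. The terms d rho_i /\
    omega add up to zero because sum_i rho_i = 1 on M. *)

(** * Lebesgue measure in the plane *)

(** Both integrals are values selected by [xget], possibly from two different partitions of unity.
    Hence the statement proved is that the boundary sum of any partition equals the surface sum of
    any other one; Stokes' theorem and the independence of the partition come together in
    [partition_stokes]. In a patch, [N] and [V] are given only where v >= 0, while derivatives live
    on open sets. They are replaced by C1 functions on open sets of the plane ([unit_normal],
    [field_local_extension]) that agree with them in the half plane, and the derivatives at v = 0
    are shown to depend only on values there, through increments h > 0. The extension of [V] changes
    from point to point, so Green's formula is assembled from local data [green_data], whose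
    coefficients a, b, k are nevertheless fixed on the whole patch. The norm on the plane is the sup
    norm, whose balls are squares. A map with Lipschitz constant L therefore multiplies the area of
    a compact set by at most L^2, with no dimensional constant; L can be taken close to 1, which is
    what makes a change of variables up to 1 + e possible. *)

Section planar_measure.
Context {R : realType}.
Local Notation mu1 := (@lebesgue_measure R).
Local Notation mu2 := (@lebesgue_measure R \x @lebesgue_measure R)%E.
Local Notation RR := (measurableTypeR R * measurableTypeR R)%type.

(** The plane carries the product sigma-algebra, so an open set has to be exhibited as a countable
    union of rectangles: the squares with rational centre and radius [1/(n+1)] that lie in [A],
    enumerated through [unpickle]. *)
Lemma open_measurable2 (A : set (R * R)) :
  open A -> measurable (A : set RR).
Proof.
move=> oA.
pose B (q : rat * rat * nat) : set (R * R) :=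
  ball (ratr q.1.1 : R) q.2.+1%:R^-1 `*` ball (ratr q.1.2 : R) q.2.+1%:R^-1.
pose C n : set (R * R) := if unpickle n is Some q then
  if `[< B q `<=` A >] then B q else set0 else set0.
have -> : A = \bigcup_n C n.
  apply/seteqP; split => [[x y] Axy|x [q _]]; last first.
    by rewrite /C; case: unpickle => // {}q; case: asboolP => // + Bqx; exact.
  have /nbhs_ballP[e /= e0 eA] := open_nbhs_nbhs (conj oA Axy : open_nbhs (x, y) A).
  have [n ne] : exists n : nat, n.+1%:R^-1 < e / 2.
    have e2 : 0 < e / 2 by rewrite divr_gt0.
    have [n _ /(_ n (leqnn n))] := near_infty_natSinv_lt (PosNum e2).
    by move=> ?; exists n.
  have n0 : 0 < n.+1%:R^-1 :> R by rewrite invr_gt0.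
  pose d : R := n.+1%:R^-1; rewrite -/d in ne n0.
  have dE : n.+1%:R^-1 = d by [].
  have [p px] : exists p : rat, `|x - ratr p| < d.
    have /rat_in_itvoo[p /=] : x - d < x + d by lra.
    by rewrite in_itv/= => /andP[h1 h2]; exists p; rewrite ltr_norml; apply/andP; split; lra.
  have [q qy] : exists q : rat, `|y - ratr q| < d.
    have /rat_in_itvoo[q /=] : y - d < y + d by lra.
    by rewrite in_itv/= => /andP[h1 h2]; exists q; rewrite ltr_norml; apply/andP; split; lra.
  have CE : C (pickle (p, q, n)) = if `[< B (p, q, n) `<=` A >] then B (p, q, n) else set0.
    by rewrite /C pickleK.
  exists (pickle (p, q, n)); [by []|rewrite CE asboolT].
    by split => /=; rewrite /ball/= dE distrC.
  move=> [u v] [/= bu bv]; apply: eA; split => /=.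
    move: bu; rewrite /ball/= dE => bu.
    rewrite (_ : x - u = (x - ratr p) + (ratr p - u)); last by ring.
    by apply: (le_lt_trans (ler_normD _ _)); rewrite (splitr e); apply: ltrD; apply: lt_trans ne.
  move: bv; rewrite /ball/= dE => bv.
  rewrite (_ : y - v = (y - ratr q) + (ratr q - v)); last by ring.
  by apply: (le_lt_trans (ler_normD _ _)); rewrite (splitr e); apply: ltrD; apply: lt_trans ne.
apply: (@bigcup_measurable _ RR) => n _; rewrite /C.
case: unpickle => [q|]; last exact: measurable0.
case: ifP => _; last exact: measurable0.
by apply: measurableX; apply: open_measurable; exact: ball_open.
Qed.

Lemma closed_measurable2 (A : set (R * R)) :
  closed A -> measurable (A : set RR).
Proof.
by move=> /closed_openC/open_measurable2/measurableC; rewrite setCK.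
Qed.

Lemma compact_measurable2 (A : set (R * R)) :
  compact A -> measurable (A : set RR).
Proof.
move=> cA; apply: closed_measurable2; apply: compact_closed cA.
exact: norm_hausdorff.
Qed.

Lemma bounded_lt_measure2 (A : set (R * R)) :
  bounded_set A -> measurable (A : set RR) -> (mu2 A < +oo)%E.
Proof.
move=> [M [_ /(_ (M + 1))]] /(_ ltac:(lra)) bA mA.
have : A `<=` `[- (M + 1), M + 1] `*` `[- (M + 1), M + 1].
  move=> x /bA; rewrite /= prod_normE ge_max !in_itv/= => /andP[].
  by rewrite !ler_norml.
move=> sA; apply: (@le_lt_trans _ _ (mu2 (`[- (M + 1), M + 1] `*` `[- (M + 1), M + 1]))).
  by apply: le_measure => //; rewrite inE//; exact: measurableX.
have fI : (mu1 `[(- (M + 1))%R, (M + 1)%R] < +oo)%E.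
  by rewrite lebesgue_measure_itv/=; case: ifP; rewrite ltry.
have -> : (mu2 (`[(- (M + 1))%R, (M + 1)%R] `*` `[(- (M + 1))%R, (M + 1)%R]) =
    mu1 `[(- (M + 1))%R, (M + 1)%R] * mu1 `[(- (M + 1))%R, (M + 1)%R])%E.
  exact: product_measure1E.
by apply: lte_mul_pinfty => //; rewrite ge0_fin_numE.
Qed.

Lemma compact_lt_measure2 (A : set (R * R)) :
  compact A -> (mu2 A < +oo)%E.
Proof.
by move=> cA; apply: bounded_lt_measure2; [exact: compact_bounded|exact: compact_measurable2].
Qed.

Lemma continuous_measurable_fun2 (A : set (R * R)) (f : R * R -> R) :
  compact A -> {within A, continuous f} -> measurable_fun (A : set RR) f.
Proof.
move=> cA /continuousP cf mA; apply: (measurability _ (RGenOpens.measurableE R)) => //.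
move=> _ [_ [a [b ->] <-]].
have /open_subspaceP[W oW WA] : open (f @^-1` `]a, b[ : set (subspace A)).
  exact/cf/interval_open.
rewrite setIC -WA; apply: measurableI => //; exact: open_measurable2.
Qed.

Lemma compact_continuous_bounded {T : topologicalType} (A : set T) (f : T -> R) :
  compact A -> {within A, continuous f} -> exists2 K, 0 < K & forall x, A x -> `|f x| <= K.
Proof.
move=> cA cf; have /compact_bounded [K [_ HK]] := continuous_compact cf cA.
exists (Num.max (K + 1) 1); first by rewrite lt_max ltr01 orbT.
by move=> x Ax; apply: HK; [rewrite lt_max ltrDl ltr01|exists x].
Qed.

Lemma continuous_integrable2 (A : set (R * R)) (f : R * R -> R) :
  compact A -> {within A, continuous f} -> mu2.-integrable (A : set RR) (EFin \o f).
Proof.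
move=> cA cf; apply: measurable_bounded_integrable.
- exact: compact_measurable2.
- exact: compact_lt_measure2.
- exact: continuous_measurable_fun2.
- have [K _ HK] := compact_continuous_bounded cA cf.
  exists K; split; first by rewrite num_real.
  by move=> r Kr x Ax /=; rewrite (le_trans (HK _ Ax))// ltW.
Qed.

End planar_measure.

(** * Linear changes of variables in the plane *)

Section linear_change.
Context {R : realType}.
Local Notation mu1 := (@lebesgue_measure R).
Local Notation mu2 := (@lebesgue_measure R \x @lebesgue_measure R)%E.
Local Notation RR := (measurableTypeR R * measurableTypeR R)%type.

(** The pushforward scaled by [|a|] agrees with Lebesgue measure on half-open intervals, and
    uniqueness concludes. For [a < 0] the preimage of such an interval is closed on the other side,
    which does not change its length. *)
Lemma lebesgue_measure_affine_preimage (a t : R) (A : set R) : a != 0 -> measurable A ->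
  (`|a|%:E * mu1 ((fun v => (a * v + t)%R) @^-1` A) = mu1 A)%E.
Proof.
move=> a0 mA.
pose f : measurableTypeR R -> measurableTypeR R := fun v => a * v + t.
have mf : measurable_fun setT f.
  by apply: measurable_funD => //; exact: measurable_funM.
apply/esym.
pose m : {measure set (measurableTypeR R) -> \bar R} :=
  mscale (NngNum (normr_ge0 a)) (measure_function_pushforward__canonical__measure_function_Measure mu1 mf).
apply: (@lebesgue_measure_unique _ m) => //= _ [[x y]] _ <-.
rewrite /m /mscale/= /pushforward lebesgue_measure_itv/=.
have [ap|an|] := ltgtP a 0; last by move/eqP: a0.
- have -> : f @^-1` `]x, y]%classic = `[(y - t) / a, (x - t) / a[%classic.
    apply/seteqP; split => z; rewrite /f/= !in_itv/= => /andP[h1 h2]; apply/andP; split.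
    + by rewrite ler_ndivrMr//; lra.
    + by rewrite ltr_ndivlMr//; lra.
    + by move: h2; rewrite ltr_ndivlMr//; lra.
    + by move: h1; rewrite ler_ndivrMr//; lra.
  rewrite lebesgue_measure_itv/= !lte_fin ltr_nM2r ?invr_lt0// ltrBlDr subrK.
  case: ifPn => _; last by rewrite mule0.
  by rewrite -!EFinD -EFinM ltr0_norm//; congr EFin; field.
- have -> : f @^-1` `]x, y]%classic = `](x - t) / a, (y - t) / a]%classic.
    apply/seteqP; split => z; rewrite /f/= !in_itv/= => /andP[h1 h2]; apply/andP; split.
    + by rewrite ltr_pdivrMr//; lra.
    + by rewrite ler_pdivlMr//; lra.
    + by move: h1; rewrite ltr_pdivrMr//; lra.
    + by move: h2; rewrite ler_pdivlMr//; lra.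
  rewrite lebesgue_measure_itv/= !lte_fin ltr_pM2r ?invr_gt0// ltrBlDr subrK.
  case: ifPn => _; last by rewrite mule0.
  by rewrite -!EFinD -EFinM gtr0_norm//; congr EFin; field.
Qed.

Definition plane_map (a b c d : R) (x : R * R) : R * R :=
  (a * x.1 + b * x.2, c * x.1 + d * x.2).

Lemma measurable_plane_map a b c d :
  measurable_fun setT (plane_map a b c d : RR -> RR).
Proof.
apply: measurable_fun_pair.
  by apply: measurable_funD; apply: measurable_funM.
by apply: measurable_funD; apply: measurable_funM.
Qed.

Lemma measurable_plane_map_preimage a b c d (X : set RR) : measurable X ->
  measurable (plane_map a b c d @^-1` X : set RR).
Proof. by move=> mX; rewrite -(setTI (_ @^-1` _)); exact: measurable_plane_map. Qed.

(** Phrased with preimages, so that measurability is automatic and the property passes to products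
    of matrices. *)
Definition det_scaling a b c d := forall X : set RR, measurable X ->
  (`|(a * d - b * c)%R|%:E * mu2 (plane_map a b c d @^-1` X) = mu2 X)%E.

Lemma det_scaling_comp a b c d a' b' c' d' :
  det_scaling a b c d -> det_scaling a' b' c' d' ->
  det_scaling (a' * a + b' * c) (a' * b + b' * d) (c' * a + d' * c) (c' * b + d' * d).
Proof.
move=> h h' X mX; rewrite -(h' X mX) -(h _ (measurable_plane_map_preimage a' b' c' d' mX)).
rewrite muleA -EFinM -normrM; congr (_%:E * mu2 _)%E; first by congr `|_|; ring.
rewrite -comp_preimage; congr (_ @^-1` X).
by apply/funext => x; rewrite /plane_map/=; congr pair; ring.
Qed.

Lemma det_scaling_swap : det_scaling 0 1 1 0.
Proof.
move=> X mX; rewrite mul0r mul1r sub0r normrN normr1 mul1e.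
apply/esym.
pose m : {measure set RR -> \bar R} :=
  measure_function_pushforward__canonical__measure_function_Measure mu2 (measurable_plane_map 0 1 1 0).
apply: (@product_measure_unique _ _ _ _ _ mu1 mu1 m) => // A B mA mB.
rewrite /m/= /pushforward.
have -> : plane_map 0 1 1 0 @^-1` (A `*` B) = B `*` A.
  by apply/seteqP; split => x; rewrite /plane_map/= !mul0r !mul1r add0r addr0 => -[].
by rewrite product_measure1E// muleC.
Qed.

Lemma det_scaling_diag (a d : R) : a != 0 -> d != 0 -> det_scaling a 0 0 d.
Proof.
move=> a0 d0 X mX; rewrite mulr0 subr0; apply/esym.
pose m : {measure set RR -> \bar R} := mscale (NngNum (normr_ge0 (a * d)))
  (measure_function_pushforward__canonical__measure_function_Measure mu2 (measurable_plane_map a 0 0 d)).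
apply: (@product_measure_unique _ _ _ _ _ mu1 mu1 m) => // A B mA mB.
rewrite /m/= /mscale/= /pushforward.
have -> : plane_map a 0 0 d @^-1` (A `*` B) =
    ((fun v => a * v + 0) @^-1` A) `*` ((fun v => d * v + 0) @^-1` B).
  by apply/seteqP; split => x; rewrite /plane_map/= !mul0r !add0r !addr0 => -[].
have maff (e : R) C : measurable C -> measurable ((fun v => e * v + 0) @^-1` C : set (measurableTypeR R)).
  move=> mC; rewrite -(setTI (_ @^-1` _)).
  have mf : measurable_fun setT ((fun v => e * v + 0) : measurableTypeR R -> measurableTypeR R).
    by apply: measurable_funD => //; exact: measurable_funM.
  exact: mf.
rewrite product_measure1E; [|exact: maff|exact: maff].
rewrite normrM EFinM muleACA; congr (_ * _)%E; exact: lebesgue_measure_affine_preimage.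
Qed.

(** The product measure integrates the lengths of the sections at fixed [u], and a shear only
    translates each of these sections. *)
Lemma det_scaling_shear c : det_scaling 1 0 c 1.
Proof.
move=> X mX; rewrite mulr1 mul0r subr0 normr1 mul1e /product_measure1/=.
apply: eq_integral => u _ /=.
have mXu : measurable (xsection X u) by exact: measurable_xsection.
rewrite -(@lebesgue_measure_affine_preimage 1 (c * u) (xsection X u)) ?oner_eq0//.
rewrite normr1 mul1e; congr (mu1 _).
apply/seteqP; split => v; rewrite /xsection/= !inE/= /plane_map/= !mul1r mul0r addr0;
  by rewrite addrC.
Qed.

(** Gaussian elimination: if [a != 0] the matrix is a lower shear times [diag(a, det / a)] times an
    upper shear, the upper shear being a lower one conjugated by the swap. If [a = 0], the rows are
    exchanged first. *)
Lemma det_scalingP (a b c d : R) : a * d - b * c != 0 -> det_scaling a b c d.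
Proof.
have main (a' b' c' d' : R) : a' != 0 -> a' * d' - b' * c' != 0 -> det_scaling a' b' c' d'.
  move=> a0 dn0.
  have up : det_scaling 1 (b' / a') 0 1.
    have := det_scaling_comp det_scaling_swap
      (det_scaling_comp (det_scaling_shear (b' / a')) det_scaling_swap).
    by rewrite !(mul0r, mul1r, mulr0, mulr1, add0r, addr0).
  have := det_scaling_comp up (det_scaling_comp
    (det_scaling_diag a0 (mulf_neq0 dn0 (invr_neq0 a0))) (det_scaling_shear (c' / a'))).
  rewrite !(mul0r, mul1r, mulr0, mulr1, add0r, addr0).
  rewrite (_ : a' * (b' / a') = b'); last by field.
  rewrite (_ : c' / a' * a' = c'); last by field.
  by rewrite (_ : c' * (b' / a') + _ = d'); last by field.
have [a0 dn0|a0 dn0] := eqVneq a 0; last exact: main.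
have c0 : c != 0 by apply: contraNneq dn0 => ->; rewrite a0 mul0r mulr0 subr0.
have dn0' : c * b - d * a != 0.
  by apply: contra_neq dn0 => h; rewrite -(@oppr0 R) -h; ring.
have := det_scaling_comp (main c d a b c0 dn0') det_scaling_swap.
by rewrite !(mul0r, mul1r, mulr0, mulr1, add0r, addr0).
Qed.

End linear_change.

(** * Area of Lipschitz images *)

Section lipschitz_area.
Context {R : realType}.
Local Notation mu1 := (@lebesgue_measure R).
Local Notation mu2 := (@lebesgue_measure R \x @lebesgue_measure R)%E.
Local Notation RR := (measurableTypeR R * measurableTypeR R)%type.

Lemma diameter_subset_square (B : set (R * R)) (l : R) : B !=set0 ->
  (forall x y, B x -> B y -> `|x - y| <= l) ->
  exists a : R * R, B `<=` `[a.1, a.1 + l] `*` `[a.2, a.2 + l].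
Proof.
move=> [b Bb] Bl.
have side (p : R * R -> R) : (forall x y, `|p x - p y| <= `|x - y|) ->
    exists a, forall x, B x -> a <= p x <= a + l.
  move=> pl; exists (inf [set p x | x in B]) => x Bx; apply/andP; split.
    apply: ge_inf; last by exists x.
    exists (p b - l) => _ [y By <-].
    by have := le_trans (pl b y) (Bl _ _ Bb By); rewrite ler_norml => /andP[]; lra.
  rewrite -lerBlDr; apply: lb_le_inf; first by exists (p b), b.
  move=> _ [y By <-].
  by have := le_trans (pl x y) (Bl _ _ Bx By); rewrite ler_norml => /andP[]; lra.
have [|a1 h1] := side fst; first by move=> x y; rewrite prod_normE le_max lexx.
have [|a2 h2] := side snd; first by move=> x y; rewrite prod_normE le_max lexx orbT.
by exists (a1, a2) => x Bx; split; rewrite /= in_itv/=; [exact: h1|exact: h2].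
Qed.

Lemma measure2_square_cc (a b l : R) : 0 <= l ->
  mu2 (`[a, (a + l)%R] `*` `[b, (b + l)%R]) = (l * l)%:E.
Proof.
move=> l0.
have side (c : R) : mu1 `[c, (c + l)%R]%classic = l%:E.
  rewrite lebesgue_measure_itv/= lte_fin ltrDl; case: ltP => h; first by rewrite -EFinD addrC addKr.
  by congr EFin; apply/eqP; rewrite eq_le l0 h.
have -> : (mu2 (`[a, (a + l)%R] `*` `[b, (b + l)%R]) =
    mu1 `[a, (a + l)%R] * mu1 `[b, (b + l)%R])%E by exact: product_measure1E.
by rewrite !side EFinM.
Qed.

Lemma measure2_square_co (a b l : R) : 0 <= l ->
  mu2 (`[a, (a + l)%R[ `*` `[b, (b + l)%R[) = (l * l)%:E.
Proof.
move=> l0.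
have side (c : R) : mu1 `[c, (c + l)%R[%classic = l%:E.
  rewrite lebesgue_measure_itv/= lte_fin ltrDl; case: ltP => h; first by rewrite -EFinD addrC addKr.
  by congr EFin; apply/eqP; rewrite eq_le l0 h.
have -> : (mu2 (`[a, (a + l)%R[ `*` `[b, (b + l)%R[) =
    mu1 `[a, (a + l)%R[ * mu1 `[b, (b + l)%R[)%E by exact: product_measure1E.
by rewrite !side EFinM.
Qed.

Definition thickening (r : R) (A : set (R * R)) : set (R * R) :=
  \bigcup_(x in A) ball x r.

Lemma measurable_thickening r (A : set (R * R)) : measurable (thickening r A : set RR).
Proof. by apply: open_measurable2; apply: bigcup_open => x _; exact: ball_open. Qed.

(** The square of half side [m] is cut into half-open cells of side [h = 2 * m / (N + 1)]. The part
    of [A] in a cell has its image in a square of side [L * h], and the cells that meet [A] are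
    disjoint and lie within distance [h] of [A]. *)
Lemma lipschitz_measure2_thickening (A : set (R * R)) (g : R * R -> R * R) (L m : R) (N : nat) :
  0 <= L -> 0 < m -> (forall x, A x -> `|x| < m) ->
  (forall x y, A x -> A y -> `|g x - g y| <= L * `|x - y|) ->
  measurable (g @` A : set RR) ->
  (mu2 (g @` A) <= (L * L)%:E * mu2 (thickening (2 * m / N.+1%:R) A))%E.
Proof.
move=> L0 m0 Am gL mgA.
pose h := 2 * m / N.+1%:R.
have h0 : 0 < h by rewrite divr_gt0 ?mulr_gt0.
have Lh0 : 0 <= L * h by rewrite mulr_ge0// ltW.
have hN : N.+1%:R * h = 2 * m by rewrite /h mulrC mulfVK.
pose I (i : nat) : set R := `[- m + i%:R * h, - m + i%:R * h + h[%classic.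
have disjI i j x : I i x -> I j x -> i = j.
  rewrite /I/= !in_itv/= => /andP[i1 i2] /andP[j1 j2].
  have le_ij k l : - m + k%:R * h <= x -> x < - m + l%:R * h + h -> (k <= l)%N.
    move=> h1 h2; rewrite -ltnS -(ltr_nat R) -(ltr_pM2r h0) -natr1; lra.
  by apply/eqP; rewrite eqn_leq !le_ij.
have findI x : `|x| < m -> exists2 i, (i < N.+1)%N & I i x.
  rewrite ltr_norml => /andP[x1 x2].
  have xm0 : 0 <= (x + m) / h by rewrite divr_ge0 ?ltW//; lra.
  exists (Num.truncn ((x + m) / h)).
    rewrite -(ltr_nat R); apply: (@le_lt_trans _ _ ((x + m) / h)); first by rewrite truncn_le.
    by rewrite ltr_pdivrMr// hN; lra.
  have /andP[] := truncn_itv xm0.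
  rewrite ler_pdivlMr// ltr_pdivrMr// /I/= in_itv/= => h1.
  by rewrite -natr1 mulrDl mul1r => h2; apply/andP; split; lra.
(* One index [k] encodes the column and the row of a cell as quotient and remainder by [N + 1]. *)
pose Q k : set (R * R) := I (k %/ N.+1)%N `*` I (k %% N.+1)%N.
have Qdiam k x y : Q k x -> Q k y -> `|x - y| <= h /\ `|x - y| < h.
  suff H : Q k x -> Q k y -> `|x - y| < h by move=> a b; split; [rewrite ltW// H|rewrite H].
  move=> [/= x1 x2] [/= y1 y2]; move: x1 x2 y1 y2; rewrite /I /= !in_itv/=.
  move=> /andP[? ?] /andP[? ?] /andP[? ?] /andP[? ?].
  by rewrite prod_normE gt_max !ltr_norml/=; apply/andP; split; apply/andP; split; lra.
have mI i : measurable (I i : set (measurableTypeR R)) by exact: measurable_itv.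
have mQ k : measurable (Q k : set RR) by exact: measurableX.
pose hit k := `[< A `&` Q k !=set0 >].
pose F k : set RR := if hit k then Q k else set0.
have ex_a : forall k, exists a : R * R, g @` (A `&` Q k) `<=`
    `[a.1, a.1 + L * h] `*` `[a.2, a.2 + L * h].
  move=> k; have [[x0 AQx0]|nh] := pselect (A `&` Q k !=set0); last first.
    by exists 0 => _ [x AQx <-]; exfalso; apply: nh; exists x.
  apply: diameter_subset_square; first by exists (g x0), x0.
  move=> _ _ [x [Ax Qx] <-] [y [Ay Qy] <-].
  rewrite (le_trans (gL _ _ Ax Ay))// ler_wpM2l//.
  by case: (Qdiam k x y Qx Qy).
have [a aP] := choice ex_a.
pose G k : set RR := if hit k then
  `[(a k).1, (a k).1 + L * h] `*` `[(a k).2, (a k).2 + L * h] else set0.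
have mF k : measurable (F k).
  by rewrite /F; case: ifP => _; [exact: mQ|exact: measurable0].
have mG k : measurable (G k).
  by rewrite /G; case: ifP => _; [exact: measurableX|exact: measurable0].
have muGF k : mu2 (G k) = ((L * L)%:E * mu2 (F k))%E.
  rewrite /G /F; case: ifP => _; last by rewrite !measure0 mule0.
  rewrite /Q /I (measure2_square_cc _ _ Lh0) (measure2_square_co _ _ (ltW h0)).
  by rewrite -EFinM mulrACA.
have covA x : A x -> exists2 k, (k < N.+1 * N.+1)%N & Q k x.
  move=> Ax; have := Am x Ax; rewrite prod_normE gt_max => /andP[x1 x2].
  have [i iN Ix1] := findI _ x1; have [j jN Ix2] := findI _ x2.
  exists (i * N.+1 + j)%N.
    have : (i * N.+1 + j < i * N.+1 + N.+1)%N by rewrite ltn_add2l.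
    by move/leq_trans; apply; rewrite addnC -mulSn leq_mul2r iN orbT.
  rewrite /Q divnMDl// divn_small// addn0 modnMDl modn_small//.
have hitx x k : A x -> Q k x -> hit k by move=> Ax Qx; apply/asboolP; exists x.
apply: (@le_trans _ _ (\sum_(k < N.+1 * N.+1) mu2 (G k))%E).
  apply: content_subadditive => // _ [x Ax <-].
  have [k kN Qx] := covA x Ax.
  apply: (bigsetU_sup kN); rewrite /G (hitx x)//.
  by apply: aP; exists x.
under eq_bigr do rewrite muGF.
rewrite -ge0_sume_distrr//.
rewrite -(@measure_bigsetU _ _ _ mu2 F)//; last first.
  apply/trivIsetP => i j _ _ ij; apply/seteqP; split => // x [].
  rewrite /F; case: ifP => // _ [i1 i2]; case: ifP => // _ [j1 j2].
  move/eqP: ij; apply.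
  by rewrite (divn_eq i N.+1) (divn_eq j N.+1) (disjI _ _ _ i1 j1) (disjI _ _ _ i2 j2).
apply: lee_wpmul2l; first by rewrite lee_fin mulr_ge0.
apply: le_measure.
- by rewrite inE; exact: bigsetU_measurable.
- by rewrite inE; exact: measurable_thickening.
rewrite -bigcup_mkord => x [k _]; rewrite /F.
case: ifPn => // /asboolP[y [Ay Qy]] Qx; exists y => //=.
by rewrite -ball_normE/=; case: (Qdiam k y x Qy Qx).
Qed.

(** As the mesh tends to 0 the thickenings decrease to [A], because [A] is closed, and continuity
    from above applies to their measures. *)
Lemma lipschitz_measure2 (A : set (R * R)) (g : R * R -> R * R) (L : R) :
  0 <= L -> compact A ->
  (forall x y, A x -> A y -> `|g x - g y| <= L * `|x - y|) ->
  measurable (g @` A : set RR) ->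
  (mu2 (g @` A) <= (L * L)%:E * mu2 A)%E.
Proof.
move=> L0 cA gL mgA.
have [M [_ HM]] := compact_bounded cA.
pose m := Num.max (M + 1) 0 + 1.
have m0 : 0 < m by rewrite ltr_wpDl// le_max lexx orbT.
have Am x : A x -> `|x| < m.
  move=> Ax; rewrite ltr_pwDr//; apply: le_trans (HM (M + 1) _ x Ax) _; first by rewrite ltrDl.
  by rewrite le_max lexx.
pose T n := thickening (2 * m / n.+1%:R) A : set RR.
have Tcvg : (mu2 \o T) n @[n --> \oo] --> mu2 (\bigcap_n T n).
  apply: nonincreasing_cvg_mu => //=.
  - apply: bounded_lt_measure2; last exact: measurable_thickening.
    (* The first thickening has radius [2 * m] around a set of points of norm less than [m]. Its
       finite measure is what continuity from above requires. *)
    exists (3 * m); split; first exact: num_real.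
    move=> x mx y [z Az]; rewrite -ball_normE/= divr1 => zy.
    rewrite (_ : y = z - (z - y)); last by rewrite subKr.
    rewrite (le_trans (ler_normB _ _))//; have := Am _ Az; lra.
  - by move=> i; exact: measurable_thickening.
  - by apply: bigcap_measurable => // k _; exact: measurable_thickening.
  - move=> i j ij; apply/subsetPset => x [y Ay yx]; exists y => //.
    apply: le_ball yx; rewrite ler_pM2l ?mulr_gt0//.
    by rewrite lef_pV2 ?posrE// ler_nat ltnS.
have TA : \bigcap_n T n = A.
  apply/seteqP; split => [x Tx|x Ax n _]; last first.
    by exists x => //; apply: ballxx; rewrite divr_gt0 ?mulr_gt0.
  have : closed A by apply: compact_closed cA; exact: norm_hausdorff.
  apply => B /nbhs_ballP[e /= e0 eB].
  have e1 : 0 < e / (2 * m) by rewrite divr_gt0 ?mulr_gt0.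
  have [n _ /(_ n (leqnn n))] := near_infty_natSinv_lt (PosNum e1).
  rewrite /= ltr_pdivlMr ?mulr_gt0// mulrC => ne.
  have [y Ay yx] := Tx n I.
  by exists y; split => //; apply: eB; apply: le_ball (ball_sym yx); exact: ltW.
rewrite TA in Tcvg.
have c := cvgeZl (isT : (L * L)%:E \is a fin_num) Tcvg.
rewrite -(cvg_lim _ c)//.
apply: lime_ge; first by apply/cvg_ex; eexists; exact: c.
by apply: nearW => n; exact: lipschitz_measure2_thickening.
Qed.

End lipschitz_area.

(** * Green's formula on a rectangle *)

Section plane_calculus.
Context {R : realType}.

Definition C1on (A : set (R * R)) (f : R * R -> R) : Prop := forall x, A x ->
  [/\ differentiable f x, {for x, continuous ('D_(1, 0) f)}
    & {for x, continuous ('D_(0, 1) f)}].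

Lemma is_derive_slice1 (f : R * R -> R) (u v : R) : differentiable f (u, v) ->
  is_derive u (1 : R) (fun t => f (t, v)) ('D_(1, 0) f (u, v)).
Proof.
move=> df; have fE h : f (h *: (1 : R) + u, v) = f (h *: ((1, 0) : R * R) + (u, v)).
  by congr f; congr pair; rewrite /= ?scaler0 ?add0r.
split; rewrite /derivable /derive/=; under eq_fun do rewrite fE.
  exact: diff_derivable df.
by [].
Qed.

Lemma is_derive_slice2 (f : R * R -> R) (u v : R) : differentiable f (u, v) ->
  is_derive v (1 : R) (fun t => f (u, t)) ('D_(0, 1) f (u, v)).
Proof.
move=> df; have fE h : f (u, h *: (1 : R) + v) = f (h *: ((0, 1) : R * R) + (u, v)).
  by congr f; congr pair; rewrite /= ?scaler0 ?add0r.
split; rewrite /derivable /derive/=; under eq_fun do rewrite fE.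
  exact: diff_derivable df.
by [].
Qed.

(** Only [x] is confined to [K]: [f] is continuous in the ambient space at the points of [K], so [y]
    may leave [K]. The uniform radius comes from the near-covering form of compactness. *)
Lemma compact_uniformly_continuous {V W : normedModType R} (K : set V) (f : V -> W) :
  compact K -> (forall x, K x -> {for x, continuous f}) -> forall e : R, 0 < e ->
  exists2 d : R, 0 < d & forall x y, K x -> `|x - y| < d -> `|f x - f y| < e.
Proof.
move=> cK cf e e0.
have /compact_near_coveringP/(_ _ (0 : R)^'+
   (fun d x => forall y, `|x - y| < d -> `|f x - f y| < e) _) := cK.
case.
  move=> x Kx.
  have /cvgrPdist_lt/(_ (e / 2)) := cf x Kx.
  rewrite divr_gt0// => /(_ isT)/nbhs_normP[r /= r0 hr].
  near=> x' d => y /= x'y.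
  have xx' : `|x - x'| < r / 2.
    near: x'; apply/nbhs_normP; exists (r / 2) => //=; exact: divr_gt0.
  have dr : d < r / 2 by near: d; apply: nbhs_right_lt; exact: divr_gt0.
  have h1 : `|f x - f x'| < e / 2 by apply: hr => /=; lra.
  have h2 : `|f x - f y| < e / 2.
    apply: hr => /=; rewrite (le_lt_trans (ler_distD x' _ _))//; lra.
  rewrite /= (le_lt_trans (ler_distD (f x) _ _))// (distrC (f x')); lra.
move=> d0 /= d00 hd; exists (d0 / 2); first exact: divr_gt0.
move=> x y Kx; apply: (hd (d0 / 2)) => //=; last exact: divr_gt0.
by rewrite sub0r normrN gtr0_norm ?divr_gt0//; lra.
Unshelve. all: by end_near. Qed.

Lemma is_derive_continuous (g : R -> R) (x dg : R) : is_derive x 1 g dg -> {for x, continuous g}.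
Proof.
move=> dg1; apply: differentiable_continuous; apply/derivable1_diffP.
exact: ex_derive.
Qed.

Lemma continuous_within (T U : topologicalType) (A : set T) (g : T -> U) :
  (forall x, A x -> {for x, continuous g}) -> {within A, continuous g}.
Proof. by move=> cg; apply: continuous_in_subspaceT => x; rewrite inE => /cg. Qed.

Lemma within_continuousP (V W : normedModType R) (A : set V) (f : V -> W) :
  {within A, continuous f} <-> forall x, A x -> forall e : R, 0 < e ->
    exists2 r : R, 0 < r & forall y, A y -> `|x - y| < r -> `|f x - f y| < e.
Proof.
split=> [/subspace_continuousP cf x Ax e e0|H].
  have /cvgrPdist_lt/(_ e e0) := cf x Ax.
  rewrite near_withinE => /nbhs_normP[r /= r0 hr].
  by exists r => // y Ay xy; exact: hr.
apply/subspace_continuousP => x Ax; apply/cvgrPdist_lt => e e0.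
have [r r0 hr] := H x Ax e e0.
rewrite near_withinE; apply/nbhs_normP; exists r => //= y xy Ay.
exact: hr.
Qed.

(** The endpoints come in either order, so increments of both signs are treated at once. *)
Lemma MVT_between (g dg : R -> R) (v w : R) :
  (forall t, Num.min v w <= t <= Num.max v w -> is_derive t 1 g (dg t)) ->
  exists2 t, Num.min v w <= t <= Num.max v w & g w - g v = dg t * (w - v).
Proof.
move=> dgP.
have cg (x y : R) : (forall t : R, x <= t <= y -> is_derive t 1 g (dg t)) -> {within `[x, y], continuous g}.
  move=> H; apply: continuous_within => t; rewrite /= in_itv/= => /H.
  exact: is_derive_continuous.
have [vw|wv] := leP v w.
- rewrite (min_idPl vw) (max_idPr vw) in dgP *.
  have [||t tvw E] := @MVT_segment _ g dg v w vw.
  + by move=> t; rewrite in_itv/= => /andP[h1 h2]; apply: dgP; rewrite !ltW.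
  + exact: cg.
  by exists t; rewrite // in_itv/= in tvw.
- rewrite (min_idPr (ltW wv)) (max_idPl (ltW wv)) in dgP *.
  have [||t tvw E] := @MVT_segment _ g dg w v (ltW wv).
  + by move=> t; rewrite in_itv/= => /andP[h1 h2]; apply: dgP; rewrite !ltW.
  + exact: cg.
  exists t; first by rewrite in_itv/= in tvw.
  by rewrite -(opprB (g v)) E -mulrN opprB.
Qed.

(** The mean value theorem turns the increment into a derivative at an intermediate point, and
    uniform continuity of that derivative on the rectangle makes [r] independent of [u] and [v]. *)
Lemma C1on_increment2 (A : set (R * R)) (f : R * R -> R) (a b c d : R) :
  C1on A f -> `[a, b] `*` `[c, d] `<=` A -> forall e, 0 < e -> exists2 r : R, 0 < r &
    forall u v w, a <= u <= b -> c <= v <= d -> c <= w <= d -> `|w - v| < r ->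
      `|f (u, w) - f (u, v) - (w - v) * 'D_(0, 1) f (u, v)| <= e * `|w - v|.
Proof.
move=> Cf sA e e0.
have cK : compact (`[a, b] `*` `[c, d]).
  by apply: compact_setX; exact: segment_compact.
have cDf x : (`[a, b] `*` `[c, d]) x -> {for x, continuous ('D_(0, 1) f)}.
  by move=> /sA/Cf[].
have [r r0 hr] := compact_uniformly_continuous cK cDf e0.
exists r => // u v w uab vcd wcd vw.
have betw t : Num.min v w <= t <= Num.max v w -> c <= t <= d /\ `|v - t| <= `|w - v|.
  move: vcd wcd => /andP[v1 v2] /andP[w1 w2].
  have [h|h] := leP v w => /andP[t1 t2]; (split; first by apply/andP; split; lra).
    by rewrite distrC !ger0_norm; lra.
  by rewrite distrC !ler0_norm; lra.
have [|t /betw[tcd tvw] E] := @MVT_between (fun t => f (u, t)) (fun t => 'D_(0, 1) f (u, t)) v w.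
  move=> t /betw[tcd _]; apply: is_derive_slice2.
  by have [] := Cf (u, t) (sA _ _); [split; rewrite /= in_itv|].
rewrite E mulrC -mulrBr normrM mulrC ler_wpM2r// ltW//.
rewrite distrC; apply: hr; first by split; rewrite /= in_itv.
by rewrite prod_normE/= subrr normr0 gt_max (le_lt_trans (normr_ge0 _) vw) (le_lt_trans tvw vw).
Qed.

End plane_calculus.

(** Both sides integrate one and the same function extended by zero. This is how the open domains in
    the definitions of the integrals are shrunk to compact supports. *)
Lemma Rintegral_subset {R : realType} d (T : measurableType d) (mu : {measure set T -> \bar R}) (A B : set T) (f : T -> R) :
  B `<=` A -> (forall x, A x -> ~ B x -> f x = 0) -> Rintegral mu A f = Rintegral mu B f.
Proof.
move=> BA f0; rewrite Rintegral_mkcond [RHS]Rintegral_mkcond; congr Rintegral.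
apply/funext => x; rewrite !patchE.
case: ifPn => [|]; rewrite ?inE ?notin_setE => h; case: ifPn => [|]; rewrite ?inE ?notin_setE => h' //.
  exact: f0.
by exfalso; apply: h; exact: BA.
Qed.

Section interval_integrals.
Context {R : realType}.
Local Notation mu1 := (@lebesgue_measure R).

Lemma itv_integrable (a b : R) (h : R -> R) : {within `[a, b], continuous h} ->
  mu1.-integrable `[a, b] (EFin \o h).
Proof. by move=> ch; apply: continuous_compact_integrable => //; exact: segment_compact. Qed.

Lemma itv_integral_bound (a b B : R) (h : R -> R) : a <= b ->
  {within `[a, b], continuous h} -> (forall u, a <= u <= b -> `|h u| <= B) ->
  `|\int[mu1]_(u in `[a, b]) h u| <= B * (b - a).
Proof.
move=> ab ch hB.
have mab : measurable (`[a, b]%classic : set (measurableTypeR R)) by exact: measurable_itv.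
apply: le_trans (le_normr_Rintegral mab (itv_integrable ch)) _.
have ca : {within `[a, b], continuous (fun=> B : R)} by apply: continuous_within => x _; exact: cst_continuous.
have cn : {within `[a, b], continuous (fun u => `|h u|)}.
  by move=> x; apply: (@continuous_comp _ _ _ (h : subspace _ -> R) (fun z => `|z|)); [exact: ch|exact: norm_continuous].
have -> : B * (b - a) = \int[mu1]_(u in `[a, b]) B.
  rewrite Rintegral_cst//; congr (_ * _); change (b - a = fine (mu1 `[a, b]%classic)).
  rewrite lebesgue_measure_itv/= lte_fin; case: ltP => h1; first by rewrite -EFinD.
  by rewrite /=; apply/eqP; rewrite subr_eq0 eq_le h1 ab.
apply: le_Rintegral => //; try exact: itv_integrable.
Qed.

Lemma itv_integral_derive (a b : R) (H h : R -> R) : a < b ->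
  (forall u, a <= u <= b -> is_derive u 1 H (h u)) -> {within `[a, b], continuous h} ->
  \int[mu1]_(u in `[a, b]) h u = H b - H a.
Proof.
move=> ab dH ch; rewrite /Rintegral (@continuous_FTC2 _ h H a b)//.
- have cH u : a <= u <= b -> {for u, continuous H} by move=> /dH; exact: is_derive_continuous.
  split.
  + move=> u; rewrite in_itv/= => /andP[h1 h2].
    by apply: (@ex_derive _ _ _ _ _ _ (h u)); apply: dH; rewrite !ltW.
  + by apply: cvg_at_right_filter; apply: cH; rewrite lexx ltW.
  + by apply: cvg_at_left_filter; apply: cH; rewrite lexx ltW.
- move=> u; rewrite in_itv/= => /andP[h1 h2]; rewrite derive1E.
  have hu : a <= u <= b by rewrite !ltW.
  by have /@derive_val := dH u hu.
Qed.

Lemma slice_continuous1 (a b c d v : R) (H : R * R -> R) :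
  (forall x, (`[a, b] `*` `[c, d]) x -> {for x, continuous H}) -> c <= v <= d ->
  {within `[a, b], continuous (fun u => H (u, v))}.
Proof.
move=> cH vcd; apply: continuous_within => u uab.
apply: (@continuous_comp _ _ _ (fun u => (u, v)) H); last by apply: cH; split; rewrite //= in_itv.
by apply: (@cvg_pair _ _ _ _ (nbhs u) (nbhs v)); [exact: cvg_id|exact: cvg_cst].
Qed.

End interval_integrals.

Section green_rectangle.
Context {R : realType}.
Local Notation mu1 := (@lebesgue_measure R).
Local Notation mu2 := (@lebesgue_measure R \x @lebesgue_measure R)%E.
Context (A : set (R * R)) (F G : R * R -> R) (a b c d : R).
Hypotheses (ab : a < b) (cd : c < d).
Hypotheses (CF : C1on A F) (CG : C1on A G).
Hypothesis sA : `[a, b] `*` `[c, d] `<=` A.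
Hypotheses (Fa : forall v, c <= v <= d -> F (a, v) = 0)
           (Fb : forall v, c <= v <= d -> F (b, v) = 0).

Local Notation Q := (`[a, b] `*` `[c, d]).
Local Notation Du H := ('D_(1, 0) H).
Local Notation Dv H := ('D_(0, 1) H).

Let cQ : compact (Q : set (R * R)).
Proof. by apply: compact_setX; exact: segment_compact. Qed.

Let Quv u v : a <= u <= b -> c <= v <= d -> Q (u, v).
Proof. by move=> h1 h2; split; rewrite /= in_itv. Qed.

Definition cont_at_Q (H : R * R -> R) := forall x, Q x -> {for x, continuous H}.

Lemma C1on_cont_at (H : R * R -> R) : C1on A H -> cont_at_Q H.
Proof. by move=> CH x /sA/CH[dH _ _]; exact: differentiable_continuous. Qed.

Lemma C1on_cont_at1 (H : R * R -> R) : C1on A H -> cont_at_Q (Du H).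
Proof. move=> CH x /sA/CH[_ cu _]; exact: cu. Qed.

Lemma C1on_cont_at2 (H : R * R -> R) : C1on A H -> cont_at_Q (Dv H).
Proof. move=> CH x /sA/CH[_ _ cv]; exact: cv. Qed.

Lemma cont_at_QM (H K : R * R -> R) : cont_at_Q H -> cont_at_Q K -> cont_at_Q (fun x => H x * K x).
Proof. by move=> cH cK x Qx; apply: continuousM; [exact: cH|exact: cK]. Qed.

Lemma cont_at_QB (H K : R * R -> R) : cont_at_Q H -> cont_at_Q K -> cont_at_Q (fun x => H x - K x).
Proof. by move=> cH cK x Qx; apply: continuousB; [exact: cH|exact: cK]. Qed.

(** Minus the density of [dF /\ dG]: formally, the [v]-derivative of [F * Du G] after an integration
    by parts in [u]. *)
Let curl x := Dv F x * Du G x - Du F x * Dv G x.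

Let ccurl : cont_at_Q curl.
Proof.
apply: (@cont_at_QB (fun x => Dv F x * Du G x) (fun x => Du F x * Dv G x)).
  by apply: cont_at_QM; [exact: C1on_cont_at2 CF|exact: C1on_cont_at1 CG].
by apply: cont_at_QM; [exact: C1on_cont_at1 CF|exact: C1on_cont_at2 CG].
Qed.

Let al v := \int[mu1]_(u in `[a, b]) (F (u, v) * Du G (u, v)).
Let be v := \int[mu1]_(u in `[a, b]) curl (u, v).

Lemma cont_at_Q_bounded (H : R * R -> R) : cont_at_Q H ->
  exists2 B, 0 < B & forall u v, a <= u <= b -> c <= v <= d -> `|H (u, v)| <= B.
Proof.
move=> cH; have [B B0 hB] := compact_continuous_bounded cQ (continuous_within cH).
by exists B => // u v h1 h2; apply: hB; exact: Quv.
Qed.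

Let slice_cont H v : cont_at_Q H -> c <= v <= d ->
  {within `[a, b], continuous (fun u => H (u, v))}.
Proof. exact: slice_continuous1. Qed.

(* Only first derivatives of G enter: the increment of v |-> int F G_u du is
   integrated by parts in u before dividing by the increment of v. *)
Lemma green_increment e : 0 < e -> exists2 r, 0 < r &
  forall v w, c <= v <= d -> c <= w <= d -> `|w - v| < r ->
    `|al w - al v - (w - v) * be v| <= e * `|w - v|.
Proof.
move=> e0.
have [B1 B10 hB1] := cont_at_Q_bounded (C1on_cont_at1 CG).
have [B2 B20 hB2] := cont_at_Q_bounded (C1on_cont_at2 CF).
have [B3 B30 hB3] := cont_at_Q_bounded (C1on_cont_at1 CF).
pose B := B1 + B2 + B3.
have B0 : 0 < B by rewrite /B; lra.
(* The integrand below is bounded by [e' * B * |w - v|], where [B] collects the bounds of the three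
   cofactors; integration over an interval of length [b - a] then gives exactly [e * |w - v|]. *)
pose e' := e / (B * (b - a)).
have e'0 : 0 < e' by rewrite divr_gt0// mulr_gt0// subr_gt0.
have [r1 r10 hr1] := C1on_increment2 CF sA e'0.
have [r2 r20 hr2] := C1on_increment2 CG sA e'0.
have [r3 r30 hr3] := compact_uniformly_continuous cQ (C1on_cont_at1 CG) e'0.
exists (Num.min r1 (Num.min r2 r3)); first by rewrite !lt_min r10 r20.
move=> v w vcd wcd; rewrite !lt_min => /andP[wr1 /andP[wr2 wr3]].
pose H1 u := F (u, w) * Du G (u, w).
pose H2 u := F (u, v) * Du G (u, v).
(* [H3] is the [u]-derivative of [F (u, v) * (G (u, w) - G (u, v))], which vanishes at [a] and [b],
   so its integral is 0. Subtracting it trades the increment of [Du G], which has no linear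
   approximation in [v], for one of [G]. *)
pose H3 u := Du F (u, v) * (G (u, w) - G (u, v)) + F (u, v) * (Du G (u, w) - Du G (u, v)).
have cF := C1on_cont_at CF; have cG := C1on_cont_at CG.
have cuF := C1on_cont_at1 CF; have cuG := C1on_cont_at1 CG.
have c1 : {within `[a, b], continuous H1} by apply: (@slice_cont (fun x => F x * Du G x)) => //; exact: cont_at_QM.
have c2 : {within `[a, b], continuous H2} by apply: (@slice_cont (fun x => F x * Du G x)) => //; exact: cont_at_QM.
have cs H z : cont_at_Q H -> c <= z <= d -> {within `[a, b], continuous (fun u => H (u, z))}.
  exact: slice_cont.
have cB (f g : R -> R) : {within `[a, b], continuous f} -> {within `[a, b], continuous g} ->
    {within `[a, b], continuous (fun u => f u - g u)}.
  by move=> cf cg x; apply: (@continuousB _ _ (subspace `[a, b]) f g x); [exact: cf|exact: cg].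
have cD (f g : R -> R) : {within `[a, b], continuous f} -> {within `[a, b], continuous g} ->
    {within `[a, b], continuous (fun u => f u + g u)}.
  by move=> cf cg x; apply: (@continuousD _ _ (subspace `[a, b]) f g x); [exact: cf|exact: cg].
have cM (f g : R -> R) : {within `[a, b], continuous f} -> {within `[a, b], continuous g} ->
    {within `[a, b], continuous (fun u => f u * g u)}.
  by move=> cf cg x; apply: (@continuousM _ (subspace `[a, b]) f g x); [exact: cf|exact: cg].
have c3 : {within `[a, b], continuous H3}.
  apply: (cD (fun u => Du F (u, v) * (G (u, w) - G (u, v)))
    (fun u => F (u, v) * (Du G (u, w) - Du G (u, v)))).
    apply: (cM (fun u => Du F (u, v)) (fun u => G (u, w) - G (u, v))); first exact: (cs (fun x => Du F x)).
    by apply: (cB (fun u => G (u, w)) (fun u => G (u, v))); exact: (cs G).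
  apply: (cM (fun u => F (u, v)) (fun u => Du G (u, w) - Du G (u, v))); first exact: (cs F).
  by apply: (cB (fun u => Du G (u, w)) (fun u => Du G (u, v))); exact: (cs (fun x => Du G x)).
have c4 : {within `[a, b], continuous (fun u => (w - v) * curl (u, v))}.
  apply: (cM (fun=> w - v) (fun u => curl (u, v))); last exact: (cs curl).
  by apply: continuous_within => x _; exact: cst_continuous.
have I3 : \int[mu1]_(u in `[a, b]) H3 u = 0.
  have dH3 u : a <= u <= b -> is_derive u (1 : R) (fun u => F (u, v) * (G (u, w) - G (u, v))) (H3 u).
    move=> uab.
    have dF : is_derive u (1 : R) (fun t => F (t, v)) (Du F (u, v)).
      by apply: is_derive_slice1; have [] := CF (sA (Quv uab vcd)).
    have dG1 : is_derive u (1 : R) (fun t => G (t, w)) (Du G (u, w)).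
      by apply: is_derive_slice1; have [] := CG (sA (Quv uab wcd)).
    have dG2 : is_derive u (1 : R) (fun t => G (t, v)) (Du G (u, v)).
      by apply: is_derive_slice1; have [] := CG (sA (Quv uab vcd)).
    have dP := is_deriveM dF (is_deriveB dG1 dG2).
    apply: (is_derive_eq dP).
    by rewrite /H3 /GRing.scale/= addrC mulrC.
  by rewrite (itv_integral_derive ab dH3 c3) Fa// Fb// !mul0r subrr.
have iI (f : R -> R) : {within `[a, b], continuous f} -> mu1.-integrable `[a, b] (EFin \o f).
  exact: itv_integrable.
have mab : measurable (`[a, b]%classic : set (measurableTypeR R)) by exact: measurable_itv.
have -> : al w - al v - (w - v) * be v =
    \int[mu1]_(u in `[a, b]) (H1 u - H2 u - H3 u - (w - v) * curl (u, v)).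
  rewrite RintegralB//; [|by apply: iI; apply: (cB (fun u => H1 u - H2 u) H3) => //; exact: (cB H1 H2)|exact: iI].
  rewrite RintegralB//; [|by apply: iI; exact: (cB H1 H2)|exact: iI].
  rewrite RintegralB//; [|exact: iI|exact: iI].
  by rewrite I3 subr0 RintegralZl//; apply: iI; exact: (cs curl).
have -> : e * `|w - v| = (e' * B * `|w - v|) * (b - a).
  rewrite /e'; field; rewrite subr_eq0 gt_eqF//=.
  by rewrite gt_eqF.
apply: itv_integral_bound; first exact: ltW.
  apply: (cB (fun u => H1 u - H2 u - H3 u) (fun u => (w - v) * curl (u, v))) => //.
  by apply: (cB (fun u => H1 u - H2 u) H3) => //; exact: (cB H1 H2).
move=> u uab.
(* Each term has one small factor: the linearization error of [F], the increment of [Du G], the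
   linearization error of [G]. *)
have -> : H1 u - H2 u - H3 u - (w - v) * curl (u, v) =
    (F (u, w) - F (u, v) - (w - v) * Dv F (u, v)) * Du G (u, w)
    + (w - v) * Dv F (u, v) * (Du G (u, w) - Du G (u, v))
    - Du F (u, v) * (G (u, w) - G (u, v) - (w - v) * Dv G (u, v)).
  rewrite /H1 /H2 /H3 /curl.
  move: (F (u, w)) (F (u, v)) (Du F (u, v)) (Dv F (u, v)) (G (u, w)) (G (u, v)) (Dv G (u, v))
    (Du G (u, w)) (Du G (u, v)) => *; ring.
have hF := hr1 u v w uab vcd wcd wr1.
have hG := hr2 u v w uab vcd wcd wr2.
have hGu : `|Du G (u, w) - Du G (u, v)| <= e'.
  rewrite ltW//; apply: hr3; first exact: Quv.
  by rewrite prod_normE/= subrr normr0 gt_max wr3 (le_lt_trans (normr_ge0 _) wr3).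
have b1 := hB1 u w uab wcd; have b2 := hB2 u v uab vcd; have b3 := hB3 u v uab vcd.
have n0 := normr_ge0 (w - v).
apply: (le_trans (ler_normB _ _)); apply: (@le_trans _ _
  (e' * `|w - v| * B1 + `|w - v| * B2 * e' + B3 * (e' * `|w - v|))); last first.
  by rewrite /B le_eqVlt; apply/orP; left; apply/eqP; ring.
apply: lerD; last by rewrite normrM; apply: ler_pM.
apply: (le_trans (ler_normD _ _)); apply: lerD; first by rewrite normrM; apply: ler_pM.
by rewrite !normrM; apply: ler_pM => //; rewrite ?mulr_ge0//; apply: ler_pM.
Qed.

End green_rectangle.

Section fubini_rectangle.
Context {R : realType}.
Local Notation mu1 := (@lebesgue_measure R).
Local Notation mu2 := (@lebesgue_measure R \x @lebesgue_measure R)%E.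

Lemma Rintegral2_rectangle (a b c d : R) (H : R * R -> R) :
  (forall x, (`[a, b] `*` `[c, d]) x -> {for x, continuous H}) ->
  Rintegral mu2 (`[a, b] `*` `[c, d]) H =
  \int[mu1]_(v in `[c, d]) \int[mu1]_(u in `[a, b]) H (u, v).
Proof.
move=> cH.
have cQ : compact (`[a, b] `*` `[c, d] : set (R * R)).
  by apply: compact_setX; exact: segment_compact.
have iH := continuous_integrable2 cQ (continuous_within cH).
have mQ := compact_measurable2 cQ.
rewrite /Rintegral integral_mkcond; congr fine.
move/(integrable_mkcond _ mQ) : iH => iH.
rewrite -(integral21_prod_meas1 iH) [in RHS]integral_mkcond.
apply: eq_integral => v _ /=; rewrite /fubini_G.
rewrite [in RHS]/patch; case: ifPn => vcd.
  rewrite fineK.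
    rewrite [in RHS]integral_mkcond; apply: eq_integral => u _.
    rewrite /patch/= !inE/= in vcd *.
    have -> : ((u, v) \in `[a, b] `*` `[c, d]) = (u \in `[a, b]%classic).
      by apply/idP/idP; rewrite !inE/=; [case|move=> ?; split].
    by [].
  apply: integrable_fin_num; first exact: measurable_itv.
  apply: itv_integrable; apply: slice_continuous1 cH _.
  by rewrite inE/= in_itv in vcd.
apply: integral0_eq => u _; rewrite patchE.
case: ifPn => //; rewrite inE/= => -[_ vcd'].
by rewrite notin_setE/= in vcd.
Qed.

End fubini_rectangle.

Section green_theorem.
Context {R : realType}.
Local Notation mu1 := (@lebesgue_measure R).
Local Notation mu2 := (@lebesgue_measure R \x @lebesgue_measure R)%E.

(** The estimate is uniform, so it may be used from [v] to [w] and from [w] to [v]; the sum of the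
    two compares [be v] with [be w] and gives continuity of [be]. The fundamental theorem of
    calculus then applies to [al]. *)
Lemma integral_of_increment (al be : R -> R) (c d : R) : c < d ->
  (forall e, 0 < e -> exists2 r, 0 < r &
    forall v w, c <= v <= d -> c <= w <= d -> `|w - v| < r ->
    `|al w - al v - (w - v) * be v| <= e * `|w - v|) ->
  \int[mu1]_(v in `[c, d]) be v = al d - al c.
Proof.
move=> cd inc.
have near_d v : c <= v <= d -> forall r : R, 0 < r -> exists2 w, c <= w <= d & 0 < `|w - v| < r.
  move=> /andP[cv vd] r r0; pose q := Num.min (r / 2) ((d - c) / 2).
  have q0 : 0 < q by rewrite lt_min !divr_gt0// subr_gt0.
  have qr : q < r by rewrite gt_min; apply/orP; left; lra.
  have qd : q <= (d - c) / 2 by rewrite ge_min lexx orbT.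
  have [vm|vm] := leP v ((c + d) / 2).
    by exists (v + q); [apply/andP; split; lra|rewrite addrAC subrr add0r gtr0_norm// q0].
  exists (v - q); first by apply/andP; split; lra.
  by rewrite addrAC subrr add0r normrN gtr0_norm// q0.
have cbe : {within `[c, d], continuous be}.
  apply/within_continuousP => v; rewrite /= in_itv/= => vcd e e0.
  have e40 : 0 < e / 4 by rewrite divr_gt0.
  have [r r0 hr] := inc _ e40.
  exists r => // w; rewrite in_itv/= => wcd wv.
  have [->|vw] := eqVneq v w; first by rewrite subrr normr0.
  have h1 := hr v w vcd wcd; rewrite distrC in wv; have {}h1 := h1 wv.
  rewrite distrC in wv; have h2 := hr w v wcd vcd wv.
  have n0 : 0 < `|w - v| by rewrite normr_gt0 subr_eq0 eq_sym.
  rewrite -(ltr_pM2l n0) -normrM.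
  have -> : (w - v) * (be v - be w) =
    - (al w - al v - (w - v) * be v) - (al v - al w - (v - w) * be w) by ring.
  rewrite (le_lt_trans (ler_normB _ _))// normrN.
  by move: h2; rewrite (distrC v w) => h2; nra.
have cal : {within `[c, d], continuous al}.
  apply/within_continuousP => v; rewrite /= in_itv/= => vcd e e0.
  have [r r0 hr] := inc 1 ltr01.
  have b0 : 0 < `|be v| + 2 by rewrite ltr_wpDl.
  exists (Num.min r (e / (`|be v| + 2))); first by rewrite lt_min r0 divr_gt0.
  move=> w; rewrite in_itv/= lt_min => wcd /andP[wr we].
  rewrite distrC in wr; have h1 := hr v w vcd wcd wr; rewrite mul1r in h1.
  have -> : al v - al w = - (al w - al v - (w - v) * be v) - (w - v) * be v by ring.
  rewrite (le_lt_trans (ler_normB _ _))// normrN normrM.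
  move: we; rewrite ltr_pdivlMr// distrC => we.
  have n0 := normr_ge0 (w - v); have m0 := normr_ge0 (be v).
  by move: we; rewrite mulrDr => we; lra.
have dal v : c < v < d -> is_derive v (1 : R) al (be v).
  move=> /andP[cv vd].
  have C : h^-1 *: (al (h *: (1 : R) + v) - al v) @[h --> 0^'] --> be v.
    apply/cvgrPdist_le => e e0.
    have [r r0 hr] := inc _ e0.
    near=> h.
    have h0 : h != 0 by near: h; exact: nbhs_dnbhs_neq.
    have hs : `|h| < Num.min r (Num.min (v - c) (d - v)).
      near: h; apply: dnbhs0_lt; rewrite !lt_min r0 !subr_gt0 cv//.
    move: hs; rewrite !lt_min !ltr_norml => /andP[/andP[h1 h2] /andP[/andP[h3 h4] /andP[h5 h6]]].
    rewrite /GRing.scale/= mulr1.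
    have hn : 0 < `|h| by rewrite normr_gt0.
    rewrite -(ler_pM2l hn) -normrM.
    have -> : h * (be v - h^-1 * (al (h + v) - al v)) = - (al (h + v) - al v - (h + v - v) * be v).
      by field.
    rewrite normrN [leRHS]mulrC; rewrite [in leRHS](_ : h = h + v - v); last by rewrite addrK.
    have vcd : c <= v <= d by rewrite !ltW.
    by apply: hr => //; rewrite ?addrK ?ltr_norml; apply/andP; split; lra.
  split; first by apply/cvg_ex; exists (be v).
  exact: cvg_lim C.
rewrite /Rintegral (@continuous_FTC2 _ be al c d)//.
- have /(continuous_within_itvP al cd)[_ h1 h2] := cal.
  split => // v; rewrite in_itv/= => vcd.
  exact: (@ex_derive _ _ _ _ _ _ _ (dal v vcd)).
- move=> v; rewrite in_itv/= => vcd; rewrite derive1E.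
  exact: (@derive_val _ _ _ _ _ _ _ (dal v vcd)).
Unshelve. all: by end_near. Qed.

(** With [F = 0] on three sides only the bottom side contributes. This is the situation of a form
    cut off inside the half plane. *)
Theorem green_rectangle (A : set (R * R)) (F G : R * R -> R) (a b c d : R) :
  a < b -> c < d -> C1on A F -> C1on A G -> `[a, b] `*` `[c, d] `<=` A ->
  (forall v, c <= v <= d -> F (a, v) = 0) ->
  (forall v, c <= v <= d -> F (b, v) = 0) ->
  (forall u, a <= u <= b -> F (u, d) = 0) ->
  Rintegral mu2 (`[a, b] `*` `[c, d])
    (fun x => 'D_(1, 0) F x * 'D_(0, 1) G x - 'D_(0, 1) F x * 'D_(1, 0) G x) =
  \int[mu1]_(u in `[a, b]) (F (u, c) * 'D_(1, 0) G (u, c)).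
Proof.
move=> ab cd CF CG sA Fa Fb Fd.
have cc : forall x, (`[a, b] `*` `[c, d]) x -> {for x, continuous
    (fun x => 'D_(0, 1) F x * 'D_(1, 0) G x - 'D_(1, 0) F x * 'D_(0, 1) G x)}.
  move=> x /sA Ax; have [_ F1 F2] := CF x Ax; have [_ G1 G2] := CG x Ax.
  exact: (continuousB (continuousM F2 G1) (continuousM F1 G2)).
have := integral_of_increment cd (green_increment ab CF CG sA Fa Fb).
rewrite -(Rintegral2_rectangle cc).
have -> : \int[mu1]_(u in `[a, b]) (F (u, d) * 'D_(1, 0) G (u, d)) = 0.
  rewrite (@eq_Rintegral _ _ _ _ _ (fun=> 0)); first by rewrite /Rintegral integral0.
  by move=> u; rewrite inE/= in_itv/= => uab; rewrite Fd// mul0r.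
rewrite sub0r => /(congr1 -%R); rewrite opprK => <-.
have cQ : compact (`[a, b] `*` `[c, d] : set (R * R)).
  by apply: compact_setX; exact: segment_compact.
have mQ := compact_measurable2 cQ.
rewrite -mulN1r -RintegralZl//; last exact: (continuous_integrable2 cQ (continuous_within cc)).
by apply: eq_Rintegral => x _; rewrite mulN1r opprB.
Qed.

End green_theorem.

(** * Euclidean geometry of R^3 *)

Section euclidean_space.
Context {R : realType}.
Implicit Types u v w : 'rV[R]_3.

Lemma forall_ord3 (P : 'I_3 -> Prop) : P 0 -> P 1 -> P 2 -> forall i, P i.
Proof.
move=> P0 P1 P2 [[|[|[|//]]] i3].
- by rewrite (_ : Ordinal i3 = 0)//; exact: val_inj.
- by rewrite (_ : Ordinal i3 = 1)//; exact: val_inj.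
- by rewrite (_ : Ordinal i3 = 2)//; exact: val_inj.
Qed.

Lemma sum_ord3 (V : nmodType) (F : 'I_3 -> V) : \sum_i F i = F 0 + F 1 + F 2.
Proof.
rewrite !big_ord_recl big_ord0 addr0 addrA; congr (_ + F _ + F _); exact: val_inj.
Qed.

Lemma eq_rV3 u v : u 0 0 = v 0 0 -> u 0 1 = v 0 1 -> u 0 2 = v 0 2 -> u = v.
Proof.
move=> h0 h1 h2; apply/rowP => i; move: i.
by apply: forall_ord3.
Qed.

Lemma dotmulE u v : dotmul u v = u 0 0 * v 0 0 + u 0 1 * v 0 1 + u 0 2 * v 0 2.
Proof. by rewrite /dotmul mxE sum_ord3 !mxE. Qed.

Lemma crossmul0 u v : (crossmul u v) 0 0 = u 0 1 * v 0 2 - u 0 2 * v 0 1.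
Proof. by rewrite mxE !add0r. Qed.

Lemma crossmul1 u v : (crossmul u v) 0 1 = u 0 2 * v 0 0 - u 0 0 * v 0 2.
Proof.
rewrite mxE (_ : 1 + 1 = 2 :> 'I_3); last exact: val_inj.
by rewrite (_ : 1 + 2 = 0 :> 'I_3)//; exact: val_inj.
Qed.

Lemma crossmul2 u v : (crossmul u v) 0 2 = u 0 0 * v 0 1 - u 0 1 * v 0 0.
Proof.
rewrite mxE (_ : 2 + 1 = 0 :> 'I_3); last exact: val_inj.
by rewrite (_ : 2 + 2 = 1 :> 'I_3)//; exact: val_inj.
Qed.

Lemma coordD u v i : (u + v) 0 i = u 0 i + v 0 i. Proof. by rewrite mxE. Qed.

Lemma coordN u i : (- u) 0 i = - u 0 i. Proof. by rewrite mxE. Qed.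

Lemma coordZ (a : R) u i : (a *: u) 0 i = a * u 0 i. Proof. by rewrite mxE. Qed.

Lemma coord0 i : (0 : 'rV[R]_3) 0 i = 0. Proof. by rewrite mxE. Qed.

Definition coordE := (coordD, coordN, coordZ, coord0, crossmul0, crossmul1, crossmul2, dotmulE).

End euclidean_space.

Ltac vec3 := apply: eq_rV3; rewrite ?coordE.
Ltac dot3 := rewrite ?coordE.

Section euclidean_identities.
Context {R : realType}.
Implicit Types (u v w : 'rV[R]_3) (a : R).

Lemma dotmulC u v : dotmul u v = dotmul v u.
Proof. by dot3; ring. Qed.

Lemma dotmulDl u v w : dotmul (u + v) w = dotmul u w + dotmul v w.
Proof. by dot3; ring. Qed.

Lemma dotmulZl a u w : dotmul (a *: u) w = a * dotmul u w.
Proof. by dot3; ring. Qed.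

Lemma dotmulDr u v w : dotmul w (u + v) = dotmul w u + dotmul w v.
Proof. by dot3; ring. Qed.

Lemma dotmulZr a u w : dotmul w (a *: u) = a * dotmul w u.
Proof. by dot3; ring. Qed.

Lemma dotmul_ge0 u : 0 <= dotmul u u.
Proof. by dot3; rewrite -!expr2 !addr_ge0// sqr_ge0. Qed.

Lemma dotmul_eq0 u : (dotmul u u == 0) = (u == 0).
Proof.
apply/idP/eqP => [|->]; last by rewrite dotmulE !mxE !mul0r !addr0.
rewrite dotmulE -!expr2 paddr_eq0 ?addr_ge0 ?sqr_ge0// paddr_eq0 ?sqr_ge0// !sqrf_eq0.
by move=> /andP[/andP[/eqP h0 /eqP h1] /eqP h2]; apply: eq_rV3; rewrite mxE.
Qed.

Lemma enorm_ge0 u : 0 <= enorm u. Proof. exact: sqrtr_ge0. Qed.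

Lemma sqr_enorm u : enorm u ^+ 2 = dotmul u u.
Proof. by rewrite sqr_sqrtr// dotmul_ge0. Qed.

Lemma enorm_eq0 u : (enorm u == 0) = (u == 0).
Proof. by rewrite -sqrf_eq0 sqr_enorm dotmul_eq0. Qed.

Lemma dotmul_crossl u v : dotmul (crossmul u v) u = 0.
Proof. by dot3; ring. Qed.

Lemma dotmul_crossr u v : dotmul (crossmul u v) v = 0.
Proof. by dot3; ring. Qed.

Lemma lagrange_identity u v w z :
  dotmul (crossmul u v) (crossmul w z) = dotmul u w * dotmul v z - dotmul u z * dotmul v w.
Proof. by dot3; ring. Qed.

(** Writing [u,v,w] for the determinant, the identity [u,v,w] n = (u.n) v x w + (v.n) w x u + (w.n)
    u x v is paired with [n]. *)
Lemma coplanar_det0 u v w n : dotmul n n != 0 -> dotmul u n = 0 -> dotmul v n = 0 -> dotmul w n = 0 ->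
  dotmul (crossmul u v) w = 0.
Proof.
move=> n0 un vn wn; apply/eqP; rewrite -(mulIr_eq0 _ (mulIf n0)); apply/eqP.
have -> : dotmul (crossmul u v) w * dotmul n n =
  dotmul u n * dotmul (crossmul v w) n + dotmul v n * dotmul (crossmul w u) n
  + dotmul w n * dotmul (crossmul u v) n by dot3; ring.
by rewrite un vn wn !mul0r !addr0.
Qed.

(* Cramer's rule in the plane orthogonal to n. *)
Lemma coplanar_decomp u v w n : dotmul n n != 0 -> dotmul u n = 0 -> dotmul v n = 0 -> dotmul w n = 0 ->
  dotmul (crossmul v w) n *: u =
  dotmul (crossmul u w) n *: v + dotmul (crossmul v u) n *: w.
Proof.
move=> n0 un vn wn; have det0 := coplanar_det0 n0 vn wn un.
have -> : dotmul (crossmul v w) n *: u = dotmul (crossmul u w) n *: v + dotmul (crossmul v u) n *: w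
   + dotmul (crossmul v w) u *: n by vec3; ring.
by rewrite det0 scale0r addr0.
Qed.

(** If the product were zero, the expansion v x (u x v) = (v.v) u - (u.v) v would be a linear
    relation; independence would force v.v = 0, hence [v = 0]. *)
Lemma crossmul_eq0_free u v : free [:: u; v] -> crossmul u v != 0.
Proof.
move=> fuv; apply/eqP => c0.
have rel a b : a *: u + b *: v = 0 -> a = 0 /\ b = 0.
  move=> ab0; move: (fuv) => /freeP/(_ (fun i : 'I_2 => [:: a; b]`_i)).
  rewrite !big_ord_recl big_ord0/= addr0 => /(_ ab0) H.
  by split; [exact: (H ord0)|exact: (H (lift ord0 ord0))].
have h : dotmul v v *: u + (- dotmul u v) *: v = crossmul v (crossmul u v) by vec3; ring.
have h0 : crossmul v (crossmul u v) = 0 by rewrite c0; vec3; ring.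
rewrite h0 in h; have [/eqP v0 _] := rel _ _ h.
have : 0 *: u + 1 *: v = 0 by rewrite dotmul_eq0 in v0; rewrite (eqP v0) scale0r scaler0 addr0.
by move=> /rel[_ /eqP]; rewrite oner_eq0.
Qed.

Lemma crossmul_free u v : crossmul u v != 0 -> free [:: u; v].
Proof.
move=> c0; apply/freeP => k; rewrite !big_ord_recl big_ord0/= addr0 => E.
set a := k ord0; set b := k (lift ord0 ord0).
have n0 : dotmul (crossmul u v) (crossmul u v) != 0 by rewrite dotmul_eq0.
have ha : a *: crossmul u v = crossmul (a *: u + b *: v) v by vec3; ring.
have hb : b *: crossmul u v = crossmul u (a *: u + b *: v) by vec3; ring.
have z1 w : crossmul 0 w = 0 by vec3; ring.
have z2 w : crossmul w 0 = 0 by vec3; ring.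
rewrite E z1 in ha; rewrite E z2 in hb.
have a0 : a = 0 by apply/eqP; move/eqP: ha; rewrite scaler_eq0 (negbTE c0) orbF.
have b0 : b = 0 by apply/eqP; move/eqP: hb; rewrite scaler_eq0 (negbTE c0) orbF.
move=> [[|[|//]] i2].
  by rewrite (_ : Ordinal i2 = ord0)//; exact: val_inj.
by rewrite (_ : Ordinal i2 = lift ord0 ord0)//; exact: val_inj.
Qed.

Lemma coord_le_norm u i : `|u 0 i| <= `|u|.
Proof.
rewrite [leRHS]mx_normrE.
exact: (le_bigmax _ (fun ij : 'I_1 * 'I_3 => `|u ij.1 ij.2|) (0, i)).
Qed.

Lemma norm_le_coord u (B : R) : 0 <= B -> (forall i, `|u 0 i| <= B) -> `|u| <= B.
Proof.
move=> B0 uB; rewrite [leLHS]mx_normrE; apply: bigmax_le => // -[i j] _ /=.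
by rewrite (ord1 i).
Qed.

End euclidean_identities.

(** * Comparison of integrals through superlevel sets *)

Section layer_cake.
Context {d} {T : measurableType d} {R : realType}.
Variable m : {sigma_finite_measure set T -> \bar R}.
Local Notation mu1 := (@lebesgue_measure R).
Implicit Types (A : set T) (F : T -> R).

Definition subgraph A F : set (T * measurableTypeR R) :=
  [set p | [/\ A p.1, 0 <= p.2 & p.2 <= F p.1]].

Lemma measurable_subgraph A F : measurable A -> measurable_fun A F ->
  measurable (subgraph A F).
Proof.
move=> mA mF.
have mFA : measurable_fun setT (F \_ A) by apply/(measurable_restrictT _ _).1.
pose f0 (p : T * measurableTypeR R) := 0 <= p.2.
pose f1 (p : T * measurableTypeR R) := p.2 <= (F \_ A) p.1.
rewrite (_ : subgraph A F = (A `*` setT) `&` (f0 @^-1` [set true] `&` f1 @^-1` [set true])).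
  apply: measurableI; first exact: measurableX.
  apply: measurableI.
    have : measurable_fun setT f0 by exact: measurable_fun_ler.
    by move=> /(_ measurableT [set true]); rewrite setTI; exact.
  have : measurable_fun setT f1.
    by apply: measurable_fun_ler => //; exact: measurableT_comp.
  by move=> /(_ measurableT [set true]); rewrite setTI; exact.
apply/seteqP; split => -[x s] /=; rewrite /f0 /f1 /= patchE.
  by move=> [Ax s0 sF]; split => //=; rewrite mem_set.
by move=> [[Ax _] [s0]]; rewrite mem_set.
Qed.

Lemma integral_subgraph A F : measurable A -> measurable_fun A F ->
  (forall x, A x -> 0 <= F x) ->
  (\int[m]_(x in A) (F x)%:E = \int[mu1]_s m (ysection (subgraph A F) s))%E.
Proof.
move=> mA mF F0; have mS := measurable_subgraph mA mF.
have := indic_fubini_tonelli m mu1 mS.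
rewrite indic_fubini_tonelli_FE// indic_fubini_tonelli_GE// => <-.
rewrite integral_mkcond; apply: eq_integral => x _ /=; rewrite patchE.
case: ifPn => [|]; rewrite ?inE ?notin_setE => Ax.
  rewrite (_ : xsection _ x = `[0, F x]%classic).
    rewrite lebesgue_measure_itv/= lte_fin; case: ltP => h; first by rewrite oppr0 addr0.
    by apply/eqP; rewrite eqe eq_le h F0.
  apply/seteqP; split => s; rewrite /xsection/= inE /subgraph/= in_itv/=.
    by move=> [_ -> ->].
  by move=> /andP[].
rewrite (_ : xsection _ x = set0) ?measure0//.
by apply/seteqP; split => // s; rewrite /xsection/= inE => -[].
Qed.

(** By Tonelli on the subgraph, each integral is the integral over [s] of the measure of a
    superlevel set. An inequality between measures of sets thus becomes one between integrals. *)
Lemma layer_cake_le A A' F F' (c : R) : 0 <= c -> measurable A -> measurable A' ->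
  measurable_fun A F -> measurable_fun A' F' ->
  (forall x, A x -> 0 <= F x) -> (forall x, A' x -> 0 <= F' x) ->
  (forall s : R, 0 <= s ->
    (m [set x | A' x /\ (s <= F' x)%R] <= c%:E * m [set x | A x /\ (s <= F x)%R])%E) ->
  (\int[m]_(x in A') (F' x)%:E <= c%:E * \int[m]_(x in A) (F x)%:E)%E.
Proof.
move=> c0 mA mA' mF mF' F0 F'0 H.
have mS := measurable_subgraph mA mF; have mS' := measurable_subgraph mA' mF'.
rewrite !integral_subgraph// -ge0_integralZl_EFin//; last exact: measurable_fun_ysection.
apply: ge0_le_integral => //.
- exact: measurable_fun_ysection.
- by apply: measurable_funeM; exact: measurable_fun_ysection.
move=> s _; have [s0|s0] := leP 0 s.
  have E B G : ysection (subgraph B G) s = [set x | B x /\ s <= G x].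
    by apply/seteqP; split => x; rewrite /ysection/= inE /subgraph/= => -[].
  by rewrite !E; exact: H.
rewrite (_ : ysection (subgraph A' F') s = set0).
  by rewrite measure0 mule_ge0.
by apply/seteqP; split => // x; rewrite /ysection/= inE => -[_ /=]; rewrite leNgt s0.
Qed.

End layer_cake.

Section plane_measure.
Context {R : realType}.

(* The product of two copies of Lebesgue measure has no canonical sigma-finite
   structure in the library, hence this alias. *)
Definition plane_measure : set (measurableTypeR R * measurableTypeR R)%type -> \bar R :=
  (@lebesgue_measure R \x @lebesgue_measure R)%E.

HB.instance Definition _ := Measure.on plane_measure.

Lemma plane_measure_sigma_finite : sigma_finite setT plane_measure.
Proof.
exists (fun n : nat => [set x : R * R | `|x| <= n%:R]).
  apply/seteqP; split => // x _; exists (Num.truncn `|x|).+1 => //=.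
  by have /andP[_ /ltW] := truncn_itv (normr_ge0 x).
move=> n; have cl : closed [set x : R * R | `|x| <= n%:R].
  apply: closed_comp (@closed_le R n%:R) => x _; exact: norm_continuous.
split; first exact: closed_measurable2.
apply: bounded_lt_measure2; last exact: closed_measurable2.
exists n%:R; split; first exact: num_real.
by move=> m nm x /= xn; rewrite (le_trans xn)// ltW.
Qed.

HB.instance Definition _ := Measure_isSigmaFinite.Build _ _ _ plane_measure
  plane_measure_sigma_finite.

End plane_measure.

Lemma layer_cake_le2 {R : realType} (A A' : set (R * R)) (F F' : R * R -> R) (c : R) :
  0 <= c -> measurable (A : set (measurableTypeR R * measurableTypeR R)) ->
  measurable (A' : set (measurableTypeR R * measurableTypeR R)) ->
  measurable_fun (A : set (measurableTypeR R * measurableTypeR R)) F ->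
  measurable_fun (A' : set (measurableTypeR R * measurableTypeR R)) F' ->
  (forall x, A x -> 0 <= F x) -> (forall x, A' x -> 0 <= F' x) ->
  (forall s : R, 0 <= s ->
    ((@lebesgue_measure R \x @lebesgue_measure R) [set x | A' x /\ (s <= F' x)%R] <=
     c%:E * (@lebesgue_measure R \x @lebesgue_measure R) [set x | A x /\ (s <= F x)%R])%E) ->
  (\int[(@lebesgue_measure R \x @lebesgue_measure R)%E]_(x in A') (F' x)%:E <=
   c%:E * \int[(@lebesgue_measure R \x @lebesgue_measure R)%E]_(x in A) (F x)%:E)%E.
Proof. exact: (@layer_cake_le _ _ R (@plane_measure R)). Qed.

(** * Patches and change of patch *)

Section strict_derivative.
Context {R : realType}.

Lemma near_eq_continuous (V W : topologicalType) (f g : V -> W) (x : V) :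
  (\forall y \near x, f y = g y) -> {for x, continuous f} -> {for x, continuous g}.
Proof.
move=> fg cf; have fgx : f x = g x by exact: nbhs_singleton fg.
rewrite /prop_for /continuous_at -fgx; apply: cvg_trans cf.
by apply: near_eq_cvg; near=> y; near: y.
Unshelve. all: by end_near. Qed.

Lemma open_ball_subset (V : normedModType R) (A : set V) (x : V) : open A -> A x ->
  exists2 r : R, 0 < r & forall y, `|x - y| < r -> A y.
Proof.
by move=> oA Ax; have /nbhs_normP[r /= r0 hr] := open_nbhs_nbhs (conj oA Ax); exists r.
Qed.

Lemma continuous_for_eps (V W : normedModType R) (f : V -> W) (x : V) : {for x, continuous f} ->
  forall e : R, 0 < e -> exists2 r : R, 0 < r & forall y, `|x - y| < r -> `|f x - f y| < e.
Proof.
by move=> /cvgrPdist_lt cf e /cf/nbhs_normP[r /= r0 hr]; exists r.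
Qed.

Lemma derive_coord (V : normedModType R) (f : V -> 'rV[R]_3) (x v : V) i :
  differentiable f x -> 'D_v (fun y => f y 0 i) x = ('D_v f x) 0 i.
Proof. by move=> /diff_derivable df; rewrite derive_mx// mxE. Qed.

Lemma differentiable_rV_coord (V : normedModType R) (f : V -> 'rV[R]_3) (x : V) i :
  differentiable f x -> differentiable (fun y => f y 0 i) x.
Proof.
move=> df; apply: (@differentiable_comp _ _ _ _ f (fun N : 'rV[R]_3 => N 0 i)) => //.
exact: differentiable_coord.
Qed.

Lemma continuous_rV_coord (T : topologicalType) (f : T -> 'rV[R]_3) (x : T) i :
  {for x, continuous f} -> {for x, continuous (fun y => f y 0 i)}.
Proof.
move=> cf; apply: (@continuous_comp _ _ _ f (fun N : 'rV[R]_3 => N 0 i)) => //.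
exact: coord_continuous.
Qed.

Lemma class_C1_coord (V : normedModType R) (A : set V) (f : V -> 'rV[R]_3) i : open A ->
  class_C 1 A f -> class_C 1 A (fun x => f x 0 i).
Proof.
move=> oA [df cf]; split=> [x Ax|v x Ax]; first exact/differentiable_rV_coord/df.
apply: (@near_eq_continuous _ _ (fun y => ('D_v f y) 0 i)).
  have Ax' := open_nbhs_nbhs (conj oA Ax : open_nbhs x A).
  by near=> y; rewrite derive_coord//; apply: df; near: y.
by apply: continuous_rV_coord; exact: cf.
Unshelve. all: by end_near. Qed.

Lemma class_C1_C1on (A : set (R * R)) (f : R * R -> R) : class_C 1 A f -> C1on A f.
Proof. by move=> [df cf] x Ax; split; [exact: df|exact: (cf (1, 0) x)|exact: (cf (0, 1) x)]. Qed.

(** Strict differentiability: both endpoints move, while the linear part stays that at [x0]. The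
    path goes through the corner [(y.1, x.2)], with one mean value theorem per leg; the legs stay in
    the sup norm ball around [x0]. *)
Lemma C1on_strict (A : set (R * R)) (f : R * R -> R) (x0 : R * R) (e : R) :
  open A -> C1on A f -> A x0 -> 0 < e -> exists2 r : R, 0 < r &
    forall x y, `|x0 - x| < r -> `|x0 - y| < r ->
      `|f x - f y - ((x - y).1 * 'D_(1, 0) f x0 + (x - y).2 * 'D_(0, 1) f x0)| <= e * `|x - y|.
Proof.
move=> oA Cf Ax0 e0.
have [df c1 c2] := Cf x0 Ax0.
have e20 : 0 < e / 2 by rewrite divr_gt0.
have [r0 r00 hr0] := open_ball_subset oA Ax0.
have [r1 r10 hr1] := continuous_for_eps c1 e20.
have [r2 r20 hr2] := continuous_for_eps c2 e20.
exists (Num.min r0 (Num.min r1 r2)); first by rewrite !lt_min r00 r10.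
move=> [x1 x2] [y1 y2] hx hy.
have near0 z1 z2 : Num.min y1 x1 <= z1 <= Num.max y1 x1 ->
    Num.min y2 x2 <= z2 <= Num.max y2 x2 ->
    [/\ A (z1, z2), `|'D_(1, 0) f x0 - 'D_(1, 0) f (z1, z2)| < e / 2
      & `|'D_(0, 1) f x0 - 'D_(0, 1) f (z1, z2)| < e / 2].
  move=> hz1 hz2.
  have betw (a b z p s : R) : Num.min a b <= z <= Num.max a b -> `|p - a| < s -> `|p - b| < s ->
      `|p - z| < s.
    have [h|h] := leP a b => /andP[z1' z2']; rewrite !ltr_norml => /andP[? ?] /andP[? ?];
      by apply/andP; split; lra.
  have : `|x0 - (z1, z2)| < Num.min r0 (Num.min r1 r2).
    move: hx hy; rewrite !prod_normE !gt_max/= => /andP[hx1 hx2] /andP[hy1 hy2].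
    by rewrite (betw y1 x1)// (betw y2 x2).
  rewrite !lt_min => /andP[z_r0 /andP[z_r1 z_r2]].
  by split; [exact: hr0|exact: hr1|exact: hr2].
have ends (a b : R) : Num.min a b <= a <= Num.max a b /\ Num.min a b <= b <= Num.max a b.
  by rewrite !ge_min !le_max !lexx ?orbT.
have [|t1 ht1 E1] := @MVT_between _ (fun t => f (t, x2)) (fun t => 'D_(1, 0) f (t, x2)) y1 x1.
  move=> t ht; apply: is_derive_slice1.
  have [Az _ _] := near0 t x2 ht (ends y2 x2).2.
  by have [] := Cf _ Az.
have [|t2 ht2 E2] := @MVT_between _ (fun t => f (y1, t)) (fun t => 'D_(0, 1) f (y1, t)) y2 x2.
  move=> t ht; apply: is_derive_slice2.
  have [Az _ _] := near0 y1 t (ends y1 x1).1 ht.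
  by have [] := Cf _ Az.
have [_ h1 _] := near0 t1 x2 ht1 (ends y2 x2).2.
have [_ _ h2] := near0 y1 t2 (ends y1 x1).1 ht2.
have -> : f (x1, x2) - f (y1, y2) = (f (x1, x2) - f (y1, x2)) + (f (y1, x2) - f (y1, y2)) by ring.
rewrite E1 E2 /=.
have -> : 'D_(1, 0) f (t1, x2) * (x1 - y1) + 'D_(0, 1) f (y1, t2) * (x2 - y2) -
    ((x1 - y1) * 'D_(1, 0) f x0 + (x2 - y2) * 'D_(0, 1) f x0) =
  - (('D_(1, 0) f x0 - 'D_(1, 0) f (t1, x2)) * (x1 - y1) +
    ('D_(0, 1) f x0 - 'D_(0, 1) f (y1, t2)) * (x2 - y2)) by ring.
rewrite normrN (le_trans (ler_normD _ _))// !normrM (splitr e) mulrDl.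
have n1 : `|x1 - y1| <= `|(x1, x2) - (y1, y2)| by rewrite prod_normE le_max/= lexx.
have n2 : `|x2 - y2| <= `|(x1, x2) - (y1, y2)| by rewrite prod_normE le_max/= lexx orbT.
by apply: lerD; apply: ler_pM => //; exact: ltW.
Qed.

Lemma coord_increment (p q a b : 'rV[R]_3) (s t : R) i :
  (p - q - (s *: a + t *: b)) 0 i = p 0 i - q 0 i - (s * a 0 i + t * b 0 i).
Proof. by rewrite !coordE. Qed.

Lemma class_C1_strict (A : set (R * R)) (f : R * R -> 'rV[R]_3) (x0 : R * R) (e : R) :
  open A -> class_C 1 A f -> A x0 -> 0 < e -> exists2 r : R, 0 < r &
    forall x y, `|x0 - x| < r -> `|x0 - y| < r ->
      `|f x - f y - ((x - y).1 *: 'D_(1, 0) f x0 + (x - y).2 *: 'D_(0, 1) f x0)| <= e * `|x - y|.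
Proof.
move=> oA Cf Ax0 e0.
have ex i : exists r : R, 0 < r /\ forall x y, `|x0 - x| < r -> `|x0 - y| < r ->
    `|(f x - f y - ((x - y).1 *: 'D_(1, 0) f x0 + (x - y).2 *: 'D_(0, 1) f x0)) 0 i| <= e * `|x - y|.
  have [r r0 hr] := C1on_strict oA (class_C1_C1on (class_C1_coord i oA Cf)) Ax0 e0.
  exists r; split => // x y hx hy; have := hr x y hx hy.
  have dE v : 'D_v (fun y => f y 0 i) x0 = ('D_v f x0) 0 i.
    by apply: derive_coord; exact: Cf.1.
  by rewrite (dE (1, 0)) (dE (0, 1)) coord_increment.
have [r hr] := choice ex.
have [[r00 h0] [r10 h1] [r20 h2]] := And3 (hr 0) (hr 1) (hr 2).
exists (Num.min (r 0) (Num.min (r 1) (r 2))); first by rewrite !lt_min r00 r10.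
move=> x y; rewrite !lt_min => /andP[x0r /andP[x1r x2r]] /andP[y0r /andP[y1r y2r]].
apply: norm_le_coord; first by rewrite mulr_ge0// ltW.
by apply: forall_ord3; [exact: h0|exact: h1|exact: h2].
Qed.

End strict_derivative.

Section patches.
Context {R : realType}.
Variables (M : set 'rV[R]_3) (N : 'rV[R]_3 -> 'rV[R]_3).
Implicit Types (O : set (R * R)) (phi : R * R -> 'rV[R]_3) (E : set 'rV[R]_3).

Definition patch_preimage O phi E : set (R * R) :=
  [set x | [/\ O x, half_plane x & E (phi x)]].

Lemma patch_C1 O phi : Defs.patch M O phi -> class_C 1 O phi.
Proof. by case=> _ sm _ _ _; exact: (sm 1%N). Qed.

Lemma patch_continuous O phi x : Defs.patch M O phi -> O x -> {for x, continuous phi}.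
Proof. by move=> /patch_C1[df _] /df; exact: differentiable_continuous. Qed.

Lemma patch_sub O phi x : Defs.patch M O phi -> O x -> half_plane x -> M (phi x).
Proof.
move=> [oO _ _ _ /(_ O oO)[//|W _ WE]] Ox Hx.
suff [] : (M `&` W) (phi x) by [].
by rewrite -WE; exists x.
Qed.

Lemma patch_image_rel_open O phi p : Defs.patch M O phi -> patch_image O phi p ->
  exists2 r : R, 0 < r & forall q, M q -> `|p - q| < r -> patch_image O phi q.
Proof.
move=> [oO _ _ _ /(_ O oO)[//|W oW WE]] Op.
have [_ Wp] : (M `&` W) p by rewrite -WE.
have [r r0 hr] := open_ball_subset oW Wp.
by exists r => // q Mq pq; rewrite WE; split => //; exact: hr.
Qed.

(** The openness clause of [patch] is applied to the part of [O] in a ball around [x]; injectivity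
    then brings [y] itself into that ball. *)
Lemma patch_inverse_continuous O phi x (e : R) : Defs.patch M O phi -> O x -> half_plane x -> 0 < e ->
  exists2 r : R, 0 < r & forall y, O y -> half_plane y -> `|phi x - phi y| < r -> `|x - y| < e.
Proof.
move=> pO Ox Hx e0; have [oO _ _ inj op] := pO.
have [||W oW WE] := op (O `&` ball x e); first by apply: openI => //; exact: ball_open.
  by move=> z [].
have [_ Wp] : (M `&` W) (phi x).
  by rewrite -WE; exists x => //; split => //; split => //; exact: ballxx.
have [r r0 hr] := open_ball_subset oW Wp.
exists r => // y Oy Hy xy.
have : (M `&` W) (phi y) by split; [exact: (patch_sub pO)|exact: hr].
rewrite -WE => -[z [[Oz]]]; rewrite -ball_normE/= => xz Hz /inj zy.
by rewrite -zy.
Qed.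

(** The preimage is the image of [E] under the inverse of the patch, which is continuous on [E]. *)
Lemma patch_preimage_compact O phi E : Defs.patch M O phi -> compact E ->
  E `<=` patch_image O phi -> compact (patch_preimage O phi E).
Proof.
move=> pO cE EO; have [oO _ _ inj _] := pO.
pose g p := xget (0 : R * R) [set x | [/\ O x, half_plane x & phi x = p]].
have gP p : patch_image O phi p -> [/\ O (g p), half_plane (g p) & phi (g p) = p].
  by move=> [x [Ox Hx] xp]; apply: (@xgetPex _ _ [set x | [/\ O x, half_plane x & phi x = p]]); exists x.
rewrite (_ : patch_preimage O phi E = g @` E).
  apply: continuous_compact => //; apply/within_continuousP => p /EO Op e e0.
  have [Og Hg gE] := gP p Op.
  have [r r0 hr] := patch_inverse_continuous pO Og Hg e0.
  exists r => // q /EO/gP[Oq Hq qE] pq.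
  by apply: hr => //; rewrite gE qE.
apply/seteqP; split => [x [Ox Hx Ex]|_ [p Ep <-]].
  exists (phi x) => //; have [Og Hg gE] := gP (phi x) (EO _ Ex).
  exact: inj.
by have [Og Hg gE] := gP p (EO _ Ep); split => //; rewrite gE.
Qed.

Lemma patch_normal_neq0 O phi x : Defs.patch M O phi -> O x -> half_plane x ->
  normal_product phi x != 0.
Proof. by move=> [_ _ im _ _] Ox Hx; apply: crossmul_eq0_free; exact: im. Qed.

Lemma patch_area_gt0 O phi x : Defs.patch M O phi -> O x -> half_plane x ->
  0 < enorm (normal_product phi x).
Proof. by move=> pO Ox Hx; rewrite lt_def enorm_ge0 enorm_eq0 (patch_normal_neq0 pO). Qed.

Lemma oriented_patch_normal O phi x : oriented_patch M N O phi -> O x -> half_plane x ->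
  normal_product phi x = enorm (normal_product phi x) *: N (phi x).
Proof.
move=> [pO NE] Ox Hx; rewrite NE// scalerA mulfV ?scale1r//.
by rewrite gt_eqF// (patch_area_gt0 pO).
Qed.

Lemma oriented_patch_unit O phi x : oriented_patch M N O phi -> O x -> half_plane x ->
  dotmul (N (phi x)) (N (phi x)) = 1.
Proof.
move=> [pO NE] Ox Hx; have w0 := patch_area_gt0 pO Ox Hx.
rewrite NE// dotmulZl dotmulZr -sqr_enorm.
by field; rewrite gt_eqF.
Qed.

End patches.

Section tangent_coordinates.
Context {R : realType}.
Implicit Types (a b q : 'rV[R]_3) (h : R * R).

Definition lin_comb a b h : 'rV[R]_3 := h.1 *: a + h.2 *: b.

(** With [dual2], the dual basis of [(a, b)] inside the plane that they span, when they are
    independent. [coords] then projects orthogonally to this plane before reading coordinates, so it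
    accepts chords of the surface, which leave the tangent plane. *)
Definition dual1 a b := (dotmul (crossmul a b) (crossmul a b))^-1 *: crossmul b (crossmul a b).

Definition dual2 a b := (dotmul (crossmul a b) (crossmul a b))^-1 *: crossmul (crossmul a b) a.

Definition coords a b q : R * R := (dotmul q (dual1 a b), dotmul q (dual2 a b)).

Lemma coordsK a b h : crossmul a b != 0 -> coords a b (lin_comb a b h) = h.
Proof.
rewrite -dotmul_eq0; set D := dotmul _ _ => D0.
case: h => h1 h2; rewrite /coords /lin_comb /dual1 /dual2 -/D /=; congr pair.
  rewrite dotmulZr (_ : dotmul _ _ = D * h1); first by rewrite mulrA mulVf// mul1r.
  by rewrite /D; dot3; ring.
rewrite dotmulZr (_ : dotmul _ _ = D * h2); first by rewrite mulrA mulVf// mul1r.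
by rewrite /D; dot3; ring.
Qed.

Lemma coordsD a b q q' : coords a b (q + q') = coords a b q + coords a b q'.
Proof. by rewrite /coords !dotmulDl. Qed.

Lemma coordsB a b q q' : coords a b (q - q') = coords a b q - coords a b q'.
Proof. by rewrite coordsD -scaleN1r /coords !dotmulZl !mulN1r. Qed.

Lemma dotmul_le_norm q q' : `|dotmul q q'| <= 3 * `|q| * `|q'|.
Proof.
rewrite dotmulE (le_trans (ler_normD _ _))//.
rewrite (_ : 3 * `|q| * `|q'| = (`|q| * `|q'| + `|q| * `|q'|) + `|q| * `|q'|); last by ring.
have c i : `|q 0 i * q' 0 i| <= `|q| * `|q'|.
  by rewrite normrM; apply: ler_pM => //; exact: coord_le_norm.
by apply: lerD => //; rewrite (le_trans (ler_normD _ _))// lerD.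
Qed.

Lemma coords_bounded a b : exists2 K : R, 0 < K & forall q, `|coords a b q| <= K * `|q|.
Proof.
exists (3 * `|dual1 a b| + 3 * `|dual2 a b| + 1).
  by rewrite ltr_wpDl// addr_ge0// mulr_ge0.
move=> q; have n0 := normr_ge0 q; have n1 := normr_ge0 (dual1 a b).
have n2 := normr_ge0 (dual2 a b).
have p1 : 0 <= `|q| * `|dual1 a b| by rewrite mulr_ge0.
have p2 : 0 <= `|q| * `|dual2 a b| by rewrite mulr_ge0.
rewrite prod_normE ge_max/=; apply/andP; split; apply: le_trans (dotmul_le_norm _ _) _;
  rewrite -!mulrA !mulrDl mul1r -!mulrA ![`|dual1 a b| * _]mulrC ![`|dual2 a b| * _]mulrC; lra.
Qed.

Lemma lin_comb_bounded a b : exists2 K : R, 0 < K & forall h, `|lin_comb a b h| <= K * `|h|.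
Proof.
exists (`|a| + `|b| + 1); first by rewrite ltr_wpDl// addr_ge0.
move=> h; rewrite (le_trans (ler_normD _ _))// !normrZ.
have h1 : `|h.1| <= `|h| by rewrite prod_normE le_max lexx.
have h2 : `|h.2| <= `|h| by rewrite prod_normE le_max lexx orbT.
have n0 := normr_ge0 h; have na := normr_ge0 a; have nb := normr_ge0 b.
have m1 : `|h.1| * `|a| <= `|h| * `|a| by rewrite ler_wpM2r.
have m2 : `|h.2| * `|b| <= `|h| * `|b| by rewrite ler_wpM2r.
rewrite !mulrDl mul1r ![_ * `|h|]mulrC; lra.
Qed.

Definition coord_change a b a' b' : R * R -> R * R :=
  plane_map (dotmul a' (dual1 a b)) (dotmul b' (dual1 a b))
            (dotmul a' (dual2 a b)) (dotmul b' (dual2 a b)).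

Lemma coord_changeE a b a' b' h : coord_change a b a' b' h = coords a b (lin_comb a' b' h).
Proof.
rewrite /coord_change /plane_map /coords /lin_comb !dotmulDl !dotmulZl.
by congr pair; ring.
Qed.

Lemma coord_changeB a b a' b' h k :
  coord_change a b a' b' h - coord_change a b a' b' k = coord_change a b a' b' (h - k).
Proof. by rewrite /coord_change /plane_map/=; congr pair => /=; ring. Qed.

(** By Lagrange's identity the determinant is a' x b' paired with dual1 x dual2, and the latter is a
    x b divided by its squared length. *)
Lemma coord_change_det a b a' b' n (w w' : R) : dotmul n n = 1 -> w != 0 ->
  crossmul a b = w *: n -> crossmul a' b' = w' *: n ->
  dotmul a' (dual1 a b) * dotmul b' (dual2 a b) - dotmul b' (dual1 a b) * dotmul a' (dual2 a b)
  = w' / w.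
Proof.
move=> n1 w0 nE nE'.
have D0 : dotmul (crossmul a b) (crossmul a b) = w ^+ 2.
  by rewrite nE dotmulZl dotmulZr n1 mulr1.
rewrite /dual1 /dual2 !dotmulZr D0 mulrACA [X in _ - X]mulrACA -mulrBr.
rewrite (mulrC (dotmul b' _)) -lagrange_identity.
have -> : crossmul (crossmul b (crossmul a b)) (crossmul (crossmul a b) a) =
    dotmul (crossmul a b) (crossmul a b) *: crossmul a b by vec3; ring.
rewrite D0 nE nE' !dotmulZr dotmulZl n1; field; exact: w0.
Qed.

End tangent_coordinates.

Lemma telescope_sub {V : zmodType} (p q s : V) : q = s + ((p - s) - (p - q)).
Proof. by rewrite opprB addrA (addrC s) subrK addrC subrK. Qed.

Lemma continuous_plane_map {R : realType} (a b c d : R) : continuous (plane_map a b c d).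
Proof.
have lin (p q : R) : continuous (fun x : R * R => p * x.1 + q * x.2).
  by move=> x; apply: cvgD; apply: cvgM; [exact: cvg_cst|exact: cvg_fst|exact: cvg_cst|exact: cvg_snd].
move=> x; apply: (@cvg_pair _ _ _ _ (nbhs (plane_map a b c d x).1) (nbhs (plane_map a b c d x).2)).
  exact: lin.
exact: lin.
Qed.

Lemma plane_map_inj {F : realType} (a b c d : F) : a * d - b * c != 0 -> injective (plane_map a b c d).
Proof.
move=> D0 [x1 x2] [y1 y2]; rewrite /plane_map/= => -[E1 E2].
have h1 : (a * d - b * c) * x1 = (a * d - b * c) * y1.
  have -> : (a * d - b * c) * x1 = d * (a * x1 + b * x2) - b * (c * x1 + d * x2) by ring.
  by rewrite E1 E2; ring.
have h2 : (a * d - b * c) * x2 = (a * d - b * c) * y2.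
  have -> : (a * d - b * c) * x2 = a * (c * x1 + d * x2) - c * (a * x1 + b * x2) by ring.
  by rewrite E1 E2; ring.
by rewrite (mulfI D0 h1) (mulfI D0 h2).
Qed.

Lemma coord_change_measure {R : realType} (a b a' b' n : 'rV[R]_3) (w w' : R) (A : set (R * R)) :
  dotmul n n = 1 -> 0 < w -> 0 < w' -> crossmul a b = w *: n -> crossmul a' b' = w' *: n ->
  compact A ->
  (w'%:E * (@lebesgue_measure R \x @lebesgue_measure R) A =
   w%:E * (@lebesgue_measure R \x @lebesgue_measure R) (coord_change a b a' b' @` A))%E.
Proof.
move=> nn w0 w0' nE nE' cA.
have detE := coord_change_det nn (lt0r_neq0 w0) nE nE'.
rewrite /coord_change; move: detE.
set t11 := dotmul a' (dual1 a b); set t12 := dotmul b' (dual1 a b).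
set t21 := dotmul a' (dual2 a b); set t22 := dotmul b' (dual2 a b) => detE.
have det0 : t11 * t22 - t12 * t21 != 0 by rewrite detE gt_eqF// divr_gt0.
have cTA : compact (plane_map t11 t12 t21 t22 @` A).
  by apply: continuous_compact => //; exact/continuous_subspaceT/continuous_plane_map.
have := det_scalingP det0 (compact_measurable2 cTA).
have -> : plane_map t11 t12 t21 t22 @^-1` (plane_map t11 t12 t21 t22 @` A) = A.
  by apply/seteqP; split => [y [z Az /(plane_map_inj det0) <-//]|y Ay]; exists y.
rewrite detE gtr0_norm ?divr_gt0// => <-.
by rewrite muleA -EFinM mulrC divfK// gt_eqF.
Qed.

(** For x in [0, 1], the excess 2x + x^2 is at most 3x. *)
Lemma sqr_1D_le {F : realFieldType} (x e : F) : 0 <= x -> x <= 1 -> x <= e / 3 ->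
  (1 + x) * (1 + x) <= 1 + e.
Proof. by move=> *; nra. Qed.

(** The error [K * de * h] is at most [h / 2] and is absorbed by the left side; this costs the
    factor 2 in the conclusion. *)
Lemma absorb_le {F : realFieldType} (h k K Lam de l n1 n2 : F) :
  0 <= K -> l <= Lam * k -> n1 <= de * h -> n2 <= de * k -> de <= 1 ->
  2 * K * de <= 1 -> 0 <= h -> 0 <= k -> h <= K * (l + (n2 + n1)) ->
  h <= 2 * K * (Lam + 1) * k.
Proof.
move=> K0 hl h1 h2 de1 de2 h0 k0 H.
have e1 : K * n1 <= K * (de * h) by rewrite ler_wpM2l.
have e2 : K * n2 <= K * (de * k) by rewrite ler_wpM2l.
have e3 : K * l <= K * (Lam * k) by rewrite ler_wpM2l.
have m1 : K * (de * k) <= K * (1 * k) by rewrite ler_wpM2l// ler_wpM2r.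
have m2 : 2 * K * de * h <= 1 * h by rewrite ler_wpM2r.
by move: H; rewrite !mulrDr => H; lra.
Qed.

Lemma scale_le {F : realFieldType} (h k K L de n e : F) :
  0 <= K -> 0 <= de -> n <= de * k + de * h -> h <= L * k ->
  K * (1 + L) * de <= e -> 0 <= k -> K * n <= e * k.
Proof.
move=> K0 de0 hn hh he k0.
have m1 : K * n <= K * (de * k + de * h) by rewrite ler_wpM2l.
have m2 : K * (de * h) <= K * (de * (L * k)) by rewrite !ler_wpM2l.
have m3 : K * (1 + L) * de * k <= e * k by rewrite ler_wpM2r.
by move: m1; rewrite !mulrDr => m1; lra.
Qed.

(** * Change of patch: from small compact sets to integrals *)

Section patch_comparison.
Context {R : realType}.
Local Notation mu2 := (@lebesgue_measure R \x @lebesgue_measure R)%E.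
Local Notation RR := (measurableTypeR R * measurableTypeR R)%type.
Variables (M : set 'rV[R]_3) (N : 'rV[R]_3 -> 'rV[R]_3).

(** The transition map [tau] followed by the linear map [T] between the coordinates of the two
    tangent bases is close to the identity: it is Lipschitz with constant [1 + e'] near [x0]. So it
    multiplies area by at most [1 + e], while [T] multiplies it exactly by the ratio of the two area
    elements. *)
Lemma patch_compare O phi O' psi (x0 y0 : R * R) (e : R) :
  oriented_patch M N O phi -> oriented_patch M N O' psi ->
  O x0 -> half_plane x0 -> O' y0 -> half_plane y0 -> phi x0 = psi y0 -> 0 < e ->
  exists2 r : R, 0 < r & forall E : set 'rV[R]_3, compact E -> (forall q, E q -> `|phi x0 - q| < r) ->
    E `<=` patch_image O phi -> E `<=` patch_image O' psi ->
    ((enorm (normal_product psi y0))%:E * mu2 (patch_preimage O' psi E) <=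
     ((1 + e) * enorm (normal_product phi x0))%:E * mu2 (patch_preimage O phi E))%E.
Proof.
move=> op op' Ox0 Hx0 Oy0 Hy0 xy0 e0.
have [pO _] := op; have [pO' _] := op'.
have [oO _ _ _ _] := pO; have [oO' _ _ inj' _] := pO'.
pose a := partial_u phi x0; pose b := partial_v phi x0.
pose a' := partial_u psi y0; pose b' := partial_v psi y0.
have n0 : crossmul a b != 0 := patch_normal_neq0 pO Ox0 Hx0.
have n0' : crossmul a' b' != 0 := patch_normal_neq0 pO' Oy0 Hy0.
have [K K0 hK] := coords_bounded a b.
have [K' K'0 hK'] := coords_bounded a' b'.
have [Lam Lam0 hLam] := lin_comb_bounded a b.
pose L := 2 * K' * (Lam + 1).
have L0 : 0 < L by rewrite /L !mulr_gt0// addr_gt0.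
pose e' := Num.min 1 (e / 3).
have e'0 : 0 < e' by rewrite lt_min ltr01 divr_gt0.
have e'1 : e' <= 1 by rewrite ge_min lexx.
have e'e : e' <= e / 3 by rewrite ge_min lexx orbT.
(* The bounds 1 and [1 / (2 * K')] serve the absorption that yields [|h| <= L * |k|]; the third one
   makes the remaining error at most [e' * |k|]. *)
pose de := Num.min 1 (Num.min (2 * K')^-1 (e' / (K * (1 + L)))).
have de0 : 0 < de.
  rewrite !lt_min ltr01 invr_gt0 mulr_gt0//=.
  by rewrite divr_gt0// mulr_gt0// addr_gt0.
have de1 : de <= 1 by rewrite ge_min lexx.
have de2 : 2 * K' * de <= 1.
  rewrite mulrC -ler_pdivlMr ?mulr_gt0// mul1r.
  by rewrite /de ge_min; apply/orP; right; rewrite ge_min lexx.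
have de3 : K * (1 + L) * de <= e'.
  rewrite mulrC -ler_pdivlMr ?mulr_gt0// ?addr_gt0//.
  by rewrite /de ge_min; apply/orP; right; rewrite ge_min lexx orbT.
have [s s0 hs] := class_C1_strict oO (patch_C1 pO) Ox0 de0.
have [s' s'0 hs'] := class_C1_strict oO' (patch_C1 pO') Oy0 de0.
have [r r0 hr] := patch_inverse_continuous pO Ox0 Hx0 s0.
have [r' r'0 hr'] := patch_inverse_continuous pO' Oy0 Hy0 s'0.
exists (Num.min r r'); first by rewrite lt_min r0.
move=> E cE Er EO EO'.
have cA := patch_preimage_compact pO cE EO.
have cA' := patch_preimage_compact pO' cE EO'.
set A := patch_preimage O phi E in cA *; set A' := patch_preimage O' psi E in cA' *.
pose T := coord_change a b a' b'.
pose tau x := xget (0 : R * R) [set y | A' y /\ psi y = phi x].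
have tauP x : A x -> A' (tau x) /\ psi (tau x) = phi x.
  move=> [Ox Hx Ex]; have [y [Oy Hy] yE] := EO' _ Ex.
  apply: (@xgetPex _ _ [set y | A' y /\ psi y = phi x]); exists y => /=.
  by split => //; split => //; rewrite yE.
have imT : (T \o tau) @` A = T @` A'.
  apply/seteqP; split => [_ [x Ax <-]|_ [y [Oy Hy Ey] <-]].
    by exists (tau x) => //; case: (tauP x Ax).
  have [x [Ox Hx] xE] := EO _ Ey.
  have Ax : A x by split => //; rewrite xE.
  exists x => //=; congr T; have [[Ot Ht _] tE] := tauP x Ax.
  by apply: inj' => //; rewrite tE.
have lip x x' : A x -> A x' -> `|(T \o tau) x - (T \o tau) x'| <= (1 + e') * `|x - x'|.
  move=> Ax Ax'; have [[Oy Hy Ey] yE] := tauP x Ax; have [[Oy' Hy' Ey'] yE'] := tauP x' Ax'.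
  rewrite /= coord_changeB coord_changeE.
  set y := tau x in Oy Hy Ey yE *; set y' := tau x' in Oy' Hy' Ey' yE' *.
  have [Ox Hx Ex] := Ax; have [Ox' Hx' Ex'] := Ax'.
  have hx : `|x0 - x| < s by apply: hr => //; have := Er _ Ex; rewrite lt_min => /andP[].
  have hx' : `|x0 - x'| < s by apply: hr => //; have := Er _ Ex'; rewrite lt_min => /andP[].
  have hy : `|y0 - y| < s'.
    by apply: hr' => //; have := Er _ Ey; rewrite lt_min xy0 => /andP[].
  have hy' : `|y0 - y'| < s'.
    by apply: hr' => //; have := Er _ Ey'; rewrite lt_min xy0 => /andP[].
  pose k := x - x'; pose h := y - y'; pose D := phi x - phi x'.
  have he2 : `|D - lin_comb a b k| <= de * `|k| := hs x x' hx hx'.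
  have he1 : `|D - lin_comb a' b' h| <= de * `|h|.
    have -> : D = psi y - psi y' by rewrite /D yE yE'.
    exact: hs'.
  pose e1 := D - lin_comb a' b' h; pose e2 := D - lin_comb a b k.
  (* The chord [D] is the same in both patches, so its two linear approximations differ only by the
     errors. Applying [coords a b] shows that [T] sends [h] to [k] up to a small error. *)
  have qE : lin_comb a' b' h = lin_comb a b k + (e2 - e1).
    exact: telescope_sub.
  have hn := normr_ge0 h; have kn := normr_ge0 k.
  have hL : `|h| <= L * `|k|.
    have : `|h| <= K' * (`|lin_comb a b k| + (`|e2| + `|e1|)).
      rewrite -{1}(coordsK h n0') qE; apply: le_trans (hK' _) _.
      apply: ler_wpM2l; first exact: ltW.
      rewrite (le_trans (ler_normD _ _))// lerD2l.
      exact: ler_normB.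
    by apply: absorb_le (ltW K'0) (hLam k) he1 he2 de1 de2 hn kn.
  rewrite -/h -/k qE coordsD coordsK// (le_trans (ler_normD _ _))// mulrDl mul1r lerD2l.
  apply: le_trans (hK _) _.
  apply: scale_le (ltW K0) (ltW de0) _ hL de3 kn.
  exact: (le_trans (ler_normB _ _) (lerD he2 he1)).
have cTA : compact (T @` A').
  by apply: continuous_compact => //; exact/continuous_subspaceT/continuous_plane_map.
have mTA := compact_measurable2 cTA.
have nn : dotmul (N (phi x0)) (N (phi x0)) = 1 := oriented_patch_unit op Ox0 Hx0.
have w0 := patch_area_gt0 pO Ox0 Hx0; have w0' := patch_area_gt0 pO' Oy0 Hy0.
set w := enorm _ in w0 *; set w' := enorm _ in w0' *.
have nE : crossmul a b = w *: N (phi x0) := oriented_patch_normal op Ox0 Hx0.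
have nE' : crossmul a' b' = w' *: N (phi x0).
  by rewrite xy0; exact: (oriented_patch_normal op' Oy0 Hy0).
clearbody tau w w' A A' de e' L a b a' b'.
have e'10 : 0 <= 1 + e' by rewrite addr_ge0// ltW.
have key : (mu2 ((T \o tau) @` A) <= (1 + e)%:E * mu2 A)%E.
  apply: le_trans (lipschitz_measure2 e'10 cA lip _) _; first by rewrite imT.
  by apply: lee_wpmul2r => //; rewrite lee_fin; exact: sqr_1D_le (ltW e'0) e'1 e'e.
have -> : (w'%:E * mu2 A' = w%:E * mu2 ((T \o tau) @` A))%E.
  by rewrite imT; exact: coord_change_measure nn w0 w0' nE nE' cA'.
rewrite [X in (_ <= X)%E](_ : _ = (w%:E * ((1 + e)%:E * mu2 A))%E); last first.
  by rewrite muleA -EFinM (mulrC w).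
have w0E : (0 <= w%:E)%E by rewrite lee_fin; exact: ltW w0.
exact: lee_wpmul2l w0E _ _ key.
Qed.

End patch_comparison.

Section patch_integrals.
Context {R : realType}.
Local Notation mu2 := (@lebesgue_measure R \x @lebesgue_measure R)%E.
Local Notation RR := (measurableTypeR R * measurableTypeR R)%type.
Variables (M : set 'rV[R]_3) (N : 'rV[R]_3 -> 'rV[R]_3).
Implicit Types (O : set (R * R)) (phi psi : R * R -> 'rV[R]_3) (E : set 'rV[R]_3)
  (f g : 'rV[R]_3 -> R).

Lemma compact_finite_balls (V : normedModType R) (K : set V) (r : V -> R) :
  compact K -> (forall x, K x -> 0 < r x) ->
  exists s : seq V, (forall x, x \in s -> K x) /\
    forall y, K y -> exists2 x, x \in s & `|x - y| < r x.
Proof.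
move=> cK r0.
have := cK; rewrite compact_cover => /(_ V K (fun x => ball x (r x)))[||D' sD' cov].
- by move=> x _; exact: ball_open.
- by move=> x Kx; exists x => //; apply: ballxx; exact: r0.
exists (finmap.enum_fset D'); split => [x xD|y Ky]; first by have := sD' x xD; rewrite inE.
by have [x xD xy] := cov y Ky; exists x => //; move: xy; rewrite -ball_normE.
Qed.

Lemma within_continuous_comp (V W : normedModType R) (A : set V) (B : set W) (h : V -> W)
    (f : W -> R) : {within A, continuous h} -> {within B, continuous f} ->
  (forall x, A x -> B (h x)) -> {within A, continuous (f \o h)}.
Proof.
move=> /within_continuousP ch /within_continuousP cf AB; apply/within_continuousP => x Ax e e0.
have [r r0 hr] := cf _ (AB x Ax) e e0.
have [s s0 hs] := ch x Ax r r0.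
by exists s => // y Ay xy; apply: hr; [exact: AB|exact: hs].
Qed.

Lemma within_continuousM (V : normedModType R) (A : set V) (f g : V -> R) :
  {within A, continuous f} -> {within A, continuous g} -> {within A, continuous (fun x => f x * g x)}.
Proof. by move=> cf cg x; apply: (@continuousM _ (subspace A) f g x); [exact: cf|exact: cg]. Qed.

Lemma within_continuousB (V : normedModType R) (A : set V) (f g : V -> R) :
  {within A, continuous f} -> {within A, continuous g} -> {within A, continuous (fun x => f x - g x)}.
Proof. by move=> cf cg x; apply: (@continuousB _ _ (subspace A) f g x); [exact: cf|exact: cg]. Qed.

Lemma within_continuousD (V : normedModType R) (A : set V) (f g : V -> R) :
  {within A, continuous f} -> {within A, continuous g} -> {within A, continuous (fun x => f x + g x)}.
Proof. by move=> cf cg x; apply: (@continuousD _ _ (subspace A) f g x); [exact: cf|exact: cg]. Qed.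

Definition area phi x := enorm (normal_product phi x).

Lemma continuous_rV (T : topologicalType) (u : T -> 'rV[R]_3) (x : T) :
  (forall i, {for x, continuous (fun y => u y 0 i)}) -> {for x, continuous u}.
Proof.
move=> cu; apply/cvgrPdist_lt => e e0.
have c i : \forall y \near x, `|(u x - u y) 0 i| <= e / 2.
  have /cvgrPdist_le/(_ (e / 2)) := cu i.
  rewrite divr_gt0// => /(_ isT); apply: filterS => y.
  by rewrite coordD coordN.
near=> y; apply: (@le_lt_trans _ _ (e / 2)); last by rewrite ltr_pdivrMr// ltr_pMr// ltr1n.
apply: norm_le_coord; first by rewrite divr_ge0// ltW.
by apply: forall_ord3; near: y; exact: c.
Unshelve. all: by end_near. Qed.

Lemma continuous_dotmul (T : topologicalType) (u v : T -> 'rV[R]_3) (x : T) :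
  {for x, continuous u} -> {for x, continuous v} ->
  {for x, continuous (fun y => dotmul (u y) (v y))}.
Proof.
move=> cu cv.
rewrite (_ : (fun y => dotmul (u y) (v y)) = (fun y => u y 0 0 * v y 0 0) + (fun y => u y 0 1 * v y 0 1)
  + (fun y => u y 0 2 * v y 0 2)); last by apply/funext => y; rewrite dotmulE.
have c i : {for x, continuous (fun y => u y 0 i * v y 0 i)}.
  by apply: continuousM; exact: continuous_rV_coord.
exact: (continuousD (continuousD (c 0) (c 1)) (c 2)).
Qed.

Lemma continuous_crossmul (T : topologicalType) (u v : T -> 'rV[R]_3) (x : T) :
  {for x, continuous u} -> {for x, continuous v} ->
  {for x, continuous (fun y => crossmul (u y) (v y))}.
Proof.
move=> cu cv; apply: continuous_rV => i.
have c j k : {for x, continuous (fun y => u y 0 j * v y 0 k)}.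
  by apply: continuousM; exact: continuous_rV_coord.
rewrite (_ : (fun y => _) = (fun y => u y 0 (i + 1) * v y 0 (i + 2) - u y 0 (i + 2) * v y 0 (i + 1))).
  exact: (continuousB (c (i + 1) (i + 2)) (c (i + 2) (i + 1))).
by apply/funext => y; rewrite mxE.
Qed.

Lemma continuous_enorm (T : topologicalType) (u : T -> 'rV[R]_3) (x : T) :
  {for x, continuous u} -> {for x, continuous (fun y => enorm (u y))}.
Proof.
move=> cu; apply: (@continuous_comp _ _ _ (fun y => dotmul (u y) (u y)) Num.sqrt).
  exact: continuous_dotmul.
exact: sqrt_continuous.
Qed.

Lemma continuous_partial_u O phi x : Defs.patch M O phi -> O x -> {for x, continuous (partial_u phi)}.
Proof. by move=> pO Ox; have [_ cD] := patch_C1 pO; exact: (cD (1, 0) x Ox). Qed.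

Lemma continuous_partial_v O phi x : Defs.patch M O phi -> O x -> {for x, continuous (partial_v phi)}.
Proof. by move=> pO Ox; have [_ cD] := patch_C1 pO; exact: (cD (0, 1) x Ox). Qed.

Lemma continuous_area O phi x : Defs.patch M O phi -> O x -> {for x, continuous (area phi)}.
Proof.
move=> pO Ox; apply: continuous_enorm.
exact: (continuous_crossmul (continuous_partial_u pO Ox) (continuous_partial_v pO Ox)).
Qed.

Definition patch_int O phi E f := Rintegral mu2 (patch_preimage O phi E) (fun x => f (phi x) * area phi x).

Section one_patch.
Variables (O : set (R * R)) (phi : R * R -> 'rV[R]_3).
Hypothesis pO : Defs.patch M O phi.

Lemma within_continuous_pullback E f : {within E, continuous f} ->
  {within patch_preimage O phi E, continuous (f \o phi)}.
Proof.
move=> cf; apply: (within_continuous_comp _ cf); last by move=> x [].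
by apply: continuous_within => x [Ox _ _]; exact: patch_continuous pO Ox.
Qed.

Lemma within_continuous_density E f : {within E, continuous f} ->
  {within patch_preimage O phi E, continuous (fun x => f (phi x) * area phi x)}.
Proof.
move=> cf; apply: within_continuousM; first exact: within_continuous_pullback.
by apply: continuous_within => x [Ox _ _]; exact: continuous_area pO Ox.
Qed.

Lemma patch_int_integrable E f : compact E -> E `<=` patch_image O phi -> {within E, continuous f} ->
  mu2.-integrable (patch_preimage O phi E : set RR) (EFin \o (fun x => f (phi x) * area phi x)).
Proof.
move=> cE EO cf; apply: continuous_integrable2; first exact: patch_preimage_compact pO cE EO.
exact: within_continuous_density.
Qed.

Lemma patch_intD E f g : compact E -> E `<=` patch_image O phi ->
  {within E, continuous f} -> {within E, continuous g} ->
  patch_int O phi E (fun p => f p + g p) = patch_int O phi E f + patch_int O phi E g.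
Proof.
move=> cE EO cf cg; rewrite /patch_int -RintegralD.
- by apply: eq_Rintegral => x _; rewrite mulrDl.
- exact: compact_measurable2 (patch_preimage_compact pO cE EO).
- exact: patch_int_integrable.
- exact: patch_int_integrable.
Qed.

Lemma patch_int_sub E E' f : E' `<=` E -> (forall p, E p -> ~ E' p -> f p = 0) ->
  patch_int O phi E f = patch_int O phi E' f.
Proof.
move=> E'E f0; apply: Rintegral_subset => [x [Ox Hx E'x]|x [Ox Hx Ex] nE'].
  by split=> //; exact: E'E.
by rewrite (f0 _ Ex) ?mul0r// => E'x; exact: nE'.
Qed.

Lemma patch_int_total E f : (forall p, M p -> ~ E p -> f p = 0) ->
  Rintegral mu2 (O `&` half_plane) (fun x => f (phi x) * enorm (normal_product phi x)) =
  patch_int O phi E f.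
Proof.
move=> f0; apply: Rintegral_subset => [x []//|x [Ox Hx] nE].
by rewrite (f0 _ (patch_sub pO Ox Hx)) ?mul0r// => Ex; exact: nE.
Qed.

Lemma patch_int_eq E f g : (forall p, E p -> f p = g p) -> patch_int O phi E f = patch_int O phi E g.
Proof. by move=> fg; apply: eq_Rintegral => x; rewrite inE => -[Ox Hx Ex]; rewrite fg. Qed.

End one_patch.

Lemma within_continuous_of_chart O phi E f : Defs.patch M O phi -> E `<=` patch_image O phi ->
  {within O `&` half_plane, continuous (f \o phi)} -> {within E, continuous f}.
Proof.
move=> pO EO /within_continuousP cf; apply/within_continuousP => p /EO[x [Ox Hx] <-] e e0.
have [r r0 hr] := cf x (conj Ox Hx) e e0.
have [s s0 hs] := patch_inverse_continuous pO Ox Hx r0.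
by exists s => // q /EO[y [Oy Hy] <-] pq; apply: hr; [|exact: hs].
Qed.

Lemma superlevel_compact E f s : compact E -> {within E, continuous f} ->
  compact (E `&` [set p | s <= f p]).
Proof.
move=> cE cf; have clE : closed E by apply: compact_closed cE; exact: norm_hausdorff.
apply: subclosed_compact cE _; last by move=> p [].
have cls : closed [set t : R | s <= t] by exact: closed_ge.
have /continuous_closedP/(_ _ cls)/closed_subspaceP[W clW WE] := cf.
by rewrite setIC -[X in closed X]/([set p | s <= f p] `&` E) -WE; exact: closedI.
Qed.

End patch_integrals.

Section patch_independence.
Context {R : realType}.
Local Notation mu2 := (@lebesgue_measure R \x @lebesgue_measure R)%E.
Local Notation RR := (measurableTypeR R * measurableTypeR R)%type.
Variables (M : set 'rV[R]_3) (N : 'rV[R]_3 -> 'rV[R]_3).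
Implicit Types (O : set (R * R)) (phi psi : R * R -> 'rV[R]_3) (E : set 'rV[R]_3)
  (f g : 'rV[R]_3 -> R).

(** For x in [0, 1], the excess 3x + 3x^2 + x^3 is at most 7x. *)
Lemma cube_1D_le {F : realFieldType} (x e : F) : 0 <= x -> x <= 1 -> x <= e / 7 ->
  (1 + x) * ((1 + x) * (1 + x)) <= 1 + e.
Proof.
move=> x0 x1 xe.
have h1 : x * x <= x by nra.
have h2 : x * x * x <= x by nra.
nra.
Qed.

(** (1 + x)(1 - x/2) exceeds 1 by x(1 - x)/2, which is nonnegative on [0, 1]. *)
Lemma ratio_lower_bound {F : realFieldType} (x w z : F) : 0 <= x -> x <= 1 -> 0 <= w ->
  w - z < w * (x / 2) -> w <= (1 + x) * z.
Proof.
move=> x0 x1 w0 h; have h1 : w * (1 - x / 2) <= z by lra.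
have h2 : (1 + x) * (w * (1 - x / 2)) <= (1 + x) * z by rewrite ler_wpM2l// addr_ge0.
apply: le_trans h2; have : 0 <= w * (x * (1 - x)) by rewrite !mulr_ge0// subr_ge0.
by lra.
Qed.

(** Near [p] both area elements are nearly constant. Freezing one of them, comparing the unweighted
    integrals and restoring the other costs three factors [1 + e'], whence the use of
    [cube_1D_le]. *)
Lemma patch_int_le_local O phi O' psi (p : 'rV[R]_3) (e : R) :
  oriented_patch M N O phi -> oriented_patch M N O' psi ->
  patch_image O phi p -> patch_image O' psi p -> 0 < e ->
  exists2 r : R, 0 < r & forall E f, compact E -> (forall q, E q -> `|p - q| < r) ->
    E `<=` patch_image O phi -> E `<=` patch_image O' psi ->
    {within E, continuous f} -> (forall q, E q -> 0 <= f q) ->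
    patch_int O' psi E f <= (1 + e) * patch_int O phi E f.
Proof.
move=> op op' [x0 [Ox0 Hx0] xp] [y0 [Oy0 Hy0] yp] e0.
have [pO _] := op; have [pO' _] := op'.
pose e' := Num.min 1 (e / 7).
have e'0 : 0 < e' by rewrite lt_min ltr01 divr_gt0.
have e'1 : e' <= 1 by rewrite ge_min lexx.
have e'e : e' <= e / 7 by rewrite ge_min lexx orbT.
clearbody e'.
have xy0 : phi x0 = psi y0 by rewrite xp yp.
have [r1 r10 cmp] := patch_compare op op' Ox0 Hx0 Oy0 Hy0 xy0 e'0.
have w0 : 0 < area phi x0 := patch_area_gt0 pO Ox0 Hx0.
have w0' : 0 < area psi y0 := patch_area_gt0 pO' Oy0 Hy0.
have e'2 : 0 < e' / 2 by rewrite divr_gt0.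
have we0 : 0 < area phi x0 * (e' / 2) := mulr_gt0 w0 e'2.
have we0' : 0 < area psi y0 * (e' / 2) := mulr_gt0 w0' e'2.
have [s s0 hs] := continuous_for_eps (continuous_area pO Ox0) we0.
have [s' s'0 hs'] := continuous_for_eps (continuous_area pO' Oy0) we0'.
have [r2 r20 hr2] := patch_inverse_continuous pO Ox0 Hx0 s0.
have [r3 r30 hr3] := patch_inverse_continuous pO' Oy0 Hy0 s'0.
rewrite xp in cmp hr2; rewrite yp in hr3.
rewrite -/(area phi x0) -/(area psi y0) in cmp.
set w := area phi x0 in w0 we0 hs cmp; set w' := area psi y0 in w0' we0' hs' cmp.
clearbody w w'.
exists (Num.min r1 (Num.min r2 r3)); first by rewrite !lt_min r10 r20.
move=> E f cE Er EO EO' cf f0.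
have {}Er q : E q -> [/\ `|p - q| < r1, `|p - q| < r2 & `|p - q| < r3].
  by move=> /Er; rewrite !lt_min => /andP[-> /andP[-> ->]].
set A := patch_preimage O phi E; set A' := patch_preimage O' psi E.
have cA : compact A := patch_preimage_compact pO cE EO.
have cA' : compact A' := patch_preimage_compact pO' cE EO'.
have mA := compact_measurable2 cA; have mA' := compact_measurable2 cA'.
have cfA : {within A, continuous (f \o phi)} by exact: (within_continuous_pullback pO cf).
have cfA' : {within A', continuous (f \o psi)} by exact: (within_continuous_pullback pO' cf).
have iA := continuous_integrable2 cA cfA.
have iA' := continuous_integrable2 cA' cfA'.
have iw := patch_int_integrable pO cE EO cf.
have iw' := patch_int_integrable pO' cE EO' cf.
pose J := Rintegral mu2 A (f \o phi); pose J' := Rintegral mu2 A' (f \o psi).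
have JJ' : w' * J' <= (1 + e') * w * J.
  pose c := (w')^-1 * ((1 + e') * w).
  have c0 : 0 <= c by rewrite mulr_ge0// ?invr_ge0 ?mulr_ge0// ltW// addr_gt0.
  have L : (\int[mu2]_(x in A') ((f \o psi) x)%:E <= c%:E * \int[mu2]_(x in A) ((f \o phi) x)%:E)%E.
    apply: (@layer_cake_le2 _ A A' (f \o phi) (f \o psi) c c0 mA mA').
    - exact: (continuous_measurable_fun2 cA cfA).
    - exact: (continuous_measurable_fun2 cA' cfA').
    - by move=> x [_ _ /f0].
    - by move=> x [_ _ /f0].
    move=> t t0.
    (* A superlevel set of the function read in a patch is the preimage of the compact set where
       [t <= f], so the comparison of measures applies to it. *)
    have sub (Q : set (R * R)) (chi : R * R -> 'rV[R]_3) :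
        [set x | patch_preimage Q chi E x /\ (t <= (f \o chi) x)%R] =
        patch_preimage Q chi (E `&` [set q | (t <= f q)%R]).
      by apply/seteqP; split => [x [[? ? ?] ?]|x [? ? [? ?]]].
    rewrite /A /A' !sub.
    have cEt := superlevel_compact (s := t) cE cf.
    have := cmp _ cEt _ _ _.
    move=> /(_ (fun q Eq => let: And3 h _ _ := Er q Eq.1 in h)).
    move=> /(_ (fun q Eq => EO q Eq.1) (fun q Eq => EO' q Eq.1)) H.
    rewrite /c EFinM -muleA.
    have wi : (0 < ((w')^-1)%:E)%E by rewrite lte_fin invr_gt0.
    apply: le_trans (lee_wpmul2l (ltW wi) H).
    by rewrite muleA -EFinM mulVf ?mul1e// gt_eqF.
  have : J' <= c * J.
    have fA := integrable_fin_num mA iA; have fA' := integrable_fin_num mA' iA'.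
    by rewrite -lee_fin EFinM /J /J' /Rintegral (fineK fA) (fineK fA').
  rewrite -(ler_pM2l w0') /c !mulrA mulfV ?mul1r// gt_eqF//.
have up : patch_int O' psi E f <= (1 + e') * w' * J'.
  rewrite -RintegralZl//; apply: le_Rintegral => //.
    by have := integrableZl mA' ((1 + e') * w') iA'; apply: eq_integrable => // x _; rewrite -EFinM.
  move=> y [Oy Hy Ey]; rewrite /= mulrC ler_wpM2r ?f0//.
  have [_ _ r3q] := Er _ Ey; have := hs' y (hr3 y Oy Hy r3q).
  by rewrite ltr_norml => /andP[h1 h2]; nra.
have down : w * J <= (1 + e') * patch_int O phi E f.
  have E1 : w * J = Rintegral mu2 A (fun x => w * (f \o phi) x).
    symmetry; exact: (@RintegralZl _ _ _ mu2 A (f \o phi) w mA iA).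
  have E2 : (1 + e') * patch_int O phi E f =
      Rintegral mu2 A (fun x => (1 + e') * (f (phi x) * area phi x)).
    symmetry; exact: (@RintegralZl _ _ _ mu2 A (fun x => f (phi x) * area phi x) (1 + e') mA iw).
  rewrite E1 E2; apply: (le_Rintegral mA).
  - by have := integrableZl mA w iA; apply: eq_integrable => // x _; rewrite -EFinM.
  - by have := integrableZl mA (1 + e') iw; apply: eq_integrable => // x _; rewrite -EFinM.
  move=> x [Ox Hx Ex]; have [_ r2q _] := Er _ Ex; have := hs x (hr2 x Ox Hx r2q).
  have fx : 0 <= f (phi x) := f0 _ Ex.
  move: (area phi x) => z; rewrite ltr_norml => /andP[h1 h2].
  have key := ratio_lower_bound (ltW e'0) e'1 (ltW w0) h2.
  by have := ler_wpM2r fx key; rewrite -mulrA (mulrC z).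
have e1 : 0 <= 1 + e' by rewrite addr_ge0// ltW.
have PI0 : 0 <= patch_int O phi E f.
  by apply: Rintegral_ge0 => x [_ _ Ex]; rewrite mulr_ge0 ?f0// enorm_ge0.
apply: (le_trans up); rewrite -mulrA.
apply: (@le_trans _ _ ((1 + e') * ((1 + e') * ((1 + e') * patch_int O phi E f)))).
  apply: ler_wpM2l => //; apply: (le_trans JJ'); rewrite -mulrA.
  exact: ler_wpM2l.
rewrite !mulrA ler_wpM2r// -mulrA.
exact: cube_1D_le (ltW e'0) e'1 e'e.
Qed.

Lemma continuous_dist (V : normedModType R) (p : V) : continuous (fun q => `|p - q|).
Proof.
move=> q; apply: (@continuous_comp _ _ _ (fun q => p - q) (fun z : V => `|z|)).
  by apply: continuousB; [exact: cst_continuous|exact: cvg_id].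
exact: norm_continuous.
Qed.

(** A piecewise linear cutoff in the distance to [p]: 1 up to [r / 2] and 0 from [3 * r / 4] on.
    Continuity is enough where integrals are only compared. *)
Definition plateau (p : 'rV[R]_3) (r : R) (q : 'rV[R]_3) : R :=
  Num.min 1 (Num.max 0 (3 - 4 * `|p - q| / r)).

Lemma plateau_ge0 p r q : 0 <= plateau p r q.
Proof. by rewrite le_min ler01 le_max lexx. Qed.

Lemma plateau_le1 p r q : plateau p r q <= 1.
Proof. by rewrite ge_min lexx. Qed.

Lemma plateau1 p r q : 0 < r -> `|p - q| <= r / 2 -> plateau p r q = 1.
Proof.
move=> r0 h; rewrite /plateau min_l// le_max; apply/orP; right.
have : 4 * `|p - q| / r <= 2 by rewrite ler_pdivrMr//; lra.
lra.
Qed.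

Lemma plateau0 p r q : 0 < r -> r * (3 / 4) <= `|p - q| -> plateau p r q = 0.
Proof.
move=> r0 h; rewrite /plateau max_l ?min_r//.
have : 3 <= 4 * `|p - q| / r by rewrite ler_pdivlMr//; lra.
lra.
Qed.

Lemma continuous_plateau p r : continuous (plateau p r).
Proof.
move=> q.
have cc (z : R) : {for q, continuous (fun _ : 'rV[R]_3 => z)} by exact: cst_continuous.
have cn : {for q, continuous (fun q : 'rV[R]_3 => `|p - q|)} by exact: continuous_dist.
have c0 : {for q, continuous (fun q : 'rV[R]_3 => 3 - 4 * `|p - q| / r)}.
  exact: (continuousB (cc 3) (continuousM (continuousM (cc 4) cn) (cc r^-1))).
exact: (continuous_min (cc 1) (continuous_max (cc 0) c0)).
Qed.

(** Induction on a finite cover of [E] by balls of radius [r p / 2]. The part [f * b] lives on [E1],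
    where the local inequality holds; [f * (1 - b)] lives on [E2], which the other balls cover. The
    pieces add up, so the factor [1 + e] does not accumulate. *)
Lemma patch_int_le O phi O' psi E f (e : R) :
  oriented_patch M N O phi -> oriented_patch M N O' psi -> 0 < e -> compact E ->
  E `<=` patch_image O phi -> E `<=` patch_image O' psi ->
  {within E, continuous f} -> (forall q, E q -> 0 <= f q) ->
  patch_int O' psi E f <= (1 + e) * patch_int O phi E f.
Proof.
move=> op op' e0 cE EO EO' cf f0.
have [pO _] := op; have [pO' _] := op'.
have ex p : exists r : R, E p -> 0 < r /\ forall (G : set 'rV[R]_3) f, compact G -> (forall q, G q -> `|p - q| < r) ->
    G `<=` patch_image O phi -> G `<=` patch_image O' psi ->
    {within G, continuous f} -> (forall q, G q -> 0 <= f q) ->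
    patch_int O' psi G f <= (1 + e) * patch_int O phi G f.
  have [Ep|nEp] := pselect (E p); last by exists 0.
  by have [r r0 hr] := patch_int_le_local op op' (EO _ Ep) (EO' _ Ep) e0; exists r.
have [r hr] := choice ex.
have r20 p : E p -> 0 < r p / 2 by move=> /hr[r0 _]; rewrite divr_gt0.
have [s [sE scov]] := compact_finite_balls cE r20.
have good p : p \in s -> 0 < r p /\ forall (G : set 'rV[R]_3) f, compact G -> (forall q, G q -> `|p - q| < r p) ->
    G `<=` patch_image O phi -> G `<=` patch_image O' psi ->
    {within G, continuous f} -> (forall q, G q -> 0 <= f q) ->
    patch_int O' psi G f <= (1 + e) * patch_int O phi G f.
  by move=> /sE /hr.
clear ex hr r20 sE.
move: s good E f cE EO EO' cf f0 scov; elim => [|p s IH] good E f cE EO EO' cf f0 scov.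
  have E0 : E = set0 by apply/seteqP; split => // q /scov[].
  have P0 Q chi : patch_int Q chi E f = 0.
    rewrite /patch_int (_ : patch_preimage _ _ _ = set0) ?Rintegral_set0//.
    by apply/seteqP; split => // x [_ _]; rewrite E0.
  by rewrite !P0 mulr0.
have [rp0 rp] := good p (mem_head _ _).
pose b := plateau p (r p).
pose E1 := E `&` [set q | 0 <= r p * (3 / 4) - `|p - q|].
pose E2 := E `&` [set q | 0 <= `|p - q| - r p / 2].
have cn := @continuous_dist _ p.
have cc (z : R) : continuous (fun _ : 'rV[R]_3 => z) by exact: cst_continuous.
have cE1 : compact E1.
  apply: superlevel_compact => //; apply: continuous_subspaceT => q.
  exact: continuousB (cc _ q) (cn q).
have cE2 : compact E2.
  apply: superlevel_compact => //; apply: continuous_subspaceT => q.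
  exact: continuousB (cn q) (cc _ q).
have cb : {within E, continuous b} by apply: continuous_subspaceT; exact: continuous_plateau.
have c1 : {within E, continuous (fun q => f q * b q)} by exact: within_continuousM.
have c2 : {within E, continuous (fun q => f q * (1 - b q))}.
  apply: within_continuousM => //; apply: within_continuousB => //.
  by apply: continuous_subspaceT; exact: cst_continuous.
have split_int Q chi : Defs.patch M Q chi -> E `<=` patch_image Q chi ->
    patch_int Q chi E f = patch_int Q chi E1 (fun q => f q * b q) +
    patch_int Q chi E2 (fun q => f q * (1 - b q)).
  move=> pQ EQ.
  rewrite (patch_int_eq Q chi (g := fun q => f q * b q + f q * (1 - b q))); last by move=> q _; ring.
  rewrite (patch_intD pQ cE EQ c1 c2); congr (_ + _); apply: patch_int_sub.
  - by move=> q [].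
  - move=> q Eq nE1; rewrite /b plateau0 ?mulr0//.
    by have [//|h] := leP (r p * (3 / 4)) `|p - q|; exfalso; apply: nE1; split => //=; lra.
  - by move=> q [].
  - move=> q Eq nE2; rewrite /b plateau1 ?subrr ?mulr0//.
    by have [//|h] := leP `|p - q| (r p / 2); exfalso; apply: nE2; split => //=; lra.
rewrite (split_int _ _ pO EO) (split_int _ _ pO' EO') mulrDr; apply: lerD.
  apply: rp => //.
  - move=> q [_ /= h]; lra.
  - by move=> q [/EO].
  - by move=> q [/EO'].
  - by apply: continuous_subspaceW c1 => q [].
  - by move=> q [/f0 fq _]; rewrite mulr_ge0// plateau_ge0.
apply: IH => //.
- by move=> q qs; apply: good; rewrite inE qs orbT.
- by move=> q [/EO].
- by move=> q [/EO'].
- by apply: continuous_subspaceW c2 => q [].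
- by move=> q [/f0 fq _]; rewrite mulr_ge0// subr_ge0 plateau_le1.
- move=> q [/scov[z]]; rewrite inE => /orP[/eqP ->|zs] zq /= h; last by exists z.
  by move: zq h; lra.
Qed.

Lemma patch_int_indep_ge0 O phi O' psi E f :
  oriented_patch M N O phi -> oriented_patch M N O' psi -> compact E ->
  E `<=` patch_image O phi -> E `<=` patch_image O' psi ->
  {within E, continuous f} -> (forall q, E q -> 0 <= f q) ->
  patch_int O' psi E f = patch_int O phi E f.
Proof.
have half Q chi Q' chi' : oriented_patch M N Q chi -> oriented_patch M N Q' chi' -> compact E ->
    E `<=` patch_image Q chi -> E `<=` patch_image Q' chi' ->
    {within E, continuous f} -> (forall q, E q -> 0 <= f q) ->
    patch_int Q' chi' E f <= patch_int Q chi E f.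
  move=> op op' cE EO EO' cf f0; apply/ler_addgt0Pr => e e0.
  have PI0 : 0 <= patch_int Q chi E f.
    by apply: Rintegral_ge0 => x [_ _ Ex]; rewrite mulr_ge0 ?f0// enorm_ge0.
  pose I := patch_int Q chi E f + 1.
  have I0 : 0 < I by rewrite ltr_wpDl.
  have eI : 0 < e / I by rewrite divr_gt0.
  apply: le_trans (patch_int_le op op' eI cE EO EO' cf f0) _.
  rewrite mulrDl mul1r lerD2l -mulrA ler_piMr ?ltW//.
  by rewrite mulrC ltr_pdivrMr// mul1r /I ltrDl.
move=> op op' cE EO EO' cf f0; apply/eqP; rewrite eq_le; apply/andP; split.
  exact: half op op' cE EO EO' cf f0.
exact: half op' op cE EO' EO cf f0.
Qed.

Theorem patch_int_indep O phi O' psi E f :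
  oriented_patch M N O phi -> oriented_patch M N O' psi -> compact E ->
  E `<=` patch_image O phi -> E `<=` patch_image O' psi ->
  {within E, continuous f} -> patch_int O' psi E f = patch_int O phi E f.
Proof.
move=> op op' cE EO EO' cf; have [pO _] := op; have [pO' _] := op'.
(* [f] is the difference of these two nonnegative continuous functions. *)
pose fp q := `|f q| + f q; pose fn q := `|f q|.
have cn : {within E, continuous fn}.
  by move=> q; apply: (@continuous_comp _ _ _ (f : subspace E -> R) (fun z => `|z|)); [exact: cf|exact: norm_continuous].
have cp : {within E, continuous fp} by exact: within_continuousD.
have H Q chi : Defs.patch M Q chi -> E `<=` patch_image Q chi ->
    patch_int Q chi E f = patch_int Q chi E fp - patch_int Q chi E fn.
  by move=> pQ EQ; rewrite (patch_intD pQ cE EQ cn cf) addrC addKr.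
have fp0 q : E q -> 0 <= fp q.
  by move=> _; rewrite /fp; have := ler_norm (- f q); rewrite normrN; lra.
have fn0 q : E q -> 0 <= fn q by move=> _; exact: normr_ge0.
rewrite (H _ _ pO' EO') (H _ _ pO EO).
rewrite (patch_int_indep_ge0 op op' cE EO EO' cp fp0).
by rewrite (patch_int_indep_ge0 op op' cE EO EO' cn fn0).
Qed.

End patch_independence.

(** * Derivatives along the surface *)

Section C1_calculus.
Context {R : realType}.
Implicit Types (A : set (R * R)) (f g : R * R -> R).

Lemma C1on_intro A f (d1 d2 : R * R -> R) : open A ->
  (forall x, A x -> [/\ differentiable f x, 'D_(1, 0) f x = d1 x & 'D_(0, 1) f x = d2 x]) ->
  (forall x, A x -> {for x, continuous d1}) -> (forall x, A x -> {for x, continuous d2}) ->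
  C1on A f.
Proof.
move=> oA df c1 c2 x Ax; have [dfx _ _] := df x Ax.
have nA : \forall y \near x, A y by exact: open_nbhs_nbhs (conj oA Ax).
split=> //.
  by apply: near_eq_continuous (c1 x Ax); apply: filterS nA => y /df[_ -> _].
by apply: near_eq_continuous (c2 x Ax); apply: filterS nA => y /df[_ _ ->].
Qed.

Lemma C1on_continuous A f x : C1on A f -> A x -> {for x, continuous f}.
Proof. by move=> Cf /Cf[df _ _]; exact: differentiable_continuous. Qed.

Lemma C1onS A A' f : A' `<=` A -> C1on A f -> C1on A' f.
Proof. by move=> sA Cf x /sA /Cf. Qed.

Lemma C1on_cst A (c : R) : open A -> C1on A (fun=> c).
Proof.
move=> oA; apply: (@C1on_intro A _ (fun=> 0) (fun=> 0) oA) => x _.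
- by split; [exact: differentiable_cst|exact: derive_cst|exact: derive_cst].
- exact: cst_continuous.
- exact: cst_continuous.
Qed.

Lemma deriveM_diff f g x (v : R * R) : differentiable f x -> differentiable g x ->
  'D_v (fun x => f x * g x) x = f x * 'D_v g x + g x * 'D_v f x.
Proof. by move=> /diff_derivable df /diff_derivable dg; exact: deriveM. Qed.

Lemma C1onM A f g : open A -> C1on A f -> C1on A g -> C1on A (fun x => f x * g x).
Proof.
move=> oA Cf Cg.
apply: (@C1on_intro A _ (fun x => f x * 'D_(1, 0) g x + g x * 'D_(1, 0) f x)
  (fun x => f x * 'D_(0, 1) g x + g x * 'D_(0, 1) f x) oA) => x Ax;
  have [df f1 f2] := Cf x Ax; have [dg g1 g2] := Cg x Ax.
- by split; [exact: differentiableM|exact: deriveM_diff|exact: deriveM_diff].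
- have cf := C1on_continuous Cf Ax; have cg := C1on_continuous Cg Ax.
  exact: (continuousD (continuousM cf g1) (continuousM cg f1)).
- have cf := C1on_continuous Cf Ax; have cg := C1on_continuous Cg Ax.
  exact: (continuousD (continuousM cf g2) (continuousM cg f2)).
Qed.

Lemma C1onD A f g : open A -> C1on A f -> C1on A g -> C1on A (fun x => f x + g x).
Proof.
move=> oA Cf Cg.
apply: (@C1on_intro A _ (fun x => 'D_(1, 0) f x + 'D_(1, 0) g x)
  (fun x => 'D_(0, 1) f x + 'D_(0, 1) g x) oA) => x Ax;
  have [df f1 f2] := Cf x Ax; have [dg g1 g2] := Cg x Ax.
- split; first exact: differentiableD.
    by apply: deriveD; exact: diff_derivable.
  by apply: deriveD; exact: diff_derivable.
- exact: (continuousD f1 g1).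
- exact: (continuousD f2 g2).
Qed.

Lemma C1onB A f g : open A -> C1on A f -> C1on A g -> C1on A (fun x => f x - g x).
Proof.
move=> oA Cf Cg.
have Cg' : C1on A (fun x => -1 * g x) by exact: (C1onM oA (C1on_cst (-1) oA) Cg).
rewrite (_ : (fun x => f x - g x) = (fun x => f x + -1 * g x)); first exact: C1onD.
by apply/funext => x; rewrite mulN1r.
Qed.

Lemma derive_comp1 (V : normedModType R) (h : R -> R) (f : V -> R) (x v : V) :
  derivable h (f x) 1 -> differentiable f x ->
  'D_v (h \o f) x = 'D_1 h (f x) * 'D_v f x.
Proof.
move=> dh df; have dh' : differentiable h (f x) by apply/derivable1_diffP.
rewrite deriveE; last exact: differentiable_comp.
by rewrite diff_comp//= (deriveE v df) (diff1E dh') derive1E /GRing.scale/= mulrC.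
Qed.

Lemma C1on_comp1 A f (h dh : R -> R) : open A -> C1on A f ->
  (forall x, A x -> is_derive (f x) (1 : R) h (dh (f x))) ->
  (forall x, A x -> {for f x, continuous dh}) -> C1on A (h \o f).
Proof.
move=> oA Cf hd hc.
apply: (@C1on_intro A _ (fun x => dh (f x) * 'D_(1, 0) f x) (fun x => dh (f x) * 'D_(0, 1) f x) oA) => x Ax;
  have [df f1 f2] := Cf x Ax.
- have hx := hd x Ax; have dhx : derivable h (f x) 1 by exact: ex_derive.
  split; first by apply: differentiable_comp => //; apply/derivable1_diffP.
    by rewrite derive_comp1// (derive_val (is_derive := hx)).
  by rewrite derive_comp1// (derive_val (is_derive := hx)).
- have cdh : {for x, continuous (dh \o f)}.
    by apply: continuous_comp; [exact: C1on_continuous Cf Ax|exact: hc].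
  exact: (continuousM cdh f1).
- have cdh : {for x, continuous (dh \o f)}.
    by apply: continuous_comp; [exact: C1on_continuous Cf Ax|exact: hc].
  exact: (continuousM cdh f2).
Qed.

Lemma derive_comp_rV (V : normedModType R) (F : 'rV[R]_3 -> R) (phi : V -> 'rV[R]_3) (x v : V) :
  differentiable F (phi x) -> differentiable phi x ->
  'D_v (F \o phi) x = \sum_i ('D_v phi x) 0 i * 'D_(delta_mx 0 i) F (phi x).
Proof.
move=> dF dphi; rewrite deriveE; last exact: differentiable_comp.
rewrite diff_comp//= -(deriveE v dphi) [in LHS](row_sum_delta ('D_v phi x)) linear_sum.
by apply: eq_bigr => i _; rewrite linearZ/= -(deriveE _ dF).
Qed.

Lemma C1on_comp_rV A (B : set 'rV[R]_3) (F : 'rV[R]_3 -> R) (phi : R * R -> 'rV[R]_3) :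
  open A -> class_C 1 A phi -> class_C 1 B F -> (forall x, A x -> B (phi x)) ->
  C1on A (F \o phi).
Proof.
move=> oA [dphi cphi] [dF cF] AB.
pose d v x := \sum_i ('D_v phi x) 0 i * 'D_(delta_mx 0 i) F (phi x).
have cd v x : A x -> {for x, continuous (d v)}.
  move=> Ax.
  have c i : {for x, continuous (fun x => ('D_v phi x) 0 i * 'D_(delta_mx 0 i) F (phi x))}.
    apply: continuousM; first by apply: continuous_rV_coord; exact: (cphi v x Ax).
    apply: (@continuous_comp _ _ _ phi ('D_(delta_mx 0 i) F)).
      exact: differentiable_continuous (dphi x Ax).
    exact: (cF (delta_mx 0 i) (phi x) (AB x Ax)).
  rewrite (_ : d v = fun x => ('D_v phi x) 0 0 * 'D_(delta_mx 0 0) F (phi x)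
     + ('D_v phi x) 0 1 * 'D_(delta_mx 0 1) F (phi x)
     + ('D_v phi x) 0 2 * 'D_(delta_mx 0 2) F (phi x)).
    exact: (continuousD (continuousD (c 0) (c 1)) (c 2)).
  by apply/funext => y; rewrite /d sum_ord3.
apply: (@C1on_intro A _ (d (1, 0)) (d (0, 1)) oA) => x Ax; [|exact: cd|exact: cd].
by split; [apply: differentiable_comp; [exact: dphi|exact: dF (AB x Ax)]|
  apply: derive_comp_rV; [exact: dF (AB x Ax)|exact: dphi]|
  apply: derive_comp_rV; [exact: dF (AB x Ax)|exact: dphi]].
Qed.

Definition C1von A (u : R * R -> 'rV[R]_3) := forall i, C1on A (fun x => u x 0 i).

Lemma class_C1_C1von A u : open A -> class_C 1 A u -> C1von A u.
Proof. by move=> oA Cu i; apply: class_C1_C1on; exact: class_C1_coord. Qed.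

Lemma differentiable_rV (V : normedModType R) (u : V -> 'rV[R]_3) (x : V) :
  (forall i, differentiable (fun y => u y 0 i) x) -> differentiable u x.
Proof.
move=> du.
rewrite (_ : u = (fun y => u y 0 0 *: (delta_mx 0 0 : 'rV[R]_3)) + (fun y => u y 0 1 *: (delta_mx 0 1 : 'rV[R]_3))
   + (fun y => u y 0 2 *: (delta_mx 0 2 : 'rV[R]_3))); last first.
  apply/funext => y; rewrite [LHS]row_sum_delta sum_ord3; by [].
apply: differentiableD; first apply: differentiableD; apply: differentiableZl; exact: du.
Qed.

Lemma C1von_differentiable A u x : C1von A u -> A x -> differentiable u x.
Proof. by move=> Cu Ax; apply: differentiable_rV => i; have [] := Cu i x Ax. Qed.

Lemma C1von_derive A u x v i : C1von A u -> A x -> ('D_v u x) 0 i = 'D_v (fun y => u y 0 i) x.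
Proof. by move=> Cu Ax; rewrite derive_coord//; exact: C1von_differentiable Cu Ax. Qed.

Lemma C1onV_sqrt A f : open A -> C1on A f -> (forall x, A x -> 0 < f x) ->
  C1on A (fun x => (Num.sqrt (f x))^-1).
Proof.
move=> oA Cf f0.
pose dh (t : R) := - (2 * Num.sqrt t ^+ 3)^-1.
apply: (@C1on_comp1 A f (fun t => (Num.sqrt t)^-1) dh oA Cf) => x Ax; have fx := f0 x Ax.
  have sx : Num.sqrt (f x) != 0 by rewrite gt_eqF// sqrtr_gt0.
  have d1 : is_derive (f x) 1 Num.sqrt (2 * Num.sqrt (f x))^-1 by exact: is_derive1_sqrt.
  have dP := @is_deriveV _ Num.sqrt (f x) _ 1 sx d1.
  by apply: (is_derive_eq dP); rewrite /dh /GRing.scale/=; field.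
rewrite /dh; apply: continuousN; apply: continuousV.
  by rewrite gt_eqF// mulr_gt0// exprn_gt0// sqrtr_gt0.
apply: continuousM; first exact: cst_continuous.
apply: (@continuous_comp _ _ _ Num.sqrt (fun z : R => z ^+ 3)); first exact: sqrt_continuous.
exact: exprn_continuous.
Qed.

End C1_calculus.

Lemma sub_common {V : zmodType} (p a b : V) : a - b = (p - b) - (p - a).
Proof. by rewrite opprB [RHS]addrC addrA subrK. Qed.

Lemma sub_common3 {V : zmodType} (p q a b : V) : a - b = (p - q) + (q - b) - (p - a).
Proof. by rewrite subrKA; exact: sub_common. Qed.

Section derivatives_along.
Context {R : realType}.

Lemma differentiable_eps (V W : normedModType R) (f : V -> W) (p : V) (e : R) :
  differentiable f p -> 0 < e -> exists2 r : R, 0 < r & forall q, `|p - q| < r ->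
    `|f q - f p - 'd f p (q - p)| <= e * `|q - p|.
Proof.
move=> /diff_locallyP[_ /eqaddoP/(_ e)] /[apply] /nbhs_normP[r /= r0 hr].
exists r => // q pq; have := hr (q - p).
rewrite /= sub0r normrN distrC => /(_ pq).
by rewrite !fctE /= subrK opprD addrA.
Qed.

Lemma nbhs_of_ball (V : normedModType R) (p : V) (P : set V) (r : R) : 0 < r ->
  (forall q, `|p - q| < r -> P q) -> nbhs p P.
Proof. by move=> r0 H; apply/nbhs_normP; exists r. Qed.

(** The restriction to [e <= 1] lets errors quadratic in [e] be bounded by linear ones. *)
Lemma norm_small_eq0 (V : normedModType R) (z : V) (K : R) :
  (forall e, 0 < e -> e <= 1 -> `|z| <= e * K) -> z = 0.
Proof.
move=> H; apply/eqP; rewrite -normr_eq0; apply/eqP/le_anti; rewrite normr_ge0 andbT.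
apply/ler_addgt0Pr => e e0; rewrite add0r.
pose K' := `|K| + 1; have K'0 : 0 < K' by rewrite ltr_wpDl.
pose e' := Num.min 1 (e / K').
have e'0 : 0 < e' by rewrite lt_min ltr01 divr_gt0.
have e'1 : e' <= 1 by rewrite ge_min lexx.
apply: le_trans (H _ e'0 e'1) _.
have KK' : K <= K' by rewrite (le_trans (ler_norm _))// lerDl.
apply: (@le_trans _ _ (e' * K')); first by rewrite ler_pM2l.
by rewrite -ler_pdivlMr// ge_min lexx orbT.
Qed.

Definition half_plane_dir (v : R * R) := v = (1, 0) \/ v = (0, 1).

Lemma half_plane_shift (x v : R * R) (h : R) : half_plane_dir v -> half_plane x -> 0 <= h ->
  half_plane (x + h *: v).
Proof.
rewrite /half_plane/= => -[->|->] /= x0 h0; rewrite /GRing.scale/= ?mulr0 ?mulr1 ?addr0//.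
exact: addr_ge0.
Qed.

Lemma norm_half_plane_dir (v : R * R) : half_plane_dir v -> `|v| = 1.
Proof.
by case=> ->; rewrite prod_normE/= normr0 normr1; [rewrite max_l|rewrite max_r].
Qed.

Lemma derive_dir_eps (W : normedModType R) (f : R * R -> W) (x v : R * R) (e : R) :
  half_plane_dir v -> differentiable f x -> 0 < e -> exists2 r : R, 0 < r &
  forall h, 0 < h -> h < r -> `|f (x + h *: v) - f x - h *: 'D_v f x| <= e * h.
Proof.
move=> hv df e0; have [r r0 hr] := differentiable_eps df e0.
exists r => // h h0 hr'.
have E0 : x + h *: v - x = h *: v by rewrite addrAC subrr add0r.
have E : `|x + h *: v - x| = h.
  by rewrite E0 normrZ norm_half_plane_dir// mulr1 gtr0_norm.
have := hr (x + h *: v); rewrite distrC E => /(_ hr').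
by rewrite E0 linearZ/= -(deriveE v df).
Qed.

(* Only directions pointing into the half plane are needed, so that the
   derivatives at its boundary are determined by the values on one side. *)
Lemma half_plane_derive_eq (W : normedModType R) (f g : R * R -> W) (x v : R * R) (r : R) :
  half_plane_dir v -> half_plane x -> 0 < r ->
  (forall y, half_plane y -> `|x - y| < r -> f y = g y) ->
  differentiable f x -> differentiable g x -> 'D_v f x = 'D_v g x.
Proof.
move=> hv Hx r0 fg df dg; apply/eqP; rewrite -subr_eq0; apply/eqP.
apply: (@norm_small_eq0 _ _ 2) => e e0 _.
have [r1 r10 h1] := derive_dir_eps hv df e0.
have [r2 r20 h2] := derive_dir_eps hv dg e0.
pose h := Num.min r (Num.min r1 r2) / 2.
have m0 : 0 < Num.min r (Num.min r1 r2) by rewrite !lt_min r0 r10.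
have h0 : 0 < h by rewrite divr_gt0.
have hm : h < Num.min r (Num.min r1 r2) by rewrite /h ltr_pdivrMr// ltr_pMr// ltr1n.
move: hm; rewrite !lt_min => /andP[hr /andP[hr1 hr2]].
have fgx : f x = g x by apply: fg => //; rewrite subrr normr0.
have fgq : f (x + h *: v) = g (x + h *: v).
  apply: fg; first by apply: half_plane_shift => //; exact: ltW.
  by rewrite opprD addrA subrr sub0r normrN normrZ norm_half_plane_dir// mulr1 gtr0_norm.
have {}h1 := h1 h h0 hr1; have {}h2 := h2 h h0 hr2.
rewrite fgx fgq in h1.
rewrite -(ler_pM2l h0) -{1}(gtr0_norm h0) -normrZ scalerBr.
have -> : h *: 'D_v f x - h *: 'D_v g x =
  (g (x + h *: v) - g x - h *: 'D_v g x) - (g (x + h *: v) - g x - h *: 'D_v f x).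
  exact: sub_common.
by rewrite (le_trans (ler_normB _ _))//; lra.
Qed.

Lemma mulmx_bounded (L : 'M[R]_3) : exists2 C : R, 0 < C & forall q : 'rV[R]_3, `|q *m L| <= C * `|q|.
Proof.
pose C := 3 * `|L| + 1.
have C0 : 0 < C by rewrite ltr_wpDl// mulr_ge0.
exists C => // q; apply: norm_le_coord; first by rewrite mulr_ge0// ltW.
move=> i; rewrite mxE sum_ord3.
have c j : `|q 0 j * L j i| <= `|L| * `|q|.
  rewrite normrM mulrC; apply: ler_pM => //; last exact: coord_le_norm.
  rewrite [leRHS]mx_normrE.
  exact: (le_bigmax _ (fun ij : 'I_3 * 'I_3 => `|L ij.1 ij.2|) (j, i)).
rewrite (le_trans (ler_normD _ _))//.
have := ler_normD (q 0 0 * L 0 i) (q 0 1 * L 1 i).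
have := c 0; have := c 1; have := c 2; have := normr_ge0 q; rewrite /C mulrDl mul1r -mulrA; lra.
Qed.

Variables (M : set 'rV[R]_3).

Lemma derivative_along_eps (F : 'rV[R]_3 -> 'rV[R]_3) (p : 'rV[R]_3) (L : 'M[R]_3) :
  derivative_along M F p L <-> forall e : R, 0 < e -> exists2 r : R, 0 < r &
    forall q, M q -> `|p - q| < r -> `|F q - F p - (q - p) *m L| <= e * `|q - p|.
Proof.
split=> H e e0.
  have := H e e0; rewrite near_withinE => /nbhs_normP[r /= r0 hr].
  by exists r => // q Mq pq; exact: hr.
have [r r0 hr] := H e e0; rewrite near_withinE.
by apply: (@nbhs_of_ball 'rV[R]_3 p _ r r0) => q pq Mq; exact: hr.
Qed.

(** Chain rule for [F o phi] when [F] is differentiable only along [M]. An increment h > 0 in the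
    direction [v] stays in the half plane, hence [phi] keeps it on [M], where [g] and [F o phi]
    agree. *)
Lemma derivative_along_derive (O : set (R * R)) (phi : R * R -> 'rV[R]_3)
    (F : 'rV[R]_3 -> 'rV[R]_3) (g : R * R -> 'rV[R]_3) (x v : R * R) (L : 'M[R]_3) (r : R) :
  Defs.patch M O phi -> half_plane_dir v -> O x -> half_plane x ->
  derivative_along M F (phi x) L -> differentiable g x -> 0 < r ->
  (forall y, O y -> half_plane y -> `|x - y| < r -> g y = F (phi y)) ->
  'D_v g x = 'D_v phi x *m L.
Proof.
move=> pO hv Ox Hx /derivative_along_eps dF dg r0 gF.
have [oO _ _ _ _] := pO.
have dphi : differentiable phi x by have [d _] := patch_C1 pO; exact: d.
have [C C0 hC] := mulmx_bounded L.
apply/eqP; rewrite -subr_eq0; apply/eqP.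
(* In units of [e * h]: one 1 for the error of [g], [C] for the error of [phi] carried through [L],
   and [|D_v phi x| + 1] for the error of [F], which is proportional to the length of the chord. *)
apply: (@norm_small_eq0 _ _ (1 + C + `|'D_v phi x| + 1)) => e e0 e1.
have [r1 r10 h1] := derive_dir_eps hv dg e0.
have [r2 r20 h2] := derive_dir_eps hv dphi e0.
have [r3 r30 h3] := dF e e0.
have [r4 r40 h4] := continuous_for_eps (differentiable_continuous dphi) r30.
have [r5 r50 h5] := open_ball_subset oO Ox.
pose m := Num.min r (Num.min r1 (Num.min r2 (Num.min r4 r5))).
have m0 : 0 < m by rewrite !lt_min r0 r10 r20 r40.
pose h := m / 2; have h0 : 0 < h by rewrite divr_gt0.
have hm : h < m by rewrite /h ltr_pdivrMr// ltr_pMr// ltr1n.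
move: hm; rewrite !lt_min => /andP[hr /andP[hr1 /andP[hr2 /andP[hr4 hr5]]]].
set y := x + h *: v.
have xy : `|x - y| = h.
  by rewrite opprD addrA subrr sub0r normrN normrZ norm_half_plane_dir// mulr1 gtr0_norm.
have Hy : half_plane y by apply: half_plane_shift => //; exact: ltW.
have Oy : O y by apply: h5; rewrite xy.
have gy : g y = F (phi y) by apply: gF => //; rewrite xy.
have gx : g x = F (phi x) by apply: gF => //; rewrite subrr normr0.
have pxy : `|phi x - phi y| < r3 by apply: h4; rewrite xy.
have My : M (phi y) by exact: (patch_sub pO).
have {}h1 := h1 h h0 hr1; have {}h2 := h2 h h0 hr2.
have {}h3 := h3 _ My pxy; rewrite -/y gy gx in h1.
rewrite -/y in h2.
set D := phi y - phi x in h2 h3; set G := F (phi y) - F (phi x) in h1 h3.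
clearbody D G; move: ('D_v phi x) ('D_v g x) h1 h2 => P Q h1 h2.
clear dF dg gF pO dphi h4 h5 gy gx Oy Hy xy My pxy.
have nD : `|D| <= e * h + h * `|P|.
  have := ler_normD (D - h *: P) (h *: P).
  rewrite subrK normrZ (gtr0_norm h0) => H; apply: (le_trans H).
  exact: lerD h2 (lexx _).
have nC : `|(D - h *: P) *m L| <= C * (e * h).
  by apply: le_trans (hC _) _; rewrite ler_pM2l.
rewrite -(ler_pM2l h0) -{1}(gtr0_norm h0) -normrZ scalerBr.
have -> : h *: Q - h *: (P *m L) =
  (G - D *m L) + (D - h *: P) *m L - (G - h *: Q).
  have -> : (D - h *: P) *m L = D *m L - h *: (P *m L).
    by rewrite mulmxBl scalemxAl.
  exact: sub_common3.
rewrite (le_trans (ler_normB _ _))//.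
have n1 := ler_normD (G - D *m L) ((D - h *: P) *m L).
have n3 : e * `|D| <= e * (e * h + h * `|P|) by rewrite ler_pM2l.
have ee : e * (e * h) <= 1 * (e * h) by rewrite ler_wpM2r// mulr_ge0 ?ltW.
move: h1 h3 nC n1 n3 ee.
by rewrite !mulrDr => *; lra.
Qed.

Lemma derivative_along_of_differentiable (F G : 'rV[R]_3 -> 'rV[R]_3) (A : set 'rV[R]_3) (p : 'rV[R]_3) :
  open A -> A p -> M p -> differentiable G p -> (forall q, M q -> A q -> G q = F q) ->
  derivative_along M F p (jacobian G p).
Proof.
move=> oA Ap Mp dG GF; apply/derivative_along_eps => e e0.
have [r r0 hr] := differentiable_eps dG e0.
have [s s0 hs] := open_ball_subset oA Ap.
exists (Num.min r s) => [|q Mq]; first by rewrite lt_min r0.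
rewrite lt_min => /andP[pr ps].
rewrite -(GF q Mq (hs _ ps)) -(GF p Mp Ap) /jacobian mul_rV_lin1.
exact: hr.
Qed.

Lemma class_C1_derivative_along (F : 'rV[R]_3 -> 'rV[R]_3) (p : 'rV[R]_3) :
  class_C_on 1 M F -> M p -> exists L, derivative_along M F p L.
Proof.
move=> CF Mp; have [A [G [oA Ap [dG _] GF]]] := CF p Mp.
exists (jacobian G p); apply: derivative_along_of_differentiable GF => //.
exact: dG.
Qed.

(* Uses the inverse of the differential of phi on its image to transport the
   derivative of F o phi to the surface. *)
Lemma derivative_along_of_chart (O : set (R * R)) (phi : R * R -> 'rV[R]_3)
    (F : 'rV[R]_3 -> 'rV[R]_3) (g : R * R -> 'rV[R]_3) (x : R * R) (r : R) :
  Defs.patch M O phi -> O x -> half_plane x -> differentiable g x -> 0 < r ->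
  (forall y, O y -> half_plane y -> `|x - y| < r -> g y = F (phi y)) ->
  exists L, derivative_along M F (phi x) L.
Proof.
move=> pO Ox Hx dg r0 gF; have [oO _ _ _ _] := pO.
have dphi : differentiable phi x by have [d _] := patch_C1 pO; exact: d.
have n0 : crossmul (partial_u phi x) (partial_v phi x) != 0 := patch_normal_neq0 pO Ox Hx.
set a := partial_u phi x in n0 *; set b := partial_v phi x in n0 *.
pose L : 'M[R]_3 := (dual1 a b)^T *m 'd g x (1, 0) + (dual2 a b)^T *m 'd g x (0, 1).
have LE q : q *m L = 'd g x (coords a b q).
  rewrite mulmxDr !mulmxA.
  have cE : coords a b q = dotmul q (dual1 a b) *: ((1, 0) : R * R) + dotmul q (dual2 a b) *: ((0, 1) : R * R).
    by rewrite /coords; congr pair; rewrite /= /GRing.scale/= ?mulr1 ?mulr0 ?addr0 ?add0r.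
  have dotE (w z : 'rV[R]_3) : q *m w^T *m z = dotmul q w *: z.
    by rewrite [q *m w^T]mx11_scalar mul_scalar_mx.
  rewrite !dotE cE linearD !linearZ/=; reflexivity.
have dphiE v : 'd phi x v = lin_comb a b v.
  have vE : v = v.1 *: ((1, 0) : R * R) + v.2 *: ((0, 1) : R * R).
    by case: v => v1 v2; congr pair; rewrite /= /GRing.scale/= ?mulr1 ?mulr0 ?addr0 ?add0r.
  have aE : a = 'd phi x (1, 0) by exact: deriveE.
  have bE : b = 'd phi x (0, 1) by exact: deriveE.
  by rewrite {1}vE linearD !linearZ/= /lin_comb aE bE.
exists L; apply/derivative_along_eps => e e0.
have [K K0 hK] := coords_bounded a b.
have [B [B0 hB]] : exists B, 0 < B /\ forall v, `|'d g x v| <= B * `|v|.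
  have /linear_boundedP[B0 [_ hB]] : bounded_near ('d g x) (nbhs 0).
    by apply/linear_bounded_continuous; exact: diff_continuous.
  exists (Num.max (B0 + 1) 1); split; first by rewrite lt_max ltr01 orbT.
  by move=> v; apply: hB; rewrite lt_max ltrDl ltr01.
pose e1 := Num.min (2 * K)^-1 (e / (2 * K * (1 + B * K))).
have BK0 : 0 < 2 * K * (1 + B * K) by rewrite !mulr_gt0// addr_gt0// mulr_gt0.
have e10 : 0 < e1 by rewrite lt_min invr_gt0 mulr_gt0//= divr_gt0.
have e1K : e1 * (2 * K) <= 1 by rewrite -ler_pdivlMr ?mulr_gt0// mul1r ge_min lexx.
have e1e : e1 * (2 * K * (1 + B * K)) <= e by rewrite -ler_pdivlMr// ge_min lexx orbT.
clearbody e1.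
have [r1 r10 h1] := differentiable_eps dg e10.
have [r2 r20 h2] := differentiable_eps dphi e10.
have m0 : 0 < Num.min r (Num.min r1 r2) by rewrite !lt_min r0 r10.
have [s s0 hs] := patch_inverse_continuous pO Ox Hx m0.
have [s' s'0 hs'] : exists2 s' : R, 0 < s' & forall q, M q -> `|phi x - q| < s' -> patch_image O phi q.
  by apply: (patch_image_rel_open pO); exists x.
exists (Num.min s s') => [|q Mq]; first by rewrite lt_min s0.
rewrite lt_min => /andP[qs qs'].
have [y [Oy Hy] yq] := hs' q Mq qs'.
rewrite -yq in qs *.
have := hs y Oy Hy qs; rewrite !lt_min => /andP[xr /andP[xr1 xr2]].
have {}h1 := h1 y xr1; have {}h2 := h2 y xr2.
rewrite -(gF y Oy Hy xr) -(gF x Ox Hx); last by rewrite subrr normr0.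
rewrite LE.
set k := y - x in h1 h2; set D := phi y - phi x in h2 *; rewrite dphiE in h2.
have cE : coords a b D = k + coords a b (D - lin_comb a b k).
  by rewrite coordsB coordsK// addrC subrK.
have nc : `|coords a b (D - lin_comb a b k)| <= K * (e1 * `|k|).
  by apply: le_trans (hK _) _; rewrite ler_pM2l.
have nk : `|k| <= 2 * K * `|D|.
  have : `|k| <= K * `|D| + K * (e1 * `|k|).
    rewrite -[X in `|X| <= _](addrK (coords a b (D - lin_comb a b k)) k) -cE.
    by rewrite (le_trans (ler_normB _ _))// lerD.
  have : e1 * (2 * K) * `|k| <= 1 * `|k| by rewrite ler_wpM2r.
  move: `|k| `|D| => kk dd; lra.
have -> : g y - g x - 'd g x (coords a b D) =
    (g y - g x - 'd g x k) - 'd g x (coords a b (D - lin_comb a b k)).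
  by rewrite cE linearD/= opprD addrA.
rewrite (le_trans (ler_normB _ _))//.
have nB : `|'d g x (coords a b (D - lin_comb a b k))| <= B * (K * (e1 * `|k|)).
  by apply: le_trans (hB _) _; rewrite ler_pM2l.
apply: (@le_trans _ _ (e1 * `|k| + B * (K * (e1 * `|k|)))); first exact: lerD.
have -> : e1 * `|k| + B * (K * (e1 * `|k|)) = (e1 * (1 + B * K)) * `|k| by ring.
have c0 : 0 <= e1 * (1 + B * K) by rewrite mulr_ge0 ?addr_ge0 ?mulr_ge0 ?ltW.
apply: le_trans (ler_wpM2l c0 nk) _.
rewrite [leLHS](_ : _ = e1 * (2 * K * (1 + B * K)) * `|D|); last by ring.
exact: ler_wpM2r.
Qed.

End derivatives_along.

Section vector_calculus.
Context {R : realType}.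
Implicit Types (A : set (R * R)) (f g : R * R -> R) (u w : R * R -> 'rV[R]_3).

Lemma C1von_crossmul A u w : open A -> C1von A u -> C1von A w ->
  C1von A (fun x => crossmul (u x) (w x)).
Proof.
move=> oA Cu Cw i.
rewrite (_ : (fun x => _) = (fun x => u x 0 (i + 1) * w x 0 (i + 2) - u x 0 (i + 2) * w x 0 (i + 1))).
  exact: (C1onB oA (C1onM oA (Cu _) (Cw _)) (C1onM oA (Cu _) (Cw _))).
by apply/funext => x; rewrite mxE.
Qed.

Lemma C1on_dotmul A u w : open A -> C1von A u -> C1von A w ->
  C1on A (fun x => dotmul (u x) (w x)).
Proof.
move=> oA Cu Cw.
rewrite (_ : (fun x => _) = (fun x => u x 0 0 * w x 0 0 + u x 0 1 * w x 0 1 + u x 0 2 * w x 0 2)).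
  have c i := C1onM oA (Cu i) (Cw i).
  exact: (C1onD oA (C1onD oA (c 0) (c 1)) (c 2)).
by apply/funext => x; rewrite dotmulE.
Qed.

Lemma C1von_scale A f u : open A -> C1on A f -> C1von A u -> C1von A (fun x => f x *: u x).
Proof.
move=> oA Cf Cu i.
rewrite (_ : (fun x => _) = (fun x => f x * u x 0 i)); first exact: (C1onM oA Cf (Cu i)).
by apply/funext => x; rewrite mxE.
Qed.

Lemma C1von_continuous_derive A u x : C1von A u -> open A -> A x ->
  {for x, continuous ('D_(1, 0) u)} /\ {for x, continuous ('D_(0, 1) u)}.
Proof.
move=> Cu oA Ax; have nA : \forall y \near x, A y by exact: open_nbhs_nbhs (conj oA Ax).
split; apply: continuous_rV => i; have [_ c1 c2] := Cu i x Ax.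
  apply: near_eq_continuous c1; apply: filterS nA => y Ay.
  by rewrite (C1von_derive (1, 0) i Cu Ay).
apply: near_eq_continuous c2; apply: filterS nA => y Ay.
by rewrite (C1von_derive (0, 1) i Cu Ay).
Qed.

Lemma differentiable_dotmul (u w : R * R -> 'rV[R]_3) x : differentiable u x -> differentiable w x ->
  differentiable (fun y => dotmul (u y) (w y)) x.
Proof.
move=> du dw.
rewrite (_ : (fun x => _) = (fun x => u x 0 0 * w x 0 0 + u x 0 1 * w x 0 1 + u x 0 2 * w x 0 2)).
  have c i : differentiable (fun x => u x 0 i * w x 0 i) x.
    by apply: differentiableM; exact: differentiable_rV_coord.
  exact: (differentiableD (differentiableD (c 0) (c 1)) (c 2)).
by apply/funext => y; rewrite dotmulE.
Qed.

Lemma derive_dotmul (u w : R * R -> 'rV[R]_3) (x v : R * R) : differentiable u x -> differentiable w x ->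
  'D_v (fun y => dotmul (u y) (w y)) x = dotmul ('D_v u x) (w x) + dotmul (u x) ('D_v w x).
Proof.
move=> du dw.
have d i : derivable (fun x => u x 0 i * w x 0 i) x v.
  apply: diff_derivable; apply: differentiableM; exact: differentiable_rV_coord.
have e i : 'D_v (fun x => u x 0 i * w x 0 i) x = u x 0 i * ('D_v w x) 0 i + w x 0 i * ('D_v u x) 0 i.
  by rewrite deriveM_diff; rewrite ?derive_coord//; exact: differentiable_rV_coord.
rewrite (_ : (fun x => _) = (fun x => u x 0 0 * w x 0 0) + (fun x => u x 0 1 * w x 0 1) + (fun x => u x 0 2 * w x 0 2)).
  rewrite (deriveD (derivableD (d 0) (d 1)) (d 2)) (deriveD (d 0) (d 1)) !e !dotmulE.
  move: ('D_v u x) ('D_v w x) => U W; ring.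
by apply/funext => y; rewrite dotmulE.
Qed.

Lemma open_pos_set A f : open A -> (forall x, A x -> {for x, continuous f}) ->
  open (A `&` [set x | 0 < f x]).
Proof.
move=> oA cf; rewrite openE => x [Ax fx]; rewrite /interior.
have [r1 r10 h1] := open_ball_subset oA Ax.
have [r2 r20 h2] := continuous_for_eps (cf x Ax) fx.
apply: (@nbhs_of_ball R _ x _ (Num.min r1 r2)); first by rewrite lt_min r10.
move=> y; rewrite lt_min => /andP[/h1 Ay /h2 fxy]; split => //=.
by move: fxy; rewrite ltr_norml => /andP[? ?]; lra.
Qed.

(** The second difference of [f] over a square of side [h] with corner [x] is [h * h] times either
    mixed derivative at some point of the square, according to the order in which the mean value
    theorem is applied. Both derivatives are continuous at [x]. *)
Lemma schwarz A f fu fv x : open A -> C1on A f -> C1on A fu -> C1on A fv ->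
  (forall y, A y -> 'D_(1, 0) f y = fu y) -> (forall y, A y -> 'D_(0, 1) f y = fv y) ->
  A x -> 'D_(0, 1) fu x = 'D_(1, 0) fv x.
Proof.
move=> oA Cf C1 C2 fuE fvE Ax; case: x Ax => a b Ax.
pose P : R * R -> R := 'D_(0, 1) fu; pose Q : R * R -> R := 'D_(1, 0) fv.
rewrite -/(P (a, b)) -/(Q (a, b)).
have [_ _ cP] := C1 _ Ax; have [_ cQ _] := C2 _ Ax.
apply/eqP; rewrite -subr_eq0; apply/eqP.
apply: (@norm_small_eq0 _ _ _ 2) => e e0 _.
have [r1 r10 h1] := open_ball_subset oA Ax.
have [r2 r20 h2] := continuous_for_eps cP e0.
have [r3 r30 h3] := continuous_for_eps cQ e0.
pose m := Num.min r1 (Num.min r2 r3).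
have m0 : 0 < m by rewrite !lt_min r10 r20.
pose h := m / 2; have h0 : 0 < h by rewrite divr_gt0.
have hm : h < m by rewrite /h ltr_pdivrMr// ltr_pMr// ltr1n.
have near s t : a <= s <= a + h -> b <= t <= b + h ->
    [/\ A (s, t), `|P (a, b) - P (s, t)| < e & `|Q (a, b) - Q (s, t)| < e].
  move=> /andP[s1 s2] /andP[t1 t2].
  have : `|(a, b) - (s, t)| < m.
    by rewrite prod_normE gt_max/= !ltr_norml; apply/andP; split; apply/andP; split; lra.
  by rewrite !lt_min => /andP[? /andP[? ?]]; split; [exact: h1|exact: h2|exact: h3].
have ia : a <= a <= a + h by apply/andP; split; lra.
have ia' : a <= a + h <= a + h by apply/andP; split; lra.
have ib : b <= b <= b + h by apply/andP; split; lra.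
have ib' : b <= b + h <= b + h by apply/andP; split; lra.
have mn (c : R) : (Num.min c (c + h) = c) * (Num.max c (c + h) = c + h).
  by have cc : c <= c + h by [rewrite lerDl ltW]; rewrite (min_l cc) (max_r cc).
have [|s hs Es] := @MVT_between _ (fun s => f (s, b + h) - f (s, b))
    (fun s => fu (s, b + h) - fu (s, b)) a (a + h).
  move=> s; rewrite !mn => hs.
  have [A1 _ _] := near s _ hs ib'; have [A2 _ _] := near s _ hs ib.
  have [d1 _ _] := Cf _ A1; have [d2 _ _] := Cf _ A2.
  rewrite -(fuE _ A1) -(fuE _ A2); exact: (is_deriveB (is_derive_slice1 d1) (is_derive_slice1 d2)).
rewrite !mn in hs.
have [|t ht Et] := @MVT_between _ (fun t => fu (s, t)) (fun t => P (s, t)) b (b + h).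
  move=> t; rewrite !mn => ht; have [A1 _ _] := near s t hs ht.
  have [d1 _ _] := C1 _ A1; exact: is_derive_slice2.
rewrite !mn in ht.
have [|t' ht' Et'] := @MVT_between _ (fun t => f (a + h, t) - f (a, t))
    (fun t => fv (a + h, t) - fv (a, t)) b (b + h).
  move=> t'; rewrite !mn => ht'.
  have [A1 _ _] := near _ t' ia' ht'; have [A2 _ _] := near _ t' ia ht'.
  have [d1 _ _] := Cf _ A1; have [d2 _ _] := Cf _ A2.
  rewrite -(fvE _ A1) -(fvE _ A2); exact: (is_deriveB (is_derive_slice2 d1) (is_derive_slice2 d2)).
rewrite !mn in ht'.
have [|s' hs' Es'] := @MVT_between _ (fun s => fv (s, t')) (fun s => Q (s, t')) a (a + h).
  move=> s'; rewrite !mn => hs'; have [A1 _ _] := near s' t' hs' ht'.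
  have [d1 _ _] := C2 _ A1; exact: is_derive_slice1.
rewrite !mn in hs'.
have [_ p1 _] := near s t hs ht; have [_ _ p2] := near s' t' hs' ht'.
have PQ : P (s, t) = Q (s', t').
  have hh : h * h != 0 by rewrite mulf_neq0// gt_eqF.
  have sh (c : R) : c + h - c = h by rewrite addrAC subrr add0r.
  apply: (mulIf hh); rewrite Et in Es; rewrite Es' in Et'; rewrite !sh in Es Et'.
  move: (f (a + h, b + h)) (f (a + h, b)) (f (a, b + h)) (f (a, b)) (P (s, t)) (Q (s', t')) Es Et'.
  move=> f1 f2 f3 f4 p q Es Et'; apply: (etrans (mulrA _ _ _)); apply: (etrans (esym Es)).
  apply: (etrans _ (esym (mulrA _ _ _))); apply: (etrans _ Et'); ring.
rewrite PQ in p1.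
move: (P (a, b)) (Q (a, b)) (Q (s', t')) p1 p2 => p q z p1 p2.
have -> : p - q = (p - z) - (q - z) by ring.
by rewrite (le_trans (ler_normB _ _))//; lra.
Qed.

End vector_calculus.

(** * Gaussian curvature in a patch *)

Section shape_operator.
Context {R : realType}.
Implicit Types (a b n u v w e : 'rV[R]_3) (L : 'M[R]_3).

Lemma parseval_plane e n v : dotmul e e = 1 -> dotmul n n = 1 -> dotmul e n = 0 -> dotmul v n = 0 ->
  v = dotmul v e *: e + dotmul v (crossmul n e) *: crossmul n e.
Proof.
move=> e1 n1 en vn.
have E : (dotmul n n * dotmul e e - dotmul e n * dotmul e n) *: v =
   (dotmul n n * dotmul v e - dotmul e n * dotmul v n) *: e + dotmul v (crossmul n e) *: crossmul n e
   + (dotmul v n * dotmul e e - dotmul v e * dotmul e n) *: n by vec3; ring.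
by move: E; rewrite e1 n1 en vn !(mulr0, mul0r, mulr1, mul1r, subr0, scale1r, scale0r, addr0).
Qed.

Lemma crossmul_parallel n v w : dotmul n n = 1 -> dotmul v n = 0 -> dotmul w n = 0 ->
  crossmul v w = dotmul (crossmul v w) n *: n.
Proof.
move=> n1 vn wn.
have E : dotmul n n *: crossmul v w = dotmul (crossmul v w) n *: n
    + crossmul n (dotmul v n *: w - dotmul w n *: v) by vec3; ring.
move: E; rewrite n1 vn wn !scale0r subr0 scale1r => E; rewrite [LHS]E.
by rewrite [X in _ + X](_ : _ = 0) ?addr0//; vec3; ring.
Qed.

(** The characteristic equation of the symmetric matrix with diagonal [p], [r] and off-diagonal
    entry [q]; its discriminant is nonnegative, and positive if [q != 0]. *)
Lemma quadratic_roots (p q r : R) : exists k1 k2 : R,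
  [/\ (k1 - p) * (k1 - r) = q ^+ 2, (k2 - p) * (k2 - r) = q ^+ 2 & q != 0 -> k1 != k2].
Proof.
pose D := (p - r) ^+ 2 + 4 * q ^+ 2.
have D0 : 0 <= D := addr_ge0 (sqr_ge0 _) (mulr_ge0 (ler0n _ 4) (sqr_ge0 _)).
pose s := Num.sqrt D; have ss : s ^+ 2 = D by rewrite sqr_sqrtr.
exists ((p + r + s) / 2), ((p + r - s) / 2); split.
- have -> : ((p + r + s) / 2 - p) * ((p + r + s) / 2 - r) = (s ^+ 2 - (p - r) ^+ 2) / 4 by field.
  by rewrite ss /D; field.
- have -> : ((p + r - s) / 2 - p) * ((p + r - s) / 2 - r) = (s ^+ 2 - (p - r) ^+ 2) / 4 by field.
  by rewrite ss /D; field.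
- move=> q0; have s0 : 0 < s.
    rewrite sqrtr_gt0; apply: (@lt_le_trans _ _ (4 * q ^+ 2)); last by rewrite lerDr sqr_ge0.
    by rewrite mulr_gt0// exprn_even_gt0.
  by rewrite gt_eqF// ltr_pM2r ?invr_gt0//; lra.
Qed.

(* The eigenvector equations are solved in the orthonormal frame (e, n x e). *)
Lemma symmetric_eigenvectors e n L : dotmul e e = 1 -> dotmul n n = 1 -> dotmul e n = 0 ->
  dotmul (e *m L) n = 0 -> dotmul (crossmul n e *m L) n = 0 ->
  dotmul (e *m L) (crossmul n e) = dotmul (crossmul n e *m L) e ->
  exists (k1 k2 : R) w1 w2, [/\ dotmul w1 n = 0 /\ dotmul w2 n = 0, free [:: w1; w2]
    & - (w1 *m L) = k1 *: w1 /\ - (w2 *m L) = k2 *: w2].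
Proof.
set f := crossmul n e => e1 n1 en eLn fLn sym.
have fn : dotmul f n = 0 by exact: dotmul_crossl.
have ef : crossmul e f = n.
  have E : crossmul e f = dotmul e e *: n - dotmul e n *: e by rewrite /f; vec3; ring.
  by rewrite E e1 en scale1r scale0r subr0.
have eL := parseval_plane e1 n1 en eLn; have fL := parseval_plane e1 n1 en fLn.
rewrite -/f in eL fL.
set p := - dotmul (e *m L) e; set q := - dotmul (e *m L) f; set r := - dotmul (f *m L) f.
have {}eL : - (e *m L) = p *: e + q *: f by rewrite eL opprD -!scaleNr.
have {}fL : - (f *m L) = q *: e + r *: f by rewrite fL opprD -!scaleNr /q sym.
have [k1 [k2 [h1 h2 h3]]] := quadratic_roots p q r.
have [q0|q0] := eqVneq q 0.
  exists p, r, e, f; split; [by []| |].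
    by apply: crossmul_free; rewrite ef -dotmul_eq0 n1 oner_neq0.
  by rewrite eL fL q0 !scale0r addr0 add0r.
(* For [q != 0], the vector of coordinates [(q, k - p)] solves the first row of the eigenvector
   equation, and the second row is the characteristic equation. *)
have ev k : (k - p) * (k - r) = q ^+ 2 ->
    - ((q *: e + (k - p) *: f) *m L) = k *: (q *: e + (k - p) *: f).
  move=> hk; rewrite mulmxDl opprD -!scalemxAl -!scalerN eL fL.
  rewrite !scalerDr !scalerA addrACA -!scalerDl; congr (_ *: _ + _ *: _); first by ring.
  by rewrite -expr2 -hk; ring.
exists k1, k2, (q *: e + (k1 - p) *: f), (q *: e + (k2 - p) *: f); split.
- by rewrite !dotmulDl !dotmulZl en fn !mulr0 addr0.
- apply: crossmul_free.
  have -> : crossmul (q *: e + (k1 - p) *: f) (q *: e + (k2 - p) *: f) = (q * (k2 - k1)) *: crossmul e f.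
    by vec3; ring.
  rewrite ef scaler_eq0 negb_or mulf_neq0 ?subr_eq0//=; last by rewrite eq_sym h3.
  by rewrite -dotmul_eq0 n1 oner_neq0.
- by split; apply: ev.
Qed.

(** Tangency and symmetry are known on the basis [(a, b)]; they extend to the whole plane by
    linearity, hence to the orthonormal frame built on [a / |a|]. *)
Lemma shape_operator_eigenvectors a b n L : dotmul n n = 1 -> crossmul a b != 0 ->
  dotmul a n = 0 -> dotmul b n = 0 -> dotmul (a *m L) n = 0 -> dotmul (b *m L) n = 0 ->
  dotmul (a *m L) b = dotmul (b *m L) a ->
  exists (k1 k2 : R) w1 w2, [/\ dotmul w1 n = 0 /\ dotmul w2 n = 0, free [:: w1; w2]
    & - (w1 *m L) = k1 *: w1 /\ - (w2 *m L) = k2 *: w2].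
Proof.
move=> n1 ab0 an bn aLn bLn sym.
have abE := crossmul_parallel n1 an bn.
set d := dotmul (crossmul a b) n in abE.
have d0 : d != 0 by apply: contraNneq ab0 => d0; rewrite abE d0 scale0r.
have n0 : dotmul n n != 0 by rewrite n1 oner_neq0.
have dec v : dotmul v n = 0 -> exists s t : R, v = s *: a + t *: b.
  move=> vn; have E := coplanar_decomp n0 vn an bn.
  exists (d^-1 * dotmul (crossmul v b) n), (d^-1 * dotmul (crossmul a v) n).
  by rewrite -!scalerA -scalerDr -E scalerA mulVf// scale1r.
have tan v : dotmul v n = 0 -> dotmul (v *m L) n = 0.
  move=> /dec[s [t ->]]; rewrite mulmxDl -!scalemxAl dotmulDl !dotmulZl aLn bLn.
  by rewrite !mulr0 addr0.
have symg v w : dotmul v n = 0 -> dotmul w n = 0 -> dotmul (v *m L) w = dotmul (w *m L) v.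
  move=> /dec[s [t ->]] /dec[s' [t' ->]].
  rewrite !mulmxDl -!scalemxAl !dotmulDl !dotmulDr !dotmulZl !dotmulZr sym; ring.
have a0 : a != 0.
  by apply: contraNneq ab0 => ->; apply/eqP; vec3; ring.
have na : enorm a != 0 by rewrite enorm_eq0.
pose e := (enorm a)^-1 *: a.
have e1 : dotmul e e = 1 by rewrite /e dotmulZl dotmulZr -sqr_enorm; field.
have en : dotmul e n = 0 by rewrite /e dotmulZl an mulr0.
have fn : dotmul (crossmul n e) n = 0 by exact: dotmul_crossl.
by apply: (symmetric_eigenvectors (e := e)) => //; [exact: tan|exact: tan|exact: symg].
Qed.

(** Expand [a] and [b] in the eigenvectors: on the plane, [L] multiplies cross products by its
    determinant (-k1)(-k2). So every admissible choice of eigenvalues has the same product. *)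
Lemma eigenvalues_det a b n L w1 w2 (k1 k2 : R) : dotmul n n = 1 ->
  dotmul a n = 0 -> dotmul b n = 0 -> dotmul w1 n = 0 -> dotmul w2 n = 0 -> free [:: w1; w2] ->
  - (w1 *m L) = k1 *: w1 -> - (w2 *m L) = k2 *: w2 ->
  crossmul (a *m L) (b *m L) = (k1 * k2) *: crossmul a b.
Proof.
move=> n1 an bn w1n w2n /crossmul_eq0_free w12 e1 e2.
have wE := crossmul_parallel n1 w1n w2n.
set d := dotmul (crossmul w1 w2) n in wE.
have d0 : d != 0 by apply: contraNneq w12 => d0; rewrite wE d0 scale0r.
have n0 : dotmul n n != 0 by rewrite n1 oner_neq0.
have dec v : dotmul v n = 0 -> exists s t : R, v = s *: w1 + t *: w2.
  move=> vn; have E := coplanar_decomp n0 vn w1n w2n.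
  exists (d^-1 * dotmul (crossmul v w2) n), (d^-1 * dotmul (crossmul w1 v) n).
  by rewrite -!scalerA -scalerDr -E scalerA mulVf// scale1r.
have {}e1 : w1 *m L = (- k1) *: w1 by rewrite scaleNr -e1 opprK.
have {}e2 : w2 *m L = (- k2) *: w2 by rewrite scaleNr -e2 opprK.
have [s [t ->]] := dec a an; have [s' [t' ->]] := dec b bn.
by rewrite !mulmxDl -!scalemxAl e1 e2; vec3; ring.
Qed.

End shape_operator.

Section chart_curvature.
Context {R : realType}.
Variables (M : set 'rV[R]_3) (N : 'rV[R]_3 -> 'rV[R]_3) (O : set (R * R)) (phi : R * R -> 'rV[R]_3).
Hypothesis op : oriented_patch M N O phi.

(** It equals [N o phi] in the half plane, and it continues it across v = 0, where [N] offers no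
    values to differentiate. *)
Definition unit_normal (x : R * R) : 'rV[R]_3 := (area phi x)^-1 *: normal_product phi x.

(** [phi] is an immersion only on the half plane part of [O]; this is an open neighbourhood of that
    part on which [unit_normal] is C1. *)
Definition regular_set : set (R * R) :=
  O `&` [set x | 0 < dotmul (normal_product phi x) (normal_product phi x)].

Let oO : open O. Proof. by have [[]] := op. Qed.

Lemma C1von_phi : C1von O phi.
Proof. by apply: class_C1_C1von => //; have [pO _] := op; exact: patch_C1 pO. Qed.

Lemma C1von_partial_u : C1von O (partial_u phi).
Proof. by apply: class_C1_C1von => //; have [[_ /(_ 2%N)[_ /(_ (1, 0))]]] := op. Qed.

Lemma C1von_partial_v : C1von O (partial_v phi).
Proof. by apply: class_C1_C1von => //; have [[_ /(_ 2%N)[_ /(_ (0, 1))]]] := op. Qed.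

Lemma C1von_normal : C1von O (normal_product phi).
Proof. exact: C1von_crossmul oO C1von_partial_u C1von_partial_v. Qed.

Lemma regular_set_open : open regular_set.
Proof.
apply: open_pos_set => // x Ox.
exact: C1on_continuous (C1on_dotmul oO C1von_normal C1von_normal) Ox.
Qed.

Lemma regular_set_half_plane x : O x -> half_plane x -> regular_set x.
Proof.
move=> Ox Hx; split => //=; rewrite lt_def dotmul_ge0 dotmul_eq0 andbT.
by have [pO _] := op; exact: patch_normal_neq0 pO Ox Hx.
Qed.

Lemma C1von_sub A A' (u : R * R -> 'rV[R]_3) : A' `<=` A -> C1von A u -> C1von A' u.
Proof. by move=> sA Cu i; exact: C1onS sA (Cu i). Qed.

Let sub_O : regular_set `<=` O. Proof. by move=> x []. Qed.

Lemma C1von_unit_normal : C1von regular_set unit_normal.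
Proof.
have Cn := C1von_sub sub_O C1von_normal.
have Cw := C1on_dotmul regular_set_open Cn Cn.
by apply: (C1von_scale regular_set_open (C1onV_sqrt regular_set_open Cw _) Cn) => x [].
Qed.

Lemma unit_normalE x : O x -> half_plane x -> unit_normal x = N (phi x).
Proof. by move=> Ox Hx; have [_ ->] := op. Qed.

Lemma unit_normal_unit x : regular_set x -> dotmul (unit_normal x) (unit_normal x) = 1.
Proof.
move=> [_ /= w0]; rewrite dotmulZl dotmulZr mulrA -invfM -expr2 sqr_enorm mulVf//.
by rewrite gt_eqF.
Qed.

Lemma derive_near_cst (f : R * R -> R) (x v : R * R) (c : R) (A : set (R * R)) : open A -> A x -> (forall y, A y -> f y = c) ->
  'D_v f x = 0.
Proof.
move=> oA Ax fc; have <- : 'D_v (cst c : R * R -> R) x = 0 by exact: derive_cst.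
apply: near_eq_derive; by apply: filterS (open_nbhs_nbhs (conj oA Ax)) => y /fc.
Qed.

Lemma derive_unit_normal_normal x v : regular_set x -> dotmul ('D_v unit_normal x) (unit_normal x) = 0.
Proof.
move=> rx; have dn := C1von_differentiable C1von_unit_normal rx.
have := derive_near_cst v regular_set_open rx unit_normal_unit.
by rewrite (derive_dotmul _ dn dn) (dotmulC (unit_normal x)) => /eqP; rewrite -mulr2n mulrn_eq0/= => /eqP.
Qed.

Lemma unit_normal_tangent x : dotmul (unit_normal x) (partial_u phi x) = 0 /\
  dotmul (unit_normal x) (partial_v phi x) = 0.
Proof.
have E w : dotmul (normal_product phi x) w = 0 -> dotmul (unit_normal x) w = 0.
  by move=> h; rewrite dotmulZl h mulr0.
by split; apply: E; [exact: dotmul_crossl|exact: dotmul_crossr].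
Qed.

(** Differentiate n . phi_u = 0 in v and n . phi_v = 0 in u: the second-order terms agree by
    [schwarz]. *)
Lemma second_fundamental_form_symmetric x : regular_set x ->
  dotmul ('D_(1, 0) unit_normal x) (partial_v phi x) = dotmul ('D_(0, 1) unit_normal x) (partial_u phi x).
Proof.
move=> rx; have Ox := sub_O rx.
have dn := C1von_differentiable C1von_unit_normal rx.
have du := C1von_differentiable C1von_partial_u Ox.
have dv := C1von_differentiable C1von_partial_v Ox.
have eu : 'D_(0, 1) (fun y => dotmul (unit_normal y) (partial_u phi y)) x = 0.
  by apply: (derive_near_cst _ regular_set_open rx (c := 0)) => y _; exact: (unit_normal_tangent y).1.
have ev : 'D_(1, 0) (fun y => dotmul (unit_normal y) (partial_v phi y)) x = 0.
  by apply: (derive_near_cst _ regular_set_open rx (c := 0)) => y _; exact: (unit_normal_tangent y).2.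
rewrite (derive_dotmul _ dn du) in eu; rewrite (derive_dotmul _ dn dv) in ev.
have uv : 'D_(0, 1) (partial_u phi) x = 'D_(1, 0) (partial_v phi) x.
  apply/rowP => i.
  apply: (etrans (C1von_derive (0, 1) i C1von_partial_u Ox)).
  apply: (etrans _ (esym (C1von_derive (1, 0) i C1von_partial_v Ox))).
  pose f z := phi z 0 i; pose fu z := partial_u phi z 0 i; pose fv z := partial_v phi z 0 i.
  have Eu y : O y -> 'D_(1, 0) f y = fu y.
    by move=> Oy; exact: (esym (C1von_derive (1, 0) i C1von_phi Oy)).
  have Ev y : O y -> 'D_(0, 1) f y = fv y.
    by move=> Oy; exact: (esym (C1von_derive (0, 1) i C1von_phi Oy)).
  have Cu : C1on O fu := C1von_partial_u i; have Cv : C1on O fv := C1von_partial_v i.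
  have Cp : C1on O f := C1von_phi i.
  have H : 'D_(0, 1) fu x = 'D_(1, 0) fv x.
    by clearbody f fu fv; exact: (schwarz oO Cp Cu Cv Eu Ev Ox).
  exact: H.
rewrite uv in eu; exact: (addIr _ (etrans ev (esym eu))).
Qed.

Lemma unit_normal_derivative_along x : O x -> half_plane x ->
  exists L, derivative_along M N (phi x) L.
Proof.
move=> Ox Hx; have rx := regular_set_half_plane Ox Hx; have [pO _] := op.
have dn := C1von_differentiable C1von_unit_normal rx.
apply: (derivative_along_of_chart pO Ox Hx dn ltr01) => y Oy Hy _.
exact: unit_normalE.
Qed.

Lemma weingarten x v L : O x -> half_plane x -> half_plane_dir v -> derivative_along M N (phi x) L ->
  'D_v unit_normal x = 'D_v phi x *m L.
Proof.
move=> Ox Hx hv dL; have rx := regular_set_half_plane Ox Hx; have [pO _] := op.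
have dn := C1von_differentiable C1von_unit_normal rx.
apply: (derivative_along_derive pO hv Ox Hx dL dn ltr01) => y Oy Hy _.
exact: unit_normalE.
Qed.

(** The symmetric shape operator has eigenvectors, so [xget] returns a genuine product of principal
    curvatures; by [weingarten] and [eigenvalues_det] the identity holds for whichever one it
    returns. *)
Lemma gaussian_curvature_normal x : O x -> half_plane x ->
  gaussian_curvature M N (phi x) *: normal_product phi x =
  crossmul ('D_(1, 0) unit_normal x) ('D_(0, 1) unit_normal x).
Proof.
move=> Ox Hx; have rx := regular_set_half_plane Ox Hx; have [pO _] := op.
have hu : half_plane_dir ((1, 0) : R * R) by left.
have hv : half_plane_dir ((0, 1) : R * R) by right.
have NE := unit_normalE Ox Hx.
have n1 := unit_normal_unit rx; rewrite NE in n1.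
have [an bn] := unit_normal_tangent x; rewrite NE dotmulC in an; rewrite NE dotmulC in bn.
have n0 : crossmul (partial_u phi x) (partial_v phi x) != 0 := patch_normal_neq0 pO Ox Hx.
have : [set K | exists k1 k2, principal_curvatures M N (phi x) k1 k2 /\ K = k1 * k2]
    (gaussian_curvature M N (phi x)).
  apply: xgetPex; have [L dL] := unit_normal_derivative_along Ox Hx.
  have uL := weingarten Ox Hx hu dL; have vL := weingarten Ox Hx hv dL.
  have := derive_unit_normal_normal (1, 0) rx; rewrite uL NE => aLn.
  have := derive_unit_normal_normal (0, 1) rx; rewrite vL NE => bLn.
  have := second_fundamental_form_symmetric rx; rewrite uL vL => sym.
  have [k1 [k2 [w1 [w2 [wn fw ew]]]]] := shape_operator_eigenvectors n1 n0 an bn aLn bLn sym.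
  exists (k1 * k2), k1, k2; split; last by [].
  by exists L, w1, w2; split; [exact: dL|exact: wn|exact: fw|exact: ew].
move=> [k1 [k2 [[L [w1 [w2 [dL [w1n w2n] fw [e1 e2]]]]] ->]]].
rewrite (weingarten Ox Hx hu dL) (weingarten Ox Hx hv dL).
by rewrite (eigenvalues_det n1 an bn w1n w2n fw e1 e2).
Qed.

Lemma gaussian_curvature_continuous :
  {within O `&` half_plane, continuous (gaussian_curvature M N \o phi)}.
Proof.
pose h x := (dotmul (normal_product phi x) (normal_product phi x))^-1 *
  dotmul (crossmul ('D_(1, 0) unit_normal x) ('D_(0, 1) unit_normal x)) (normal_product phi x).
have hE x : (O `&` half_plane) x -> h x = gaussian_curvature M N (phi x).
  move=> [Ox Hx]; have [_ /= w0] := regular_set_half_plane Ox Hx.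
  by rewrite /h -gaussian_curvature_normal// dotmulZl mulrCA mulVf ?mulr1// gt_eqF.
have ch : {within O `&` half_plane, continuous h}.
  apply: continuous_within => x [Ox Hx]; have rx := regular_set_half_plane Ox Hx.
  have [c1 c2] := C1von_continuous_derive C1von_unit_normal regular_set_open rx.
  have cn : {for x, continuous (normal_product phi)}.
    by apply: differentiable_continuous; exact: C1von_differentiable C1von_normal Ox.
  apply: continuousM; last exact: (continuous_dotmul (continuous_crossmul c1 c2) cn).
  apply: continuousV; last exact: (continuous_dotmul cn cn).
  by case: rx => _ /= w0; rewrite gt_eqF.
apply/within_continuousP => x Ax e e0; have [r r0 hr] := (within_continuousP _ _).1 ch x Ax e e0.
by exists r => // y Ay xy /=; rewrite -!hE//; exact: hr.
Qed.

End chart_curvature.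

(** * Green's formula on the half plane *)

Section plane_bump.
Context {R : realType}.

(** A truncation with continuous first derivative, from which bump functions of class C1 are built
    by polynomial operations. *)
Definition sqr_pos (t : R) : R := Num.max 0 t ^+ 2.

Lemma is_derive_sqr_pos (t : R) : is_derive t (1 : R) sqr_pos (2 * Num.max 0 t).
Proof.
have key (h : R) : `|sqr_pos (t + h) - sqr_pos t - h * (2 * Num.max 0 t)| <= h ^+ 2.
  rewrite /sqr_pos ler_norml; have [t0|t0] := leP 0 t; have [th|th] := leP 0 (t + h);
  by apply/andP; split; nra.
have lim : (fun h : R => h^-1 *: (sqr_pos (h *: 1 + t) - sqr_pos t)) @ 0^' --> (2 * Num.max 0 t).
  apply/cvgrPdist_le => e e0; near=> h.
  have h0 : h != 0 by near: h; exact: nbhs_dnbhs_neq.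
  have he : `|h| <= e.
    by near: h; apply/nbhs_dnbhs/nbhs_normP; exists e => // y; rewrite /ball_/= sub0r normrN => /ltW.
  rewrite /GRing.scale/= mulr1 (addrC h).
  have -> : 2 * Num.max 0 t - h^-1 * (sqr_pos (t + h) - sqr_pos t) =
    - (h^-1 * (sqr_pos (t + h) - sqr_pos t - h * (2 * Num.max 0 t))) by field.
  rewrite normrN normrM normfV ler_pdivrMl ?normr_gt0//.
  apply: le_trans (key h) _; rewrite -real_normK ?num_real// expr2.
  by rewrite ler_pM2l// normr_gt0.
split; first by apply/cvg_ex; exists (2 * Num.max 0 t).
exact: cvg_lim lim.
Unshelve. all: by end_near. Qed.

Lemma continuous_maxr0 : continuous (fun t : R => 2 * Num.max 0 t).
Proof.
move=> t.
have c (z : R) : {for t, continuous (fun _ : R => z)} by exact: cst_continuous.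
have ci : {for t, continuous (fun z : R => z)} by exact: cvg_id.
exact: (continuousM (c 2) (continuous_max (c 0) ci)).
Qed.

Lemma C1on_sqr_pos (A : set (R * R)) (f : R * R -> R) : open A -> C1on A f ->
  C1on A (fun x => sqr_pos (f x)).
Proof.
move=> oA Cf; apply: (C1on_comp1 oA Cf (h := sqr_pos) (dh := fun t => 2 * Num.max 0 t)) => x _; first exact: is_derive_sqr_pos.
exact: continuous_maxr0.
Qed.

Lemma C1on_linear (A : set (R * R)) (f : {linear (R * R)%type -> R}) : open A -> continuous f -> C1on A f.
Proof.
move=> oA cf; have d x : differentiable f x by exact: linear_differentiable.
have e v x : 'D_v (f : R * R -> R) x = f v by rewrite deriveE// diff_lin.
apply: (@C1on_intro R A f (fun=> f (1, 0)) (fun=> f (0, 1)) oA) => x Ax.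
- by split; [exact: d|exact: e|exact: e].
- exact: cst_continuous.
- exact: cst_continuous.
Qed.

Lemma C1on_fst (A : set (R * R)) : open A -> C1on A (fun x => x.1).
Proof. by move=> oA; apply: (@C1on_linear A fst oA) => x; exact: cvg_fst. Qed.

Lemma C1on_snd (A : set (R * R)) : open A -> C1on A (fun x => x.2).
Proof. by move=> oA; apply: (@C1on_linear A snd oA) => x; exact: cvg_snd. Qed.

(** The inner truncation is 0 for |t| <= 1 and at least 9 for |t| >= 2, so the outer one gives 1 and
    0 respectively. *)
Definition bump1 (t : R) : R := sqr_pos (1 - sqr_pos (t * t - 1)).

Lemma bump1_in (t : R) : `|t| <= 1 -> bump1 t = 1.
Proof.
rewrite ler_norml => /andP[h1 h2]; rewrite /bump1 /sqr_pos.
have h : t * t - 1 <= 0 by nra.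
rewrite (max_l h) expr0n/= subr0 (max_r ler01); exact: expr1n.
Qed.

Lemma bump1_out (t : R) : 2 <= `|t| -> bump1 t = 0.
Proof.
move=> h; have h1 : 4 <= t * t.
  by rewrite -expr2 -real_normK ?num_real// expr2; nra.
have h2 : 1 <= t * t - 1 by lra.
have h3 : 0 <= t * t - 1 by lra.
have h4 : 1 - (t * t - 1) ^+ 2 <= 0 by nra.
by rewrite /bump1 /sqr_pos (max_r h3) (max_l h4) expr0n.
Qed.

Definition bump (c : R * R) (r : R) (x : R * R) : R :=
  bump1 (r^-1 * (x.1 - c.1)) * bump1 (r^-1 * (x.2 - c.2)).

Lemma bump_in c r x : 0 < r -> `|c - x| <= r -> bump c r x = 1.
Proof.
move=> r0; rewrite distrC prod_normE ge_max/= => /andP[h1 h2].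
have h (z : R) : `|z| <= r -> `|r^-1 * z| <= 1.
  by move=> zr; rewrite normrM normfV (gtr0_norm r0) ler_pdivrMl// mulr1.
by rewrite /bump !bump1_in ?mulr1//; exact: h.
Qed.

Lemma bump_out c r x : 0 < r -> 2 * r <= `|c - x| -> bump c r x = 0.
Proof.
move=> r0; rewrite distrC prod_normE le_max/=.
have h (z : R) : 2 * r <= `|z| -> bump1 (r^-1 * z) = 0.
  by move=> zr; apply: bump1_out; rewrite normrM normfV (gtr0_norm r0) ler_pdivlMl// mulrC.
by move=> /orP[/h|/h]; rewrite /bump => ->; rewrite ?mulr0 ?mul0r.
Qed.

Lemma C1on_bump A c r : open A -> C1on A (bump c r).
Proof.
move=> oA.
have C0 (z : R) : C1on A (fun=> z) by exact: C1on_cst.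
have C1 (f : R * R -> R) (z : R) : C1on A f -> C1on A (fun x => bump1 (r^-1 * (f x - z))).
  move=> Cf; have Cg := C1onM oA (C0 r^-1) (C1onB oA Cf (C0 z)).
  exact: (C1on_sqr_pos oA (C1onB oA (C0 1) (C1on_sqr_pos oA (C1onB oA (C1onM oA Cg Cg) (C0 1))))).
exact: (C1onM oA (C1 _ _ (C1on_fst oA)) (C1 _ _ (C1on_snd oA))).
Qed.

End plane_bump.

Section green_half_plane.
Context {R : realType}.
Local Notation mu1 := (@lebesgue_measure R).
Local Notation mu2 := (@lebesgue_measure R \x @lebesgue_measure R)%E.

Lemma within_continuous_local (V W : normedModType R) (A : set V) (f : V -> W) :
  (forall x, A x -> exists (B : set V) (g : V -> W),
    [/\ open B, B x, {for x, continuous g} & forall y, A y -> B y -> f y = g y]) ->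
  {within A, continuous f}.
Proof.
move=> H; apply/within_continuousP => x Ax e e0; have [B [g [oB Bx cg fg]]] := H x Ax.
have [r1 r10 h1] := open_ball_subset oB Bx; have [r2 r20 h2] := continuous_for_eps cg e0.
exists (Num.min r1 r2) => [|y Ay]; first by rewrite lt_min r10.
by rewrite lt_min => /andP[/h1 By /h2]; rewrite !fg.
Qed.

(* On the half plane, a du + b dv is the form sum_i F_i dG_i and k du dv its
   exterior derivative. *)
Definition green_data (B : set (R * R)) (a b k : R * R -> R) :=
  exists F G : 'I_3 -> R * R -> R, [/\ forall i, C1on B (F i), forall i, C1on B (G i) &
    forall x, B x -> half_plane x -> [/\
      a x = \sum_i F i x * 'D_(1, 0) (G i) x,
      b x = \sum_i F i x * 'D_(0, 1) (G i) x &
      k x = \sum_i ('D_(1, 0) (F i) x * 'D_(0, 1) (G i) x - 'D_(0, 1) (F i) x * 'D_(1, 0) (G i) x)]].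

Variables (O : set (R * R)) (a b k : R * R -> R).
Hypothesis oO : open O.
Hypothesis loc : forall x, O x -> half_plane x -> exists B, [/\ open B, B x, B `<=` O & green_data B a b k].

(** Near each point the three functions coincide in the half plane with sums of products of
    continuous functions. *)
Lemma green_data_continuous : [/\ {within O `&` half_plane, continuous a},
  {within O `&` half_plane, continuous b} & {within O `&` half_plane, continuous k}].
Proof.
split; apply: within_continuous_local => x [Ox Hx];
  have [B [oB Bx BO [F [G [CF CG E]]]]] := loc Ox Hx.
- exists B, (fun x => F 0 x * 'D_(1, 0) (G 0) x + F 1 x * 'D_(1, 0) (G 1) x + F 2 x * 'D_(1, 0) (G 2) x).
  split=> //; last by move=> y [_ Hy] By; have [-> _ _] := E y By Hy; rewrite sum_ord3.
  have c i : {for x, continuous (fun x => F i x * 'D_(1, 0) (G i) x)}.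
    have cF := C1on_continuous (CF i) Bx; have [_ c1 c2] := CG i x Bx; exact: (continuousM cF c1).
  exact: (continuousD (continuousD (c 0) (c 1)) (c 2)).
- exists B, (fun x => F 0 x * 'D_(0, 1) (G 0) x + F 1 x * 'D_(0, 1) (G 1) x + F 2 x * 'D_(0, 1) (G 2) x).
  split=> //; last by move=> y [_ Hy] By; have [_ -> _] := E y By Hy; rewrite sum_ord3.
  have c i : {for x, continuous (fun x => F i x * 'D_(0, 1) (G i) x)}.
    have cF := C1on_continuous (CF i) Bx; have [_ c1 c2] := CG i x Bx; exact: (continuousM cF c2).
  exact: (continuousD (continuousD (c 0) (c 1)) (c 2)).
- pose h i x := 'D_(1, 0) (F i) x * 'D_(0, 1) (G i) x - 'D_(0, 1) (F i) x * 'D_(1, 0) (G i) x.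
  exists B, (fun x => h 0 x + h 1 x + h 2 x).
  split=> //; last by move=> y [_ Hy] By; have [_ _ ->] := E y By Hy; rewrite sum_ord3.
  have c i : {for x, continuous (h i)}.
    have [_ c1 c2] := CG i x Bx; have [_ d1 d2] := CF i x Bx.
    exact: (continuousB (continuousM d1 c2) (continuousM d2 c1)).
  exact: (continuousD (continuousD (c 0) (c 1)) (c 2)).
Qed.

(** The density of d(eta (a du + b dv)), where [k] stands for the exterior derivative of a du + b
    dv. *)
Definition curl_density (eta : R * R -> R) x :=
  eta x * k x + 'D_(1, 0) eta x * b x - 'D_(0, 1) eta x * a x.

Lemma half_plane_derive0 (eta : R * R -> R) (C : set (R * R)) x v : C1on O eta -> open C ->
  (forall y, O y -> half_plane y -> C y -> eta y = 0) -> O x -> half_plane x -> C x ->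
  half_plane_dir v -> 'D_v eta x = 0.
Proof.
move=> Ce oC e0 Ox Hx Cx hv; have [d _ _] := Ce x Ox.
have <- : 'D_v (cst 0 : R * R -> R) x = 0 by exact: derive_cst.
have [r1 r10 h1] := open_ball_subset oO Ox; have [r2 r20 h2] := open_ball_subset oC Cx.
apply: (@half_plane_derive_eq R R eta (cst 0) x v (Num.min r1 r2) hv Hx _ _ d).
- by rewrite lt_min r10.
- by move=> y Hy; rewrite lt_min => /andP[/h1 Oy /h2 Cy]; exact: e0.
- exact: differentiable_cst.
Qed.

Lemma curl_density0 (eta : R * R -> R) (C : set (R * R)) x : C1on O eta -> open C ->
  (forall y, O y -> half_plane y -> C y -> eta y = 0) -> O x -> half_plane x -> C x ->
  curl_density eta x = 0.
Proof.
move=> Ce oC e0 Ox Hx Cx; rewrite /curl_density e0//.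
have du : 'D_(1, 0) eta x = 0 by apply: (half_plane_derive0 Ce oC e0 Ox Hx Cx); left.
have dv : 'D_(0, 1) eta x = 0 by apply: (half_plane_derive0 Ce oC e0 Ox Hx Cx); right.
by rewrite du dv !mul0r addr0 subr0.
Qed.

Definition half_plane_green (eta : R * R -> R) :=
  Rintegral mu1 [set t : R | O (t, 0)] (fun t => eta (t, 0) * a (t, 0)) =
  Rintegral mu2 (O `&` half_plane) (curl_density eta).

End green_half_plane.

Section green_half_plane_local.
Context {R : realType}.
Local Notation mu1 := (@lebesgue_measure R).
Local Notation mu2 := (@lebesgue_measure R \x @lebesgue_measure R)%E.
Variables (O : set (R * R)) (a b k : R * R -> R).
Hypothesis oO : open O.

Lemma Rintegral_sum3 d (T : measurableType d) (mu : {measure set T -> \bar R}) (A : set T)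
    (h : 'I_3 -> T -> R) : measurable A ->
  (forall i, mu.-integrable A (EFin \o h i)) ->
  Rintegral mu A (fun x => \sum_i h i x) = \sum_i Rintegral mu A (h i).
Proof.
move=> mA ih; rewrite sum_ord3.
rewrite -(RintegralD mA (ih 0) (ih 1)).
have i01 : mu.-integrable A (EFin \o (fun x => h 0 x + h 1 x)).
  have iD := integrableD mA (ih 0) (ih 1).
  by apply: eq_integrable iD.
rewrite -(RintegralD mA i01 (ih 2)).
by apply: eq_Rintegral => x _; rewrite sum_ord3.
Qed.

(** The part [Q] of a square around [x0] in the half plane is a rectangle; on its left, right and
    top sides [zeta = 0], and Green's formula is applied to each [zeta * F i]. *)
Lemma half_plane_green_small (B : set (R * R)) (zeta : R * R -> R) (x0 : R * R) (r : R) :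
  C1on O zeta -> half_plane x0 -> 0 < r -> open B -> B `<=` O -> green_data B a b k ->
  (forall y, `|x0 - y| <= r -> B y) ->
  (forall y, O y -> half_plane y -> r <= `|x0 - y| -> zeta y = 0) ->
  half_plane_green O a b k zeta.
Proof.
case: x0 => u0 v0 Cz Hx r0 oB BO [F [G [CF CG E]]] rB z0; rewrite /half_plane/= in Hx.
(* If the square reaches v = 0, then [c = 0] and the bottom side is the boundary piece. Otherwise
   [c = v0 - r > 0], and [zeta] vanishes both on the bottom side and at v = 0. *)
pose c := Num.max 0 (v0 - r); pose d := v0 + r.
have c0 : 0 <= c by rewrite le_max lexx.
have cv : v0 - r <= c by rewrite le_max lexx orbT.
have cd : c < d by rewrite gt_max /d; apply/andP; split; lra.
have uu : u0 - r < u0 + r by lra.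
have cv0 : c <= v0 by rewrite ge_max Hx /=; lra.
pose Q : set (R * R) := `[u0 - r, u0 + r] `*` `[c, d].
have ballE y : (`|(u0, v0) - y| <= r) = (`|u0 - y.1| <= r) && (`|v0 - y.2| <= r).
  by rewrite prod_normE ge_max.
have QP y : Q y -> half_plane y /\ `|(u0, v0) - y| <= r.
  rewrite /Q /= !in_itv/= => -[/andP[h1 h2] /andP[h3 h4]]; split; first exact: le_trans c0 h3.
  have h5 := le_trans cv h3; rewrite /d in h4.
  by rewrite ballE !ler_norml; apply/andP; split; apply/andP; split; lra.
have PQ y : half_plane y -> `|(u0, v0) - y| <= r -> Q y.
  rewrite ballE !ler_norml => Hy /andP[/andP[h1 h2] /andP[h3 h4]].
  rewrite /Q /= !in_itv/= /d; split; apply/andP; split; try lra.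
  by rewrite ge_max; apply/andP; split; [exact: Hy|lra].
have QB : Q `<=` B by move=> y /QP[_ /rB].
have far1 u v : r <= `|u0 - u| -> r <= `|(u0, v0) - (u, v)|.
  by move=> h; rewrite prod_normE le_max h.
have far2 u v : r <= `|v0 - v| -> r <= `|(u0, v0) - (u, v)|.
  by move=> h; rewrite prod_normE le_max h orbT.
have bd : Rintegral mu1 [set t : R | O (t, 0)] (fun t => zeta (t, 0) * a (t, 0)) =
    \int[mu1]_(u in `[u0 - r, u0 + r]) (zeta (u, c) * a (u, c)).
  have [vr|rv] := leP v0 r.
    have cE : c = 0 by apply/eqP; rewrite eq_le c0 andbT ge_max lexx /=; lra.
    rewrite cE; apply: Rintegral_subset.
      move=> t tI; have [] : half_plane (t, (0 : R)) /\ `|(u0, v0) - (t, 0)| <= r.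
        apply: QP; split => //=; rewrite in_itv/= cE lexx /=; rewrite /d; lra.
      by move=> _ /rB/BO.
    move=> t /= Ot tI; rewrite z0 ?mul0r//; first by rewrite /half_plane/=.
    apply: far1; rewrite leNgt; apply/negP; rewrite ltr_norml => /andP[h1 h2]; apply: tI.
    by rewrite /= in_itv/=; apply/andP; split; lra.
  have -> : \int[mu1]_(u in `[u0 - r, u0 + r]) (zeta (u, c) * a (u, c)) =
      Rintegral mu1 set0 (fun u => zeta (u, c) * a (u, c)).
    apply: Rintegral_subset => // u uI _.
    have Qu : Q (u, c) by split => //=; rewrite in_itv/= lexx ltW.
    rewrite z0 ?mul0r//; first exact/BO/QB.
    apply: far2; have -> : c = v0 - r by rewrite /c max_r//; lra.
    by rewrite opprB addrC subrK gtr0_norm.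
  have -> : Rintegral mu1 [set t : R | O (t, 0)] (fun t => zeta (t, 0) * a (t, 0)) =
      Rintegral mu1 set0 (fun t => zeta (t, 0) * a (t, 0)).
    apply: Rintegral_subset => // t Ot _; rewrite z0 ?mul0r//; first by rewrite /half_plane/=.
    by apply: far2; rewrite subr0 ger0_norm// ltW.
  by rewrite /Rintegral !integral_set0.
rewrite /half_plane_green bd.
have -> : Rintegral mu2 (O `&` half_plane) (curl_density a b k zeta) = Rintegral mu2 Q (curl_density a b k zeta).
  apply: Rintegral_subset => [y Qy|y [Oy Hy] nQ].
    by split; [exact/BO/QB|exact: (QP _ Qy).1].
  pose C : set (R * R) := [set y | r < `|(u0, v0) - y|].
  have oC : open C.
    apply: (@open_comp _ _ (fun y : R * R => `|(u0, v0) - y|) [set t : R | r < t]); last exact: open_gt.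
    by move=> z _; exact: continuous_dist.
  apply: (@curl_density0 R O a b k oO zeta C y Cz oC _ Oy Hy).
    by move=> z Oz Hz Cz'; apply: z0 => //; exact: ltW.
  by rewrite /C /= ltNge; apply/negP => /(PQ y Hy).
have CzB := C1onS BO Cz.
have CzF i : C1on B (fun x => zeta x * F i x) := C1onM oB CzB (CF i).
pose h i x := 'D_(1, 0) (fun x => zeta x * F i x) x * 'D_(0, 1) (G i) x -
   'D_(0, 1) (fun x => zeta x * F i x) x * 'D_(1, 0) (G i) x.
have ch i x : B x -> {for x, continuous (h i)}.
  move=> Bx; have [_ c1 c2] := CG i x Bx; have [_ d1 d2] := CzF i x Bx.
  exact: (continuousB (continuousM d1 c2) (continuousM d2 c1)).
have cQ : compact Q by apply: compact_setX; exact: segment_compact.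
have -> : Rintegral mu2 Q (curl_density a b k zeta) = Rintegral mu2 Q (fun x => \sum_i h i x).
  apply: eq_Rintegral => x; rewrite inE => Qx; have Bx := QB x Qx.
  have [Hx' _] := QP x Qx; have [aE bE kE] := E x Bx Hx'.
  rewrite /curl_density aE bE kE !mulr_sumr -big_split/= -sumrB.
  have D i v : 'D_v (fun x => zeta x * F i x) x = zeta x * 'D_v (F i) x + F i x * 'D_v zeta x.
    by have [dz _ _] := CzB x Bx; have [dF _ _] := CF i x Bx; exact: deriveM_diff.
  apply: eq_bigr => i _; rewrite /h !D.
  move: (zeta x) (F i x) ('D_(1, 0) zeta x) ('D_(0, 1) zeta x) ('D_(1, 0) (F i) x) ('D_(0, 1) (F i) x)
    ('D_(1, 0) (G i) x) ('D_(0, 1) (G i) x) => *; ring.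
rewrite Rintegral_sum3; last 2 first.
- exact: compact_measurable2.
- move=> i; apply: continuous_integrable2 => //; apply: continuous_within => x /QB; exact: ch.
have ca i : {within `[u0 - r, u0 + r], continuous (fun u => zeta (u, c) * F i (u, c) * 'D_(1, 0) (G i) (u, c))}.
  apply: (slice_continuous1 (c := c) (d := d) (H := fun x => zeta x * F i x * 'D_(1, 0) (G i) x)).
    move=> x /QB Bx; have [_ c1 _] := CG i x Bx.
    exact: (continuousM (C1on_continuous (CzF i) Bx) c1).
  by rewrite lexx ltW.
have -> : \int[mu1]_(u in `[u0 - r, u0 + r]) (zeta (u, c) * a (u, c)) =
    \int[mu1]_(u in `[u0 - r, u0 + r]) (\sum_i zeta (u, c) * F i (u, c) * 'D_(1, 0) (G i) (u, c)).
  apply: eq_Rintegral => u; rewrite inE => uI.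
  have Qu : Q (u, c) by split => //=; rewrite in_itv/= lexx ltW.
  have [Hu _] := QP _ Qu; have [aE _ _] := E _ (QB _ Qu) Hu.
  by rewrite aE mulr_sumr; apply: eq_bigr => i _; rewrite mulrA.
rewrite (Rintegral_sum3 (mu := mu1)); last 2 first.
- exact: measurable_itv.
- by move=> i; apply: itv_integrable; exact: ca.
apply: eq_bigr => i _; symmetry.
have zB y : Q y -> r <= `|(u0, v0) - y| -> zeta y = 0.
  by move=> Qy hy; apply: z0 => //; [exact/BO/QB|exact: (QP _ Qy).1].
apply: (green_rectangle uu cd (CzF i) (CG i) QB) => [v hv|v hv|u hu]; rewrite zB ?mul0r//.
- by split => //=; rewrite in_itv/= lexx ltW.
- by apply: far1; rewrite opprB addrC subrK gtr0_norm.
- by split => //=; rewrite in_itv/= lexx ltW.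
- by apply: far1; rewrite opprD addrA subrr sub0r normrN gtr0_norm.
- by split => //=; rewrite in_itv/= lexx ltW.
- by apply: far2; rewrite opprD addrA subrr sub0r normrN gtr0_norm.
Qed.

End green_half_plane_local.

Section green_half_plane_global.
Context {R : realType}.
Local Notation mu1 := (@lebesgue_measure R).
Local Notation mu2 := (@lebesgue_measure R \x @lebesgue_measure R)%E.
Variables (O : set (R * R)) (a b k : R * R -> R).
Hypothesis oO : open O.
Hypothesis loc : forall x, O x -> half_plane x -> exists B, [/\ open B, B x, B `<=` O & green_data B a b k].
Variable S : set (R * R).
Hypothesis cS : compact S.
Hypothesis SO : S `<=` O `&` half_plane.

Let vanish (eta : R * R -> R) := forall y, O y -> half_plane y -> ~ S y -> eta y = 0.

Let S0 : set R := [set t | S (t, 0)].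

Let cS0 : compact S0.
Proof.
rewrite (_ : S0 = fst @` (S `&` [set x | x.2 = 0])).
  apply: continuous_compact; first by apply: continuous_subspaceT => x; exact: cvg_fst.
  apply: subclosed_compact cS _; last by move=> x [].
  apply: closedI; first by apply: compact_closed cS; exact: norm_hausdorff.
  rewrite (_ : mkset _ = snd @^-1` [set z : R | z = 0])//.
  by apply: closed_comp => [x _|]; [exact: cvg_snd|exact: closed_eq].
apply/seteqP; split => [t St|_ [[t v] [Stv /= v0] <-]].
  by exists (t, 0).
by rewrite /S0 /= -v0.
Qed.

(** On the compact set [S] the density is continuous, hence integrable, which is what additivity in
    [eta] requires. *)
Lemma curl_density_restrict eta : C1on O eta -> vanish eta ->
  Rintegral mu2 (O `&` half_plane) (curl_density a b k eta) = Rintegral mu2 S (curl_density a b k eta) /\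
  mu2.-integrable (S : set (measurableTypeR R * measurableTypeR R)) (EFin \o curl_density a b k eta).
Proof.
move=> Ce e0.
have clS : closed S by apply: compact_closed cS; exact: norm_hausdorff.
have oC : open (~` S) by exact: closed_openC.
split.
  apply: Rintegral_subset => // y [Oy Hy] nS.
  exact: (@curl_density0 R O a b k oO eta (~` S) y Ce oC e0 Oy Hy nS).
have [ca cb ck] := green_data_continuous loc.
apply: continuous_integrable2 => //.
have sub (f : R * R -> R) : {within O `&` half_plane, continuous f} -> {within S, continuous f}.
  exact: (continuous_subspaceW SO).
have ce (f : R * R -> R) : (forall x, O x -> {for x, continuous f}) -> {within S, continuous f}.
  by move=> cf; apply: continuous_within => x /SO[Ox _]; exact: cf.
apply: within_continuousB; first apply: within_continuousD; apply: within_continuousM.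
- by apply: ce => x Ox; exact: C1on_continuous Ce Ox.
- exact: sub.
- by apply: ce => x Ox; have [_ c1 _] := Ce x Ox.
- exact: sub.
- by apply: ce => x Ox; have [_ _ c2] := Ce x Ox.
- exact: sub.
Qed.

Lemma boundary_restrict eta : C1on O eta -> vanish eta ->
  Rintegral mu1 [set t : R | O (t, 0)] (fun t => eta (t, 0) * a (t, 0)) =
  Rintegral mu1 S0 (fun t => eta (t, 0) * a (t, 0)) /\
  mu1.-integrable (S0 : set (measurableTypeR R)) (EFin \o (fun t => eta (t, 0) * a (t, 0))).
Proof.
move=> Ce e0; split.
  apply: Rintegral_subset => [t /SO[]//|t Ot nS].
  by rewrite (e0 (t, 0) Ot _ nS) ?mul0r// /half_plane/=.
apply: continuous_compact_integrable; first exact: cS0.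
have ci : {within S0, continuous (fun t : R => (t, (0 : R)))}.
  apply: continuous_subspaceT => t.
  by apply: (@cvg_pair _ _ _ _ (nbhs t) (nbhs (0 : R))); [exact: cvg_id|exact: cvg_cst].
have [ca _ _] := green_data_continuous loc.
have ca' : {within S, continuous a} by exact: (continuous_subspaceW SO ca).
have ce : {within S, continuous eta}.
  by apply: continuous_within => x /SO[Ox _]; exact: C1on_continuous Ce Ox.
exact: (within_continuous_comp ci (within_continuousM ce ca')).
Qed.

Lemma half_plane_greenD z1 z2 : C1on O z1 -> C1on O z2 -> vanish z1 -> vanish z2 ->
  half_plane_green O a b k z1 -> half_plane_green O a b k z2 ->
  half_plane_green O a b k (fun x => z1 x + z2 x).
Proof.
move=> C1 C2 v1 v2; have CD := C1onD oO C1 C2.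
have vD : vanish (fun x => z1 x + z2 x) by move=> y Oy Hy nS; rewrite v1// v2// addr0.
rewrite /half_plane_green.
have [-> i1] := curl_density_restrict C1 v1; have [-> i2] := curl_density_restrict C2 v2.
have [-> iD] := curl_density_restrict CD vD.
have [-> j1] := boundary_restrict C1 v1; have [-> j2] := boundary_restrict C2 v2.
have [-> jD] := boundary_restrict CD vD => h1 h2.
have mS := compact_measurable2 cS.
have mS0 : measurable (S0 : set (measurableTypeR R)) by exact: compact_measurable.
transitivity (Rintegral mu1 S0 (fun t => z1 (t, 0) * a (t, 0)) + Rintegral mu1 S0 (fun t => z2 (t, 0) * a (t, 0))).
  rewrite -(RintegralD mS0 j1 j2); apply: eq_Rintegral => t _ /=; exact: mulrDl.
rewrite h1 h2 -(RintegralD mS i1 i2); apply: eq_Rintegral => x; rewrite inE => /SO[Ox _].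
have D v : 'D_v (fun x => z1 x + z2 x) x = 'D_v z1 x + 'D_v z2 x.
  by have [d1 _ _] := C1 x Ox; have [d2 _ _] := C2 x Ox; apply: deriveD; exact: diff_derivable.
rewrite /curl_density !D.
move: (z1 x) (z2 x) ('D_(1, 0) z1 x) ('D_(0, 1) z1 x) ('D_(1, 0) z2 x) ('D_(0, 1) z2 x) => *; ring.
Qed.

(** Induction on a list of balls outside which [eta] vanishes: a bump splits off the part near the
    first centre, and the rest vanishes on that ball. The cutoff gets differentiated here, hence a
    C1 bump. *)
Theorem half_plane_green_compact eta : C1on O eta -> vanish eta -> half_plane_green O a b k eta.
Proof.
have ex x : exists r : R, S x -> 0 < r /\ exists B, [/\ open B, B `<=` O, green_data B a b k &
    forall y, `|x - y| <= 2 * r -> B y].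
  have [Sx|nS] := pselect (S x); last by exists 1.
  have [Ox Hx] := SO Sx; have [B [oB Bx BO gB]] := loc Ox Hx.
  (* A bump equal to 1 up to distance [r x] lives within [2 * r x], and that closed ball must fit in
     the open one of radius [r]. *)
  have [r r0 hr] := open_ball_subset oB Bx; exists (r / 4) => _; split; first by rewrite divr_gt0.
  exists B; split => // y xy; apply: hr; apply: le_lt_trans xy _; lra.
have [r hr] := choice ex.
have [|s [sS cov]] := compact_finite_balls (r := r) cS; first by move=> x /hr[].
move=> Ce ve.
have {cov} : forall y, O y -> half_plane y -> (forall x, x \in s -> r x <= `|x - y|) -> eta y = 0.
  move=> y Oy Hy far; apply: ve => // Sy; have [x xs xy] := cov y Sy.
  by have := far x xs; rewrite leNgt xy.
elim: s sS eta Ce ve => [|x s IH] sS eta Ce ve far.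
  rewrite /half_plane_green.
  have z y : O y -> half_plane y -> eta y = 0 by move=> Oy Hy; exact: far.
  transitivity (Rintegral mu1 set0 (fun t => eta (t, 0) * a (t, 0))).
    by apply: Rintegral_subset => // t Ot _; rewrite z ?mul0r// /half_plane/=.
  have -> : Rintegral mu2 (O `&` half_plane) (curl_density a b k eta) =
      Rintegral mu2 set0 (curl_density a b k eta).
    apply: Rintegral_subset => // y [Oy Hy] _.
    by apply: (@curl_density0 R O a b k oO eta setT y Ce openT _ Oy Hy) => // w Ow Hw _; exact: z.
  by rewrite /Rintegral !integral_set0.
have Sx : S x by apply: sS; rewrite mem_head.
have [r0 [B [oB BO gB rB]]] := hr x Sx; have [Ox Hx] := SO Sx.
pose beta := bump x (r x); have Cb : C1on O beta := C1on_bump _ _ oO.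
pose z1 y := eta y * beta y; pose z2 y := eta y * (1 - beta y).
have C1 : C1on O z1 := C1onM oO Ce Cb.
have C2 : C1on O z2 := C1onM oO Ce (C1onB oO (C1on_cst 1 oO) Cb).
have v1 : vanish z1 by move=> y Oy Hy nS; rewrite /z1 ve// mul0r.
have v2 : vanish z2 by move=> y Oy Hy nS; rewrite /z2 ve// mul0r.
rewrite (_ : eta = fun y => z1 y + z2 y); last first.
  by apply/funext => y; rewrite /z1 /z2 -mulrDr addrC subrK mulr1.
apply: half_plane_greenD => //.
  apply: (half_plane_green_small oO C1 Hx (_ : 0 < 2 * r x) oB BO gB rB) => [|y _ _ h].
    by rewrite mulr_gt0.
  by rewrite /z1 /beta bump_out// mulr0.
apply: IH => // [y ys|y Oy Hy h]; first by apply: sS; rewrite inE ys orbT.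
rewrite /z2; have [xy|xy] := leP (r x) `|x - y|.
  rewrite far ?mul0r// => w; rewrite inE => /orP[/eqP->//|]; exact: h.
by rewrite /beta (bump_in r0 (ltW xy)) subrr mulr0.
Qed.

End green_half_plane_global.

(** * The connection form *)

Section field_in_chart.
Context {R : realType}.

Lemma differentiable_crossmul (u w : R * R -> 'rV[R]_3) x : differentiable u x -> differentiable w x ->
  differentiable (fun y => crossmul (u y) (w y)) x.
Proof.
move=> du dw; apply: differentiable_rV => i.
rewrite (_ : (fun x => _) = (fun x => u x 0 (i + 1) * w x 0 (i + 2) - u x 0 (i + 2) * w x 0 (i + 1))).
  by apply: differentiableB; apply: differentiableM; exact: differentiable_rV_coord.
by apply/funext => y; rewrite mxE.
Qed.

Lemma derive_crossmul (u w : R * R -> 'rV[R]_3) (x v : R * R) : differentiable u x -> differentiable w x ->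
  'D_v (fun y => crossmul (u y) (w y)) x = crossmul ('D_v u x) (w x) + crossmul (u x) ('D_v w x).
Proof.
move=> du dw; have dc := differentiable_crossmul du dw; apply/rowP => i.
rewrite -(derive_coord v i dc).
have d j l : derivable (fun x => u x 0 j * w x 0 l) x v.
  apply: diff_derivable; apply: differentiableM; exact: differentiable_rV_coord.
have e j l : 'D_v (fun x => u x 0 j * w x 0 l) x = u x 0 j * ('D_v w x) 0 l + w x 0 l * ('D_v u x) 0 j.
  by rewrite deriveM_diff; rewrite ?derive_coord//; exact: differentiable_rV_coord.
rewrite (_ : (fun x => _) = (fun x => u x 0 (i + 1) * w x 0 (i + 2)) - (fun x => u x 0 (i + 2) * w x 0 (i + 1))).
  rewrite (deriveB (d _ _) (d _ _)) !e [in RHS]mxE !mxE.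
  move: ('D_v u x) ('D_v w x) => U W; ring.
by apply/funext => y; rewrite mxE.
Qed.

(* Expand nu and nv in the orthonormal frame (v, n x v, n); vu x vv is parallel to v. *)
Lemma moving_frame_identity (v n vu vv nu nv : 'rV[R]_3) :
  dotmul v v = 1 -> dotmul n n = 1 -> dotmul v n = 0 ->
  dotmul vu v = 0 -> dotmul vv v = 0 -> dotmul nu n = 0 -> dotmul nv n = 0 ->
  dotmul vu n = - dotmul nu v -> dotmul vv n = - dotmul nv v ->
  dotmul (crossmul vu n + crossmul v nu) vv - dotmul (crossmul vv n + crossmul v nv) vu =
  dotmul (crossmul nu nv) n.
Proof.
move=> v1 n1 vn vuv vvv nun nvn hu hv.
have v0 : dotmul v v != 0 by rewrite v1 oner_neq0.
have det0 : dotmul (crossmul vu vv) n = 0 by apply: (coplanar_det0 v0) => //; rewrite dotmulC.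
have nuE := parseval_plane v1 n1 vn nun; have nvE := parseval_plane v1 n1 vn nvn.
have vmn : crossmul v (crossmul n v) = n.
  have E : crossmul v (crossmul n v) = dotmul v v *: n - dotmul v n *: v by vec3; ring.
  by rewrite E v1 vn scale1r scale0r subr0.
set m := crossmul n v in nuE nvE vmn.
set q := dotmul nu m in nuE; set q' := dotmul nv m in nvE.
set p := dotmul nu v in nuE hu; set p' := dotmul nv v in nvE hv.
have E1 : dotmul (crossmul vu n + crossmul v nu) vv = - dotmul (crossmul vu vv) n + q * dotmul (crossmul v m) vv.
  by rewrite {1}nuE; dot3; ring.
have E2 : dotmul (crossmul vv n + crossmul v nv) vu = dotmul (crossmul vu vv) n + q' * dotmul (crossmul v m) vu.
  by rewrite {1}nvE; dot3; ring.
have E3 : dotmul (crossmul nu nv) n = (p * q' - q * p') * dotmul (crossmul v m) n.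
  by rewrite {1}nuE {1}nvE; dot3; ring.
rewrite E1 E2 E3 det0 vmn n1 (dotmulC n vv) (dotmulC n vu) hu hv; ring.
Qed.

Lemma derive_slice (W : normedModType R) (f : R * R -> W) (u v : R) :
  'D_1 (fun t : R => f (t, v)) u = 'D_(1, 0) f (u, v).
Proof.
have fE h : f (h *: (1 : R) + u, v) = f (h *: ((1, 0) : R * R) + (u, v)).
  by congr f; congr pair; rewrite /= ?scaler0 ?add0r.
by rewrite /derive/=; under eq_fun do rewrite fE.
Qed.

Lemma dotmul_sum (u v : 'rV[R]_3) : dotmul u v = \sum_i u 0 i * v 0 i.
Proof. by rewrite dotmulE sum_ord3. Qed.

Lemma dotmul_sumB (u v w z : 'rV[R]_3) :
  dotmul u v - dotmul w z = \sum_i (u 0 i * v 0 i - w 0 i * z 0 i).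
Proof. by rewrite !dotmul_sum -sumrB. Qed.

Variables (M : set 'rV[R]_3) (N V : 'rV[R]_3 -> 'rV[R]_3).
Hypothesis C1V : class_C_on 1 M V.
Hypothesis tangentV : forall p, M p -> dotmul (V p) (N p) = 0.
Hypothesis unitV : forall p, M p -> enorm (V p) = 1.

(** The matrix is arbitrary on normal vectors; it is evaluated only on tangent vectors or in
    expressions that retain its tangential part. *)
Definition along_derivative (p : 'rV[R]_3) : 'M[R]_3 := xget 0 [set L | derivative_along M V p L].

Lemma along_derivativeP p : M p -> derivative_along M V p (along_derivative p).
Proof.
move=> Mp; apply: (@xgetPex _ _ [set L | derivative_along M V p L]).
exact: class_C1_derivative_along.
Qed.

Variables (O : set (R * R)) (phi : R * R -> 'rV[R]_3).
Hypothesis op : oriented_patch M N O phi.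

Let pO : Defs.patch M O phi. Proof. by case: op. Qed.
Let oO : open O. Proof. by case: pO. Qed.

(* V o phi is only known to be C1 after extension across the boundary of the half plane. *)
Lemma field_local_extension x : O x -> half_plane x -> exists (B : set (R * R)) (W : R * R -> 'rV[R]_3),
  [/\ open B, B x, B `<=` regular_set O phi, C1von B W & forall y, B y -> half_plane y -> W y = V (phi y)].
Proof.
move=> Ox Hx; have Mx := patch_sub pO Ox Hx.
have [A [G [oA Ax CG GV]]] := C1V Mx.
have rx := regular_set_half_plane op Ox Hx; have or := regular_set_open op.
have [r1 r10 h1] := open_ball_subset or rx.
have [r2 r20 h2] := open_ball_subset oA Ax.
have [r3 r30 h3] := continuous_for_eps (patch_continuous pO Ox) r20.
exists (ball x (Num.min r1 r3)), (fun y => G (phi y)).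
have Bh y : ball x (Num.min r1 r3) y -> regular_set O phi y /\ A (phi y).
  rewrite -ball_normE /= lt_min => /andP[/h1 ry /h3 /h2 Ay]; by split.
have oB : open (ball x (Num.min r1 r3)) by exact: ball_open.
split.
- exact: oB.
- by apply: ballxx; rewrite lt_min r10.
- by move=> y /Bh[].
- have Cphi : class_C 1 (ball x (Num.min r1 r3)) phi.
    have [d c] := patch_C1 pO; split => [y /Bh[[Oy _] _]|v y /Bh[[Oy _] _]]; [exact: d|exact: (c v)].
  move=> i; apply: (C1on_comp_rV (B := A) (F := fun p => G p 0 i) oB Cphi).
    exact: class_C1_coord.
  by move=> y /Bh[].
- by move=> y /Bh[[Oy _] Ay] Hy; exact: (GV _ (patch_sub pO Oy Hy) Ay).
Qed.

(** The right side does not mention [W]: in the half plane all local extensions have the same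
    derivatives, so the local data assemble into functions on the whole patch. *)
Lemma field_derive x v (B : set (R * R)) (W : R * R -> 'rV[R]_3) : half_plane_dir v -> O x -> half_plane x ->
  open B -> B x -> C1von B W -> (forall y, B y -> half_plane y -> W y = V (phi y)) ->
  'D_v W x = 'D_v phi x *m along_derivative (phi x).
Proof.
move=> hv Ox Hx oB Bx CW WV.
have dL := along_derivativeP (patch_sub pO Ox Hx).
have dW := C1von_differentiable CW Bx.
have [r r0 hr] := open_ball_subset oB Bx.
by apply: (derivative_along_derive pO hv Ox Hx dL dW r0) => y Oy Hy /hr By; exact: WV.
Qed.

Lemma boundary_derive t : O (t, 0) ->
  derive1 (fun s : R => V (phi (s, 0))) t = partial_u phi (t, 0) *m along_derivative (phi (t, 0)).
Proof.
move=> Ot; have Ht : half_plane (t, (0 : R)) by rewrite /half_plane/=.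
have [B [W [oB Bt BO CW WV]]] := field_local_extension Ot Ht.
have hu : half_plane_dir ((1, 0) : R * R) by left.
have E := field_derive hu Ot Ht oB Bt CW WV.
rewrite /partial_u -E -derive_slice derive1E; apply: near_eq_derive.
have [r r0 hr] := open_ball_subset oB Bt.
apply: (@nbhs_of_ball R R t _ r r0) => s ts.
have Hs : half_plane (s, (0 : R)) := lexx 0.
rewrite (WV _ _ Hs)//; apply: hr; rewrite prod_normE/= subrr normr0.
by rewrite (max_l (normr_ge0 _)).
Qed.

(** The coefficient of du in the pull-back of the connection form; [coframe_v] is that of dv. *)
Definition coframe_u x := dotmul (crossmul (V (phi x)) (N (phi x))) (partial_u phi x *m along_derivative (phi x)).

Definition coframe_v x := dotmul (crossmul (V (phi x)) (N (phi x))) (partial_v phi x *m along_derivative (phi x)).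

Definition curvature_density x := gaussian_curvature M N (phi x) * area phi x.

Lemma half_plane_derive_cst (B : set (R * R)) (f : R * R -> R) (c : R) x v : half_plane_dir v -> half_plane x ->
  open B -> B x -> differentiable f x -> (forall y, B y -> half_plane y -> f y = c) -> 'D_v f x = 0.
Proof.
move=> hv Hx oB Bx df fc.
have <- : 'D_v (cst c : R * R -> R) x = 0 by exact: derive_cst.
have [r r0 hr] := open_ball_subset oB Bx.
apply: (@half_plane_derive_eq R R f (cst c) x v r hv Hx r0 _ df); last exact: differentiable_cst.
by move=> y Hy /hr By; exact: fc.
Qed.

(** The relations W . W = 1 and W . n = 0 are known only in the half plane, so they are
    differentiated through [half_plane_derive_cst]. *)
Lemma field_derive_relations x v (B : set (R * R)) (W : R * R -> 'rV[R]_3) : half_plane_dir v -> half_plane x ->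
  open B -> B x -> B `<=` regular_set O phi -> C1von B W ->
  (forall y, B y -> half_plane y -> W y = V (phi y)) ->
  dotmul ('D_v W x) (W x) = 0 /\ dotmul ('D_v W x) (unit_normal phi x) = - dotmul ('D_v (unit_normal phi) x) (W x).
Proof.
move=> hv Hx oB Bx Br CW WV; have dW := C1von_differentiable CW Bx.
have dn := C1von_differentiable (C1von_unit_normal op) (Br _ Bx).
have My y : B y -> half_plane y -> M (phi y) by move=> /Br[Oy _] Hy; exact: patch_sub pO Oy Hy.
have e1 : 'D_v (fun y => dotmul (W y) (W y)) x = 0.
  apply: (half_plane_derive_cst (c := 1) hv Hx oB Bx (differentiable_dotmul dW dW)) => y By Hy.
  by rewrite WV// -sqr_enorm unitV ?expr1n//; exact: My.
have e2 : 'D_v (fun y => dotmul (W y) (unit_normal phi y)) x = 0.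
  apply: (half_plane_derive_cst (c := 0) hv Hx oB Bx (differentiable_dotmul dW dn)) => y By Hy.
  have [Oy _] := Br y By.
  by rewrite WV// (unit_normalE op Oy Hy) tangentV//; exact: My.
rewrite (derive_dotmul _ dW dW) in e1; rewrite (derive_dotmul _ dW dn) in e2.
move: e1 e2; rewrite (dotmulC (W x) ('D_v W x)) (dotmulC (W x) ('D_v (unit_normal phi) x)) => e1 e2.
split; last by apply/eqP; rewrite -addr_eq0; apply/eqP.
by move/eqP: e1; rewrite -mulr2n mulrn_eq0/= => /eqP.
Qed.

Lemma green_data_field x : O x -> half_plane x -> exists B, [/\ open B, B x, B `<=` O &
  green_data B coframe_u coframe_v curvature_density].
Proof.
move=> Ox Hx; have [B [W [oB Bx Br CW WV]]] := field_local_extension Ox Hx.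
exists B; split; [exact: oB|exact: Bx|by move=> y /Br[]|].
have Cn := C1von_sub Br (C1von_unit_normal op).
pose U y := crossmul (W y) (unit_normal phi y).
have CU : C1von B U := C1von_crossmul oB CW Cn.
exists (fun i y => U y 0 i), (fun i y => W y 0 i); split => [i|i|y By Hy]; [exact: CU|exact: CW|].
have [Oy _] := Br y By.
have hu : half_plane_dir ((1, 0) : R * R) by left.
have hv : half_plane_dir ((0, 1) : R * R) by right.
have dW := C1von_differentiable CW By; have dn := C1von_differentiable Cn By.
have UE : U y = crossmul (V (phi y)) (N (phi y)) by rewrite /U WV// (unit_normalE op Oy Hy).
have WE v i : 'D_v (fun y => W y 0 i) y = ('D_v W y) 0 i by rewrite (C1von_derive v i CW By).
have UdE v i : 'D_v (fun y => U y 0 i) y = ('D_v U y) 0 i by rewrite (C1von_derive v i CU By).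
split.
- rewrite /coframe_u -UE -(field_derive hu Oy Hy oB By CW WV) dotmul_sum.
  by apply: eq_bigr => i _; rewrite WE.
- rewrite /coframe_v -UE -(field_derive hv Oy Hy oB By CW WV) dotmul_sum.
  by apply: eq_bigr => i _; rewrite WE.
transitivity (dotmul ('D_(1, 0) U y) ('D_(0, 1) W y) - dotmul ('D_(0, 1) U y) ('D_(1, 0) W y)); last first.
  rewrite dotmul_sumB; apply: eq_bigr => i _.
  by rewrite (WE (1, 0) i) (WE (0, 1) i) (UdE (1, 0) i) (UdE (0, 1) i).
rewrite /U !(derive_crossmul _ dW dn).
have [u1 u2] := field_derive_relations hu Hy oB By Br CW WV.
have [v1 v2] := field_derive_relations hv Hy oB By Br CW WV.
have My := patch_sub pO Oy Hy.
have nE := unit_normalE op Oy Hy; have nn := unit_normal_unit (Br y By).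
have WW : dotmul (W y) (W y) = 1 by rewrite WV// -sqr_enorm unitV ?expr1n.
have Wn : dotmul (W y) (unit_normal phi y) = 0 by rewrite WV// nE tangentV.
have nu := derive_unit_normal_normal op (1, 0) (Br y By).
have nv := derive_unit_normal_normal op (0, 1) (Br y By).
rewrite (moving_frame_identity WW nn Wn u1 v1 nu nv u2 v2).
rewrite -(gaussian_curvature_normal op Oy Hy) dotmulZl (oriented_patch_normal op Oy Hy).
by rewrite -nE dotmulZl nn mulr1.
Qed.

End field_in_chart.

(** * Partitions of unity *)

Section partitions.
Context {R : realType}.
Local Notation mu1 := (@lebesgue_measure R).
Local Notation mu2 := (@lebesgue_measure R \x @lebesgue_measure R)%E.
Variables (M : set 'rV[R]_3) (N : 'rV[R]_3 -> 'rV[R]_3).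
Implicit Types (f g : 'rV[R]_3 -> R) (E : set 'rV[R]_3).

(** Curvature and wedge densities involve choices by [xget] at each point; their continuity becomes
    visible only through formulas in a patch. *)
Definition chart_continuous f := forall O phi, oriented_patch M N O phi ->
  {within O `&` half_plane, continuous (f \o phi)}.

Lemma chart_continuousM f g : chart_continuous f -> chart_continuous g ->
  chart_continuous (fun p => f p * g p).
Proof.
by move=> cf cg O phi op; exact: (within_continuousM (cf O phi op) (cg O phi op)).
Qed.

Lemma chart_continuousD f g : chart_continuous f -> chart_continuous g ->
  chart_continuous (fun p => f p + g p).
Proof.
by move=> cf cg O phi op; exact: (within_continuousD (cf O phi op) (cg O phi op)).
Qed.

Lemma chart_continuous_cst (c : R) : chart_continuous (fun=> c).
Proof. by move=> O phi op; apply: continuous_subspaceT; exact: cst_continuous. Qed.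

Lemma chart_continuous_sum (I : Type) (s : seq I) (F : I -> 'rV[R]_3 -> R) :
  (forall i, chart_continuous (F i)) -> chart_continuous (fun p => \sum_(i <- s) F i p).
Proof.
move=> cF; elim: s => [|i s IH].
  rewrite (_ : (fun p => _) = fun=> 0); first exact: chart_continuous_cst.
  by apply/funext => p; rewrite big_nil.
rewrite (_ : (fun p => _) = fun p => F i p + \sum_(i <- s) F i p).
  exact: chart_continuousD.
by apply/funext => p; rewrite big_cons.
Qed.

Lemma chart_continuous_of_continuous f : continuous f -> chart_continuous f.
Proof.
move=> cf O phi [pO _]; apply: continuous_within => x [Ox _].
by apply: (@continuous_comp _ _ _ phi f); [exact: patch_continuous pO Ox|exact: cf].
Qed.

Lemma chart_continuous_within O phi E f : oriented_patch M N O phi -> E `<=` patch_image O phi ->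
  chart_continuous f -> {within E, continuous f}.
Proof. by move=> op EO cf; have [pO _] := op; apply: (within_continuous_of_chart pO EO); exact: cf. Qed.

Lemma patch_int_sum (I : Type) (s : seq I) (F : I -> 'rV[R]_3 -> R) O phi E :
  oriented_patch M N O phi -> compact E -> E `<=` patch_image O phi ->
  (forall i, chart_continuous (F i)) ->
  patch_int O phi E (fun p => \sum_(i <- s) F i p) = \sum_(i <- s) patch_int O phi E (F i).
Proof.
move=> op cE EO cF; have [pO _] := op; elim: s => [|i s IH].
  rewrite big_nil /patch_int (Rintegral_subset mu2 (B := set0))//.
    by rewrite /Rintegral integral_set0.
  by move=> x _ _; rewrite big_nil mul0r.
have c1 := chart_continuous_within op EO (cF i).
have c2 := chart_continuous_within op EO (chart_continuous_sum (s := s) cF).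
rewrite big_cons -IH -(patch_intD pO cE EO c1 c2).
by apply: patch_int_eq => p _; rewrite big_cons.
Qed.

Section one_partition.
Hypothesis cM : compact M.
Variables (n : nat) (O : 'I_n -> set (R * R)) (phi : 'I_n -> R * R -> 'rV[R]_3) (rho : 'I_n -> 'rV[R]_3 -> R).
Hypothesis pu : partition_of_unity M N O phi rho.

Definition support i := closure [set p | M p /\ rho i p != 0].

Lemma support_image i : support i `<=` patch_image (O i) (phi i).
Proof. by have [_ _ _ h _] := pu; exact: h. Qed.

Lemma support_compact i : compact (support i).
Proof.
apply: subclosed_compact cM _; first exact: closed_closure.
move=> p /support_image[x [Ox Hx] <-]; have [op _ _ _ _] := pu; have [pO _] := op i.
exact: patch_sub pO Ox Hx.
Qed.

Lemma partition_off_support i p : M p -> ~ support i p -> rho i p = 0.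
Proof.
move=> Mp nS; apply/eqP/negPn/negP => r0; apply: nS.
by apply: subset_closure; split.
Qed.

Lemma partition_chart_continuous i : chart_continuous (rho i).
Proof.
apply: chart_continuous_of_continuous => p; have [_ sm _ _ _] := pu.
exact: (sm i 0%N p I).
Qed.

End one_partition.

(** Stated for any family [F i] that vanishes off the support of [rho i], not just for [rho i] times
    a fixed function: it will be applied to densities that contain derivatives of [rho i]. Each
    product [rho' j * F i] changes patch on the intersection of two compact supports. *)
Lemma partition_exchange n (O : 'I_n -> set (R * R)) (phi : 'I_n -> R * R -> 'rV[R]_3) rho
    m (O' : 'I_m -> set (R * R)) (phi' : 'I_m -> R * R -> 'rV[R]_3) rho' (F : 'I_n -> 'rV[R]_3 -> R) :
  compact M -> partition_of_unity M N O phi rho -> partition_of_unity M N O' phi' rho' ->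
  (forall i, chart_continuous (F i)) -> (forall i p, M p -> ~ support rho i p -> F i p = 0) ->
  \sum_i patch_int (O i) (phi i) (support rho i) (F i) =
  \sum_j patch_int (O' j) (phi' j) (support rho' j) (fun p => rho' j p * \sum_i F i p).
Proof.
move=> cM pu pu' cF F0.
have [op _ _ _ _] := pu; have [op' _ _ _ sum1] := pu'.
have cF' i j : chart_continuous (fun p => rho' j p * F i p).
  exact: (chart_continuousM (partition_chart_continuous pu' (i := j)) (cF i)).
have E1 i : patch_int (O i) (phi i) (support rho i) (F i) =
    \sum_j patch_int (O i) (phi i) (support rho i) (fun p => rho' j p * F i p).
  rewrite -(patch_int_sum _ (op i) (support_compact cM pu (i := i)) (support_image pu (i := i)) (cF' i)).
  apply: patch_int_eq => p Sp; rewrite -mulr_suml sum1 ?mul1r//.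
  have [x [Ox Hx] <-] := support_image pu Sp; have [pO _] := op i; exact: patch_sub pO Ox Hx.
have E2 j : patch_int (O' j) (phi' j) (support rho' j) (fun p => rho' j p * \sum_i F i p) =
    \sum_i patch_int (O' j) (phi' j) (support rho' j) (fun p => rho' j p * F i p).
  rewrite -(patch_int_sum _ (op' j) (support_compact cM pu' (i := j)) (support_image pu' (i := j)) (cF'^~ j)).
  by apply: patch_int_eq => p Sp; rewrite mulr_sumr.
apply: (etrans (eq_bigr _ (fun i _ => E1 i))).
apply: (etrans _ (esym (eq_bigr _ (fun j _ => E2 j)))).
apply: (etrans (exchange_big _ _ _ _ _ _)).
apply: eq_bigr => j _; apply: eq_bigr => i _.
have sub : support rho i `&` support rho' j `<=` support rho i by move=> p [].
have sub' : support rho i `&` support rho' j `<=` support rho' j by move=> p [].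
have Mi p : support rho i p -> M p.
  move=> /(support_image pu)[x [Ox Hx] <-]; have [pO _] := op i; exact: patch_sub pO Ox Hx.
have Mj p : support rho' j p -> M p.
  move=> /(support_image pu')[x [Ox Hx] <-]; have [pO _] := op' j; exact: patch_sub pO Ox Hx.
rewrite (patch_int_sub (O i) (phi i) sub); last first.
  move=> p Sp nS; rewrite (partition_off_support (i := j) (Mi p Sp)) ?mul0r// => Sp'.
  exact: nS.
rewrite (patch_int_sub (O' j) (phi' j) sub'); last first.
  move=> p Sp nS; rewrite (F0 i p (Mj p Sp)) ?mulr0// => Sp'.
  exact: nS.
have EO := subset_trans sub (support_image pu (i := i)).
have EO' := subset_trans sub' (support_image pu' (i := j)).
have cE : compact (support rho i `&` support rho' j).
  apply: subclosed_compact (support_compact cM pu (i := i)) sub.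
  by apply: closedI; exact: closed_closure.
symmetry; apply: (patch_int_indep (op i) (op' j) cE EO EO').
exact: (chart_continuous_within (op i) EO (cF' i j)).
Qed.

End partitions.

Lemma det_zero_row {F : pzRingType} (p q a b : F) : p = 0 -> q = 0 -> p * b - q * a = 0.
Proof. by move=> -> ->; rewrite !mul0r subrr. Qed.

Lemma sum_det_zero_row {F : pzRingType} n (p q : 'I_n -> F) (a b : F) :
  \sum_i p i = 0 -> \sum_i q i = 0 -> \sum_i (p i * b - q i * a) = 0.
Proof. by move=> p0 q0; rewrite sumrB -!mulr_suml; exact: det_zero_row. Qed.

(** * Stokes' theorem for the connection form *)

Section connection_form_integral.
Context {R : realType}.
Local Notation mu1 := (@lebesgue_measure R).
Local Notation mu2 := (@lebesgue_measure R \x @lebesgue_measure R)%E.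
Variables (M : set 'rV[R]_3) (N V : 'rV[R]_3 -> 'rV[R]_3).
Hypothesis cM : compact M.
Hypothesis orientM : orientation M N.
Hypothesis C1V : class_C_on 1 M V.
Hypothesis tangentV : forall p, M p -> dotmul (V p) (N p) = 0.
Hypothesis unitV : forall p, M p -> enorm (V p) = 1.

Definition gradient (rho : 'rV[R]_3 -> R) p : 'rV[R]_3 := \row_i 'D_(delta_mx 0 i) rho p.

(* The density of d rho /\ omega with respect to dA, where omega = (V x N) . dV. *)
Definition wedge_density (rho : 'rV[R]_3 -> R) p : R :=
  dotmul (crossmul (gradient rho p) (crossmul (V p) (N p) *m (along_derivative M V p)^T)) (N p).

Lemma dotmul_adjoint (u v : 'rV[R]_3) (L : 'M[R]_3) : dotmul u (v *m L) = dotmul (u *m L^T) v.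
Proof. by rewrite /dotmul trmx_mul mulmxA. Qed.

Section one_chart.
Variables (O : set (R * R)) (phi : R * R -> 'rV[R]_3).
Hypothesis op : oriented_patch M N O phi.
Variable rho : 'rV[R]_3 -> R.
Hypothesis Crho : class_C 1 setT rho.

Let pO : Defs.patch M O phi. Proof. by case: op. Qed.
Let oO : open O. Proof. by case: pO. Qed.

Lemma C1on_chart : C1on O (rho \o phi).
Proof. exact: (C1on_comp_rV oO (patch_C1 pO) Crho). Qed.

Lemma derive_chart x v : O x -> 'D_v (rho \o phi) x = dotmul (gradient rho (phi x)) ('D_v phi x).
Proof.
move=> Ox; have [dr _] := Crho; have [dp _] := patch_C1 pO.
rewrite (derive_comp_rV v (dr _ I) (dp _ Ox)) dotmulC dotmul_sum.
by apply: eq_bigr => i _; rewrite mxE.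
Qed.

(** Lagrange's identity, after moving the matrix to the other side of the dot product by
    transposition. It shows that a density defined on [M] represents the form in every oriented
    patch. *)
Lemma wedge_density_chart x : O x -> half_plane x ->
  wedge_density rho (phi x) * area phi x =
  'D_(1, 0) (rho \o phi) x * coframe_v M N V phi x - 'D_(0, 1) (rho \o phi) x * coframe_u M N V phi x.
Proof.
move=> Ox Hx; have nE := oriented_patch_normal op Ox Hx.
have eu := derive_chart (1, 0) Ox; have ev := derive_chart (0, 1) Ox.
have aE : coframe_u M N V phi x = dotmul (crossmul (V (phi x)) (N (phi x)) *m (along_derivative M V (phi x))^T) (partial_u phi x).
  exact: dotmul_adjoint.
have bE : coframe_v M N V phi x = dotmul (crossmul (V (phi x)) (N (phi x)) *m (along_derivative M V (phi x))^T) (partial_v phi x).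
  exact: dotmul_adjoint.
rewrite eu ev aE bE /wedge_density mulrC -dotmulZr.
move: nE; rewrite -/(area phi x) => <-.
exact: lagrange_identity.
Qed.

Lemma wedge_density_continuous : {within O `&` half_plane, continuous (wedge_density rho \o phi)}.
Proof.
have [ca cb _] := green_data_continuous (green_data_field C1V tangentV unitV op).
have ce (f : R * R -> R) : (forall x, O x -> {for x, continuous f}) -> {within O `&` half_plane, continuous f}.
  by move=> cf; apply: continuous_within => x [Ox _]; exact: cf.
have c1 : {within O `&` half_plane, continuous ('D_(1, 0) (rho \o phi))}.
  by apply: ce => x Ox; have [_ c _] := C1on_chart Ox.
have c2 : {within O `&` half_plane, continuous ('D_(0, 1) (rho \o phi))}.
  by apply: ce => x Ox; have [_ _ c] := C1on_chart Ox.
have ci : {within O `&` half_plane, continuous (fun x => (area phi x)^-1)}.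
  apply: continuous_within => x [Ox Hx]; apply: continuousV; last exact: continuous_area pO Ox.
  by have := patch_area_gt0 pO Ox Hx => h; rewrite gt_eqF.
have ch := within_continuousM ci (within_continuousB (within_continuousM c1 cb) (within_continuousM c2 ca)).
apply/within_continuousP => x Ax e e0; have [r r0 hr] := (within_continuousP _ _).1 ch x Ax e e0.
have E y : (O `&` half_plane) y -> wedge_density rho (phi y) =
    (area phi y)^-1 * ('D_(1, 0) (rho \o phi) y * coframe_v M N V phi y -
      'D_(0, 1) (rho \o phi) y * coframe_u M N V phi y).
  move=> [Oy Hy]; rewrite -(wedge_density_chart Oy Hy) mulrCA mulVf ?mulr1//.
  by have := patch_area_gt0 pO Oy Hy => h; rewrite gt_eqF.
by exists r => // y Ay xy /=; rewrite (E _ Ax) (E _ Ay); exact: hr.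
Qed.

Lemma wedge_density0 x (Z : set 'rV[R]_3) : O x -> half_plane x -> open Z -> Z (phi x) ->
  (forall q, M q -> Z q -> rho q = 0) -> wedge_density rho (phi x) = 0.
Proof.
move=> Ox Hx oZ Zx r0.
have [r2 r20 h2] := open_ball_subset oZ Zx.
have [r3 r30 h3] := continuous_for_eps (patch_continuous pO Ox) r20.
have oB : open (ball x r3) by exact: ball_open.
have z y : O y -> half_plane y -> ball x r3 y -> (rho \o phi) y = 0.
  move=> Oy Hy; rewrite -ball_normE /= => /h3/h2 Zy; apply: (r0 _ _ Zy).
  exact: patch_sub pO Oy Hy.
have Bx : ball x r3 x by exact: ballxx.
have du : 'D_(1, 0) (rho \o phi) x = 0.
  by apply: (half_plane_derive0 oO C1on_chart oB z Ox Hx Bx); left.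
have dv : 'D_(0, 1) (rho \o phi) x = 0.
  by apply: (half_plane_derive0 oO C1on_chart oB z Ox Hx Bx); right.
have w0 : area phi x != 0 := lt0r_neq0 (patch_area_gt0 pO Ox Hx).
have /eqP := etrans (wedge_density_chart Ox Hx) (det_zero_row _ _ du dv).
by rewrite mulf_eq0 (negbTE w0) orbF => /eqP.
Qed.

End one_chart.

Lemma class_C1_of_smooth (rho : 'rV[R]_3 -> R) : smooth setT rho -> class_C 1 setT rho.
Proof. by move=> sm; exact: (sm 1%N). Qed.

Section one_partition.
Variables (n : nat) (O : 'I_n -> set (R * R)) (phi : 'I_n -> R * R -> 'rV[R]_3) (rho : 'I_n -> 'rV[R]_3 -> R).
Hypothesis pu : partition_of_unity M N O phi rho.

Let Crho i : class_C 1 setT (rho i).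
Proof. by have [_ sm _ _ _] := pu; exact: class_C1_of_smooth. Qed.

(** The functions sum to 1 only on [M], so the sum of their gradients may have a normal part. In a
    patch only the tangential derivatives appear, and these add up to 0. *)
Lemma sum_wedge_density p : M p -> \sum_i wedge_density (rho i) p = 0.
Proof.
move=> Mp; have [Q [psi [op [x [Ox Hx] xp]]]] := orientM Mp; rewrite -xp.
have [pO _] := op; have oQ : open Q by case: pO.
have [_ _ _ _ sum1] := pu.
have d i : differentiable (rho i \o psi) x by have [] := C1on_chart op (Crho i) Ox.
have D v : half_plane_dir v -> \sum_i 'D_v (rho i \o psi) x = 0.
  move=> hv; rewrite -derive_sum; last by move=> i; exact: diff_derivable.
  apply: (half_plane_derive_cst (c := 1) hv Hx oQ Ox); first exact: differentiable_sum.
  by move=> y Oy Hy; rewrite fct_sumE; apply: sum1; exact: patch_sub pO Oy Hy.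
have w0 := patch_area_gt0 pO Ox Hx.
apply: (mulIf (lt0r_neq0 w0)); rewrite mul0r mulr_suml -/(area psi x).
transitivity (\sum_i ('D_(1, 0) (rho i \o psi) x * coframe_v M N V psi x -
    'D_(0, 1) (rho i \o psi) x * coframe_u M N V psi x)).
  by apply: eq_bigr => i _; exact: (wedge_density_chart op (Crho i) Ox Hx).
have Du := D (1, 0) (or_introl erefl); have Dv := D (0, 1) (or_intror erefl).
exact: sum_det_zero_row Du Dv.
Qed.

(** The density of d(rho_i omega) with respect to dA. *)
Definition stokes_density i p := rho i p * gaussian_curvature M N p + wedge_density (rho i) p.

Lemma stokes_density_chart_continuous i : chart_continuous M N (stokes_density i).
Proof.
apply: chart_continuousD; last by move=> Q psi op; exact: (wedge_density_continuous op (Crho i)).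
apply: chart_continuousM; first exact: (partition_chart_continuous pu (i := i)).
by move=> Q psi op; exact: gaussian_curvature_continuous.
Qed.

Lemma stokes_density_off_support i p : M p -> ~ support M rho i p -> stokes_density i p = 0.
Proof.
move=> Mp nS; rewrite /stokes_density (partition_off_support Mp nS) mul0r add0r.
have [Q [psi [op [x [Ox Hx] xp]]]] := orientM Mp; rewrite -xp.
have oZ : open (~` support M rho i) by apply: closed_openC; exact: closed_closure.
apply: (wedge_density0 op (Crho i) Ox Hx oZ); first by rewrite xp; exact: nS.
by move=> q Mq nq; exact: (partition_off_support Mq nq).
Qed.

Lemma boundary_piece i :
  Rintegral mu1 [set t : R | O i (t, 0)]
    (fun t => rho i (phi i (t, 0)) * dotmul (crossmul (V (phi i (t, 0))) (N (phi i (t, 0))))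
                                            (derive1 (fun s : R => V (phi i (s, 0))) t)) =
  patch_int (O i) (phi i) (support M rho i) (stokes_density i).
Proof.
have [op' _ _ _ _] := pu; have op := op' i; have [pO _] := op; have [oO _ _ _ _] := pO.
have cS := patch_preimage_compact pO (support_compact cM pu (i := i)) (support_image pu (i := i)).
have SO : patch_preimage (O i) (phi i) (support M rho i) `<=` O i `&` half_plane by move=> x [].
have loc := green_data_field C1V tangentV unitV op.
have Ce := C1on_chart op (Crho i).
have ve x : O i x -> half_plane x -> ~ patch_preimage (O i) (phi i) (support M rho i) x ->
    (rho i \o phi i) x = 0.
  move=> Ox Hx nS; apply: (partition_off_support (patch_sub pO Ox Hx)) => Sx; exact: nS.
have := half_plane_green_compact oO loc cS SO Ce ve; rewrite /half_plane_green => G.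
rewrite -(patch_int_total pO (stokes_density_off_support (i := i))).
transitivity (Rintegral mu1 [set t : R | O i (t, 0)]
    (fun t => (rho i \o phi i) (t, 0) * coframe_u M N V (phi i) (t, 0))).
  apply: eq_Rintegral => t; rewrite inE => Ot.
  by rewrite (boundary_derive C1V op Ot).
apply: (etrans G); apply: eq_Rintegral => x; rewrite inE => -[Ox Hx].
rewrite /curl_density -addrA -(wedge_density_chart op (Crho i) Ox Hx).
by rewrite /stokes_density mulrDl /curvature_density mulrA.
Qed.

End one_partition.

(** Two partitions occur because the two integrals choose theirs separately. Green's formula is
    applied in the patches of the first; after the transfer to the second, the sum over the first
    leaves K alone. *)
Lemma partition_stokes n (O : 'I_n -> set (R * R)) (phi : 'I_n -> R * R -> 'rV[R]_3) rho
    m (O' : 'I_m -> set (R * R)) (phi' : 'I_m -> R * R -> 'rV[R]_3) rho' :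
  partition_of_unity M N O phi rho -> partition_of_unity M N O' phi' rho' ->
  \sum_i Rintegral mu1 [set t : R | O i (t, 0)]
    (fun t => rho i (phi i (t, 0)) * dotmul (crossmul (V (phi i (t, 0))) (N (phi i (t, 0))))
                                            (derive1 (fun s : R => V (phi i (s, 0))) t)) =
  \sum_j Rintegral mu2 (O' j `&` half_plane)
    (fun x => rho' j (phi' j x) * gaussian_curvature M N (phi' j x) * enorm (normal_product (phi' j) x)).
Proof.
move=> pu pu'; have [op _ _ _ sum1] := pu; have [op' _ _ _ _] := pu'.
apply: (etrans (eq_bigr _ (fun i _ => boundary_piece pu i))).
apply: (etrans (partition_exchange cM pu pu' (stokes_density_chart_continuous pu) (stokes_density_off_support pu))).
apply: eq_bigr => j _; have [pO' _] := op' j.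
have z p : M p -> ~ support M rho' j p -> rho' j p * gaussian_curvature M N p = 0.
  by move=> Mp nS; rewrite (partition_off_support Mp nS) mul0r.
rewrite -[RHS]/(Rintegral mu2 (O' j `&` half_plane) (fun x =>
  (fun p => rho' j p * gaussian_curvature M N p) (phi' j x) * enorm (normal_product (phi' j) x))).
rewrite (patch_int_total pO' z); apply: patch_int_eq => p Sp; congr (_ * _).
have Mp : M p.
  by have [x [Ox Hx] <-] := support_image pu' Sp; exact: patch_sub pO' Ox Hx.
by rewrite big_split /= (sum_wedge_density pu Mp) addr0 -mulr_suml (sum1 _ Mp) mul1r.
Qed.

End connection_form_integral.

Theorem mainTheorem4 (R : realType) (M : set 'rV[R]_3)
    (N V : 'rV[R]_3 -> 'rV[R]_3)
    (surfM : surface_with_boundary M)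
    (compactM : compact M)
    (orientM : orientation M N)
    (C1V : class_C_on 1 M V)
    (tangentV : forall p, M p -> dotmul (V p) (N p) = 0)
    (unitV : forall p, M p -> enorm (V p) = 1) :
  boundary_integral M N (fun p => crossmul (V p) (N p)) V =
  surface_integral M N (gaussian_curvature M N).
Proof.
have [[n [A [phi [rho pu]]]]|no] := pselect (exists n O phi rho, @partition_of_unity R M N n O phi rho).
  rewrite /boundary_integral /surface_integral.
  set SB := [set I | _]; set SS := (X in _ = xget 0 X).
  have : SB (xget 0 SB) by apply: xgetPex; eexists; exists n, A, phi, rho; split; [exact: pu|reflexivity].
  have : SS (xget 0 SS) by apply: xgetPex; eexists; exists n, A, phi, rho; split; [exact: pu|reflexivity].
  move=> [m [A' [phi' [rho' [pu' ->]]]]] [l [A1 [phi1 [rho1 [pu1 ->]]]]].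
  have h := partition_stokes compactM orientM C1V tangentV unitV pu1 pu'.
  exact h.
(* In the absence of any partition of unity both sides are the default value 0. *)
rewrite /boundary_integral /surface_integral !xgetPN//.
- by move=> I [m [A [phi [rho [pu _]]]]]; apply: no; exists m, A, phi, rho.
- by move=> I [m [A [phi [rho [pu _]]]]]; apply: no; exists m, A, phi, rho.
Qed.
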